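(* For $i=1,2$, let $\mathfrak{V}_i\subseteq\mathbb{D}_{Q_i}\subset\mathbb{M}^{d_i}$ be a homogeneous subvariety of a nc operator ball. Then for every completely contractive homomorphism $\varphi:A(\mathfrak{V}_1)\to A(\mathfrak{V}_2)$ there exists a uniformly continuous nc map $F:\overline{\mathfrak{V}_2}\to\overline{\mathfrak{V}_1}$ such that $\varphi(f)=f\circ F$ for all $f\in A(\mathfrak{V}_1)$. Conversely, every uniformly continuous nc map $F:\overline{\mathfrak{V}_2}\to\overline{\mathfrak{V}_1}$ gives rise, via $\varphi(f)=f\circ F$, to a continuous completely contractive homomorphism $\varphi:A(\mathfrak{V}_1)\to A(\mathfrak{V}_2)$. Moreover, the following are equivalent: (1) There is a completely isometric isomorphism $\varphi:A(\mathfrak{V}_1)\to A(\mathfrak{V}_2)$. (2) There is a uniformly continuous nc biholomorphism $G:\overline{\mathfrak{V}_1}\to\overline{\mathfrak{V}_2}$ with a uniformly continuous inverse. (3) There is a uniformly continuous nc biholomorphism $G:\mathfrak{V}_1\to\mathfrak{V}_2$ with a uniformly continuous inverse.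
   Context: $M_n^d$ is the set of $d$-tuples of complex $n\times n$ matrices, with $\|X\|_\infty=\max_j\|X_j\|$; $\mathbb{M}^d=\sqcup_{n\ge1}M_n^d$; for $\Omega\subseteq\mathbb{M}^d$, $\Omega(n)=\Omega\cap M_n^d$ and $\overline{\Omega}=\sqcup_n\overline{\Omega(n)}$ is the level-wise closure in $\mathbb{M}^d$. $\Omega$ is a nc set if it is closed under direct sums. A nc map $f:\Omega\to\mathbb{M}^l$ on a nc set is a map that is graded ($X\in\Omega(n)\Rightarrow f(X)\in M_n^l$), satisfies $f(X\oplus Y)=f(X)\oplus f(Y)$, and $f(S^{-1}XS)=S^{-1}f(X)S$ whenever $S\in GL_n$ and $X,S^{-1}XS\in\Omega(n)$. It is uniformly continuous if for each $\epsilon>0$ there is $\delta>0$ such that $\|f(X)-f(Y)\|_\infty<\epsilon$ for all $n$ and all $X,Y\in\Omega(n)$ with $\|X-Y\|_\infty<\delta$. A nc biholomorphism between nc sets is a bijective nc map (its inverse is then also nc). NC operator ball: given Hilbert spaces $\mathcal{R},\mathcal{S}$ and linearly independent $Q_1,\dots,Q_d\in\mathcal{L}(\mathcal{R},\mathcal{S})$ (bounded operators), put $Q(X)=\sum_jQ_j\otimes X_j$ for $X\in\mathbb{M}^d$ and $\mathbb{D}_Q=\{X\in\mathbb{M}^d:\|Q(X)\|<1\}$. (Here $Q_1$, $Q_2$ as subscripts of $\mathbb{D}_{Q_i}$ denote two such linear polynomials, in $d_1$ and $d_2$ variables respectively.) $H^\infty(\mathbb{D}_Q)$ is the algebra of bounded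 nc functions $\mathbb{D}_Q\to\mathbb{M}^1$. A subvariety of $\mathbb{D}_Q$ is a set $\mathfrak{V}=\{X\in\mathbb{D}_Q: f(X)=0\ \forall f\in S\}$ with $S\subseteq H^\infty(\mathbb{D}_Q)$; it is homogeneous if $\lambda\mathfrak{V}\subseteq\mathfrak{V}$ for all $\lambda\in\mathbb{C}$, $|\lambda|\le1$. $H^\infty(\mathfrak{V})$ is the algebra of bounded nc functions on $\mathfrak{V}$ with norm $\|f\|=\sup_{X\in\mathfrak{V}}\|f(X)\|$ and matrix norms $\|[f_{jk}]\|=\sup_{X\in\mathfrak{V}}\|[f_{jk}(X)]\|$; $A(\mathfrak{V})$ is the norm closure in $H^\infty(\mathfrak{V})$ of the restrictions to $\mathfrak{V}$ of free nc polynomials. Elements of $A(\mathfrak{V})$ are uniformly continuous and so are regarded as functions on $\overline{\mathfrak{V}}$ by continuous extension. Homomorphisms and isomorphisms are of algebras; ''completely contractive'' and ''completely isometric'' refer to the matrix norms above. *)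

(* Defs.v *)
From HB Require Import structures.
From mathcomp Require Import all_boot all_order all_algebra.
From mathcomp Require Import all_classical all_reals all_analysis.
From mathcomp Require Import complex.
Import Order.TTheory GRing.Theory Num.Theory numFieldNormedType.Exports.

Local Open Scope classical_set_scope.
Local Open Scope ring_scope.

(* Norms of complex normed modules take values in the (partially ordered) field
   R[i]; the norms below are the corresponding elements of R, so that suprema
   can be taken. *)

(* Norm of the Hilbert sum of n copies of H, i.e. of H (x) C^n. *)
Definition l2norm {R : realType} {H : normedModType R[i]} {n : nat}
    (v : 'I_n -> H) : R :=
  Num.sqrt (\sum_(i < n) (complex.Re `|v i|) ^+ 2).

Definition opnorm {R : realType} {H K : normedModType R[i]} {m n : nat}
    (T : ('I_n -> H) -> ('I_m -> K)) : R :=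
  sup [set l2norm (T v) | v in [set v | l2norm v <= 1]].

Definition mnorm {R : realType} {m n : nat} (A : 'M[R[i]]_(m, n)) : R :=
  @opnorm R R[i]^o R[i]^o m n (fun v i => \sum_(k < n) A i k * v k).

Record hilbert (R : realType) := Hilbert {
  hcarrier :> completeNormedModType R[i];
  hdot : {dot hcarrier for Num.conj};
  hdotE : forall v : hcarrier, `|v| ^+ 2 = hdot v v }.
Arguments hdot {R} h.
Arguments hdotE {R} h v.

Record pencil (R : realType) (d : nat) := Pencil {
  pdom : hilbert R;
  pcod : hilbert R;
  pcoef : 'I_d -> {linear pdom -> pcod};
  pcoef_bounded : forall j, exists M : R[i], forall v, `|pcoef j v| <= M * `|v|;
  pcoef_free : forall c : 'I_d -> R[i],
    (forall v, \sum_(j < d) c j *: pcoef j v = 0) -> forall j, c j = 0 }.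
Arguments pdom {R d} p.
Arguments pcod {R d} p.
Arguments pcoef {R d} p j.
Arguments pcoef_bounded {R d} p j.
Arguments pcoef_free {R d} p c.

Definition mtuple (R : realType) (d n : nat) := 'I_d -> 'M[R[i]]_n.

(* Q(X) = \sum_j Q_j (x) X_j, acting from H (x) C^n to K (x) C^n. *)
Definition pencil_eval {R : realType} {d : nat} (Q : pencil R d) {n : nat}
    (X : mtuple R d n) (v : 'I_n -> pdom Q) : 'I_n -> pcod Q :=
  fun i => \sum_(j < d) \sum_(k < n) X j i k *: pcoef Q j (v k).

Definition tnorm {R : realType} {d n : nat} (X : mtuple R d n) : R :=
  \big[Num.max/0]_(j < d) mnorm (X j).

Definition tdist {R : realType} {d n : nat} (X Y : mtuple R d n) : R :=
  tnorm (fun j => X j - Y j).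

Definition dsum {R : realType} {d m n : nat} (X : mtuple R d m)
    (Y : mtuple R d n) : mtuple R d (m + n) :=
  fun j => block_mx (X j) 0 0 (Y j).

Definition tconj {R : realType} {d n : nat} (S : 'M[R[i]]_n)
    (X : mtuple R d n) : mtuple R d n :=
  fun j => invmx S *m X j *m S.

(* A subset of M^d, given by its levels. The sizes n >= 1 are the meaningful
   ones: level 0 is empty for nc operator balls, hence for all their subsets and
   the closures of these. *)
Definition ncdom (R : realType) (d : nat) := forall n : nat, set (mtuple R d n).

Definition ncclosure {R : realType} {d : nat} (V : ncdom R d) : ncdom R d :=
  fun n => [set X | forall e : R, 0 < e -> exists2 Y, V n Y & tdist X Y < e].

Definition opball {R : realType} {d : nat} (Q : pencil R d) : ncdom R d :=
  fun n => [set X | (0 < n)%N /\ opnorm (pencil_eval Q X) < 1].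

Definition tupfun {R : realType} {d : nat} (V : ncdom R d) (l : nat) :=
  forall n, V n -> mtuple R l n.

Definition is_nc {R : realType} {d : nat} {V : ncdom R d} {l : nat}
    (f : tupfun V l) : Prop :=
  (forall m n (X : V m) (Y : V n) (Z : V (m + n)%N),
     val Z = dsum (val X) (val Y) -> f _ Z = dsum (f _ X) (f _ Y)) /\
  (forall n (S : 'M[R[i]]_n) (X Y : V n),
     S \in unitmx -> val Y = tconj S (val X) -> f _ Y = tconj S (f _ X)).

Definition nc_unif_continuous {R : realType} {d : nat} {V : ncdom R d} {l : nat}
    (f : tupfun V l) : Prop :=
  forall e : R, 0 < e -> exists2 dl : R, 0 < dl &
    forall n (X Y : V n),
      tdist (val X) (val Y) < dl -> tdist (f n X) (f n Y) < e.

Definition ncmap {R : realType} {d l : nat} (V : ncdom R d) (W : ncdom R l) :=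
  forall n, V n -> W n.

Definition tupfun_of_map {R : realType} {d l : nat} {V : ncdom R d}
    {W : ncdom R l} (F : ncmap V W) : tupfun V l := fun n X => val (F n X).

Definition nc_biholomorphism {R : realType} {d l : nat} {V : ncdom R d}
    {W : ncdom R l} (G : ncmap V W) : Prop :=
  is_nc (tupfun_of_map G) /\ forall n, bijective (G n).

Definition uc_nc_biholomorphism {R : realType} {d l : nat} {V : ncdom R d}
    {W : ncdom R l} (G : ncmap V W) : Prop :=
  [/\ nc_biholomorphism G, nc_unif_continuous (tupfun_of_map G) &
      exists H : ncmap W V,
        [/\ forall n, cancel (G n) (H n), forall n, cancel (H n) (G n) &
            nc_unif_continuous (tupfun_of_map H)]].

(* Functions V -> M^1; M^1 is identified with the disjoint union of the M_n. *)
Definition scalfun {R : realType} {d : nat} (V : ncdom R d) : Type :=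
  forall n, V n -> 'M[R[i]]_n.

Lemma scalfunP {R : realType} {d : nat} {V : ncdom R d} (f g : scalfun V) :
  (forall n X, f n X = g n X) -> f = g.
Proof. by move=> fg; apply: functional_extensionality_dep => n; apply/funext. Qed.

Section ScalfunAlgebra.
Context {R : realType} {d : nat} {V : ncdom R d}.
Implicit Types f g h : scalfun V.

Definition sf_zero : scalfun V := fun n X => 0.
Definition sf_opp f : scalfun V := fun n X => - f n X.
Definition sf_add f g : scalfun V := fun n X => f n X + g n X.
Definition sf_one : scalfun V := fun n X => 1%:M.
Definition sf_mul f g : scalfun V := fun n X => f n X *m g n X.
Definition sf_scale (a : R[i]) f : scalfun V := fun n X => a *: f n X.

HB.instance Definition _ := gen_eqMixin (scalfun V).
HB.instance Definition _ := gen_choiceMixin (scalfun V).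

Fact sf_addA : associative sf_add.
Proof. by move=> f g h; apply/scalfunP => n X; apply: addrA. Qed.
Fact sf_addC : commutative sf_add.
Proof. by move=> f g; apply/scalfunP => n X; apply: addrC. Qed.
Fact sf_add0 : left_id sf_zero sf_add.
Proof. by move=> f; apply/scalfunP => n X; apply: add0r. Qed.
Fact sf_addN : left_inverse sf_zero sf_opp sf_add.
Proof. by move=> f; apply/scalfunP => n X; apply: addNr. Qed.
HB.instance Definition _ :=
  GRing.isZmodule.Build (scalfun V) sf_addA sf_addC sf_add0 sf_addN.

Fact sf_mulA : associative sf_mul.
Proof. by move=> f g h; apply/scalfunP => n X; apply: mulmxA. Qed.
Fact sf_mul1l : left_id sf_one sf_mul.
Proof. by move=> f; apply/scalfunP => n X; apply: mul1mx. Qed.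
Fact sf_mul1r : right_id sf_one sf_mul.
Proof. by move=> f; apply/scalfunP => n X; apply: mulmx1. Qed.
Fact sf_mulDl : left_distributive sf_mul +%R.
Proof. by move=> f g h; apply/scalfunP => n X; apply: mulmxDl. Qed.
Fact sf_mulDr : right_distributive sf_mul +%R.
Proof. by move=> f g h; apply/scalfunP => n X; apply: mulmxDr. Qed.
HB.instance Definition _ := GRing.Zmodule_isPzRing.Build (scalfun V)
  sf_mulA sf_mul1l sf_mul1r sf_mulDl sf_mulDr.

Fact sf_scaleA a b f : sf_scale a (sf_scale b f) = sf_scale (a * b) f.
Proof. by apply/scalfunP => n X; apply: scalerA. Qed.
Fact sf_scale1 : left_id 1 sf_scale.
Proof. by move=> f; apply/scalfunP => n X; apply: scale1r. Qed.
Fact sf_scaleDr : right_distributive sf_scale +%R.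
Proof. by move=> a f g; apply/scalfunP => n X; apply: scalerDr. Qed.
Fact sf_scaleDl f : {morph sf_scale^~ f : a b / a + b}.
Proof. by move=> a b; apply/scalfunP => n X; apply: scalerDl. Qed.
HB.instance Definition _ := GRing.Zmodule_isLmodule.Build R[i] (scalfun V)
  sf_scaleA sf_scale1 sf_scaleDr sf_scaleDl.

End ScalfunAlgebra.

Definition tupfun_of_scal {R : realType} {d : nat} {V : ncdom R d}
    (f : scalfun V) : tupfun V 1 := fun n X _ => f n X.

Definition supnorm {R : realType} {d : nat} {V : ncdom R d}
    (f : scalfun V) : R :=
  sup [set r | exists n (X : V n), r = mnorm (f n X)].

Definition supnorm_mx {R : realType} {d : nat} {V : ncdom R d} {k : nat}
    (f : 'M[scalfun V]_k) : R :=
  sup [set r | exists n (X : V n),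
                 r = mnorm (\mxblock_(i < k, j < k) (f i j n X))].

Definition Hinf {R : realType} {d : nat} (V : ncdom R d) : set (scalfun V) :=
  [set f | is_nc (tupfun_of_scal f) /\
           exists M : R, forall n (X : V n), mnorm (f n X) <= M].

Definition subvariety {R : realType} {d : nat} (Q : pencil R d)
    (V : ncdom R d) : Prop :=
  exists2 S : set (scalfun (opball Q)), S `<=` Hinf (opball Q) &
    forall n, V n = [set val X | X in
                      [set X : opball Q n | forall f, S f -> f n X = 0]].

Definition homogeneous {R : realType} {d : nat} (V : ncdom R d) : Prop :=
  forall (a : R[i]), `|a| <= 1 ->
    forall n (X : mtuple R d n), V n X -> V n (fun j => a *: X j).

(* Free nc polynomials, as finite formal sums of terms (coefficient, word).
   Different sums may denote the same element of the free algebra; only the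
   functions that they define are used. *)
Definition ncpoly (R : realType) (d : nat) := seq (R[i] * seq 'I_d).

Definition word_eval {R : realType} {d n : nat} (w : seq 'I_d)
    (X : mtuple R d n) : 'M[R[i]]_n :=
  foldr (fun j A => X j *m A) 1%:M w.

Definition ncpoly_eval {R : realType} {d n : nat} (p : ncpoly R d)
    (X : mtuple R d n) : 'M[R[i]]_n :=
  \sum_(t <- p) t.1 *: word_eval t.2 X.

Definition ncpoly_fun {R : realType} {d : nat} (V : ncdom R d)
    (p : ncpoly R d) : scalfun V := fun n X => ncpoly_eval p (val X).

Definition Aalg {R : realType} {d : nat} (V : ncdom R d) : set (scalfun V) :=
  [set f | Hinf V f /\
    forall e : R, 0 < e -> exists p, supnorm (f - ncpoly_fun V p) < e].

(* The continuous extension of f to the closure of V: its value at X is the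
   limit of f(Y) as Y in V(n) tends to X (and 0 if there is no such limit). *)
Definition cext {R : realType} {d : nat} {V : ncdom R d} (f : scalfun V) :
    scalfun (ncclosure V) :=
  fun n X => xget 0 [set L | forall e : R, 0 < e -> exists2 dl : R, 0 < dl &
    forall Y : V n, tdist (val Y) (val X) < dl -> mnorm (f n Y - L) < e].

Definition sfcomp {R : realType} {d l : nat} {V : ncdom R d} {W : ncdom R l}
    (f : scalfun W) (F : ncmap V W) : scalfun V := fun n X => f n (F n X).

(* In the definitions below, a map A(V) -> A(W) is the restriction to A(V) of a
   function phi between the ambient algebras; its values outside A(V) are
   irrelevant. *)

(* Homomorphisms are required to be unital: with phi = 0 allowed, a completely
   contractive homomorphism need not be a composition operator. *)
Definition alg_hom {R : realType} {d l : nat} {V : ncdom R d} {W : ncdom R l}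
    (phi : scalfun V -> scalfun W) : Prop :=
  [/\ set_fun (Aalg V) (Aalg W) phi,
      forall (a : R[i]) f g, Aalg V f -> Aalg V g ->
        phi (a *: f + g) = a *: phi f + phi g,
      forall f g, Aalg V f -> Aalg V g -> phi (f * g) = phi f * phi g &
      phi 1 = 1].

Definition supnorm_continuous {R : realType} {d l : nat} {V : ncdom R d}
    {W : ncdom R l} (phi : scalfun V -> scalfun W) : Prop :=
  forall f, Aalg V f -> forall e : R, 0 < e -> exists2 dl : R, 0 < dl &
    forall g, Aalg V g -> supnorm (g - f) < dl -> supnorm (phi g - phi f) < e.

Definition completely_contractive {R : realType} {d l : nat} {V : ncdom R d}
    {W : ncdom R l} (phi : scalfun V -> scalfun W) : Prop :=
  forall k (f : 'M[scalfun V]_k), (forall i j, Aalg V (f i j)) ->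
    supnorm_mx (map_mx phi f) <= supnorm_mx f.

Definition completely_isometric {R : realType} {d l : nat} {V : ncdom R d}
    {W : ncdom R l} (phi : scalfun V -> scalfun W) : Prop :=
  forall k (f : 'M[scalfun V]_k), (forall i j, Aalg V (f i j)) ->
    supnorm_mx (map_mx phi f) = supnorm_mx f.

Definition alg_iso {R : realType} {d l : nat} {V : ncdom R d} {W : ncdom R l}
    (phi : scalfun V -> scalfun W) : Prop :=
  alg_hom phi /\ set_bij (Aalg V) (Aalg W) phi.

(* Main.v *)
(* Let P be the set of homogeneous nc polynomials vanishing on V.

   Taylor formula.  A point T similar to a restriction of A in V to an invariant
   subspace is again a common zero of P, so a bounded nc function f preserves the
   cyclic subspaces of nilpotent tuples: for a nilpotent Jordan block J, the
   blocks of f(J (x) X) are polynomials p_m(X).  Replacing J by a contraction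
   having r as an eigenvalue and J as a quotient gives
   |f(rX) - \sum_(m < N) r^m p_m(X)| <= r^N |f| / (1 - r), without any
   integration.  Applied to the functions defining V, it shows that V is cut out
   of the ball by P; applied to f on V, that A(V) consists of the bounded
   uniformly continuous nc functions.

   Maps and homomorphisms.  If phi is completely contractive, evaluating phi of
   the coordinates at X gives a tuple Y on which P_1 vanishes, and |Q_1(Y)| <= 1
   because finite compressions of Q_1 are matrices over A(V_1); hence Y lies in
   the closure of V_1.

   Boundary points.  If the tuple with blocks c, s(c - b), 0, b has norm at most
   1 under Q and |Q(c)| <= 1/2, then its second column forces |Q(b)| < 1.  Such
   tuples are similar to c (+) b, so nc maps send them to tuples of the same
   form; this takes the place of the maximum principle in showing that a
   biholomorphism of the closures preserves the interiors.  The inverse map is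
   not assumed to be nc; on the interior this follows from injectivity. *)
Require Import Defs.
From mathcomp Require Import all_boot all_order all_algebra.
From mathcomp Require Import all_classical all_reals all_analysis.
From mathcomp Require Import complex mxtens ring lra.
Import Order.TTheory GRing.Theory Num.Theory numFieldNormedType.Exports.

Set Implicit Arguments.
Unset Strict Implicit.
Unset Printing Implicit Defensive.

Local Open Scope classical_set_scope.
Local Open Scope ring_scope.

(** * Real-valued norms and Minkowski's inequality *)

(** Its substitute is that nc functions respect every intertwiner: if [L X = Y L], conjugation by
    the shear of [L] fixes [X (+) Y], so the shear commutes with [f(X) (+) f(Y)], and no point
    outside [V] is needed. Most structural steps amount to writing down an intertwiner, often
    rectangular, between two explicit points of [V]. Such points are supplied by direct sums,
    restrictions to invariant subspaces, and [A (x) X] with [A] a scalar contraction: the last stays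
    in the ball because [Q] sees [A] only as an outer factor, and stays a zero of [P] because [P] is
    homogeneous. Estimates have two grades. Constants depending on the matrix size suffice at one
    level; uniform continuity needs constants valid at all levels, and these rest on the boundedness
    of the ball, the one place where linear independence of the coefficients enters. *)

Section RealNorm.
Context {R : realType}.

Definition cn {V : normedZmodType R[i]} (v : V) : R := complex.Re `|v|.

Lemma cnE {V : normedZmodType R[i]} (v : V) : `|v| = (cn v)%:C%C.
Proof. by rewrite /cn RRe_real // normr_real. Qed.

Lemma cn_ge0 {V : normedZmodType R[i]} (v : V) : 0 <= cn v.
Proof. by rewrite -(lecR 0) -cnE normr_ge0. Qed.

Lemma cnD {V : normedZmodType R[i]} (u v : V) : cn (u + v) <= cn u + cn v.
Proof. by rewrite -lecR rmorphD /= -!cnE ler_normD. Qed.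

Lemma cn0 {V : normedZmodType R[i]} : cn (0 : V) = 0.
Proof. by rewrite /cn normr0. Qed.

Lemma cnN {V : normedZmodType R[i]} (v : V) : cn (- v) = cn v.
Proof. by rewrite /cn normrN. Qed.

Lemma cn_eq0 {V : normedZmodType R[i]} (v : V) : cn v = 0 -> v = 0.
Proof. by move=> v0; apply/eqP; rewrite -normr_eq0 cnE v0. Qed.

Lemma cnM (a b : R[i]) : cn (a * b) = cn a * cn b.
Proof. by apply: complexI; rewrite rmorphM /= -!cnE normrM. Qed.

Lemma cnZ {V : normedModType R[i]} (a : R[i]) (v : V) :
  cn (a *: v) = cn a * cn v.
Proof. by apply: complexI; rewrite rmorphM /= -!cnE normrZ. Qed.

Lemma cn_real (r : R) : cn (r%:C%C : R[i]) = `|r|.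
Proof.
by rewrite /cn normc_def /= expr0n /= addr0 sqrtr_sqr.
Qed.

Lemma cn_sum {V : normedZmodType R[i]} (I : finType) (F : I -> V) :
  cn (\sum_i F i) <= \sum_i cn (F i).
Proof.
elim/big_ind2: _ => [|u a v b ua vb|//]; first by rewrite cn0.
by apply: le_trans (cnD _ _) _; apply: lerD.
Qed.

Definition nsq {V : normedZmodType R[i]} {I : finType} (v : I -> V) : R :=
  \sum_i cn (v i) ^+ 2.

Lemma nsq_ge0 {V : normedZmodType R[i]} {I : finType} (v : I -> V) :
  0 <= nsq v.
Proof. by apply: sumr_ge0 => i _; rewrite sqr_ge0. Qed.

Lemma le_cn_nsq {V : normedZmodType R[i]} {I : finType} (v : I -> V) i :
  cn (v i) ^+ 2 <= nsq v.
Proof.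
by rewrite /nsq (bigD1 i) //= lerDl sumr_ge0 // => j _; rewrite sqr_ge0.
Qed.

Lemma nsq_eq0 {V : normedZmodType R[i]} {I : finType} (v : I -> V) :
  nsq v = 0 -> forall i, v i = 0.
Proof.
move=> v0 i; apply: cn_eq0; apply/eqP; rewrite -sqrf_eq0 eq_le sqr_ge0 andbT.
by rewrite -v0 le_cn_nsq.
Qed.

Lemma eq_nsq {V : normedZmodType R[i]} {I : finType} (u v : I -> V) :
  u =1 v -> nsq u = nsq v.
Proof. by move=> uv; apply: eq_bigr => i _; rewrite uv. Qed.

Lemma nsqZ {V : normedModType R[i]} {I : finType} (a : R[i]) (v : I -> V) :
  nsq (fun i => a *: v i) = cn a ^+ 2 * nsq v.
Proof. by rewrite /nsq mulr_sumr; apply: eq_bigr => i _; rewrite cnZ exprMn. Qed.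

(* Peter-Paul with weight [b / a] turns into Minkowski's inequality. *)
Lemma nsqD {V : normedZmodType R[i]} {I : finType} (u v : I -> V) (a b : R) :
  0 <= a -> 0 <= b -> nsq u <= a ^+ 2 -> nsq v <= b ^+ 2 ->
  nsq (fun i => u i + v i) <= (a + b) ^+ 2.
Proof.
rewrite le_eqVlt => /predU1P[<-|a0].
  move=> b0 u0 vb; have /nsq_eq0 {}u0 : nsq u = 0.
    by apply/eqP; rewrite eq_le nsq_ge0 andbT (le_trans u0) ?expr0n.
  by rewrite add0r (eq_nsq (v := v)) // => i; rewrite u0 add0r.
rewrite le_eqVlt => /predU1P[<-|b0].
  move=> ua v0; have /nsq_eq0 {}v0 : nsq v = 0.
    by apply/eqP; rewrite eq_le nsq_ge0 andbT (le_trans v0) ?expr0n.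
  by rewrite addr0 (eq_nsq (v := u)) // => i; rewrite v0 addr0.
move=> ua vb.
have : nsq (fun i => u i + v i) <= (1 + b / a) * nsq u + (1 + a / b) * nsq v.
  rewrite /nsq !mulr_sumr -big_split /=; apply: ler_sum => i _.
  have := cnD (u i) (v i); have := cn_ge0 (u i + v i).
  move: (cn (u i + v i)) (cn (u i)) (cn (v i)) => z x y z0 zxy.
  apply: (@le_trans _ _ ((x + y) ^+ 2)); first by rewrite lerXn2r ?nnegrE // (le_trans z0).
  rewrite -subr_ge0; suff -> : (1 + b / a) * x ^+ 2 + (1 + a / b) * y ^+ 2 - (x + y) ^+ 2
      = (b * x - a * y) ^+ 2 / (a * b).
    by rewrite divr_ge0 ?sqr_ge0 // mulr_ge0 // ltW.
  by field; rewrite !gt_eqF.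
move=> /le_trans; apply.
apply: (@le_trans _ _ ((1 + b / a) * a ^+ 2 + (1 + a / b) * b ^+ 2)).
  by apply: lerD; apply: ler_wpM2l => //; rewrite addr_ge0 // divr_ge0 // ltW.
rewrite le_eqVlt; apply/orP; left; apply/eqP.
by field; rewrite !gt_eqF.
Qed.

Lemma l2normE {H : normedModType R[i]} {n : nat} (v : 'I_n -> H) :
  l2norm v = Num.sqrt (nsq v).
Proof. by []. Qed.

Lemma l2norm_sq {H : normedModType R[i]} {n : nat} (v : 'I_n -> H) :
  l2norm v ^+ 2 = nsq v.
Proof. by rewrite l2normE sqr_sqrtr ?nsq_ge0. Qed.

Lemma l2norm_le {H : normedModType R[i]} {n : nat} (v : 'I_n -> H) (c : R) :
  0 <= c -> (l2norm v <= c) = (nsq v <= c ^+ 2).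
Proof.
by move=> c0; rewrite -l2norm_sq ler_sqr ?nnegrE // l2normE sqrtr_ge0.
Qed.

Section OpNorm.
Context {H K : normedModType R[i]} {m n : nat}.
Variable T : ('I_n -> H) -> ('I_m -> K).

Let T_homog := forall (a : R[i]) v, T (fun i => a *: v i) = fun i => a *: T v i.

Definition opbound (c : R) := forall v, nsq (T v) <= c ^+ 2 * nsq v.

Lemma opbound_set c : 0 <= c -> opbound c ->
  ubound [set l2norm (T v) | v in [set v | l2norm v <= 1]] c.
Proof.
move=> c0 Tc _ [v /= v1 <-]; rewrite l2norm_le //.
apply: le_trans (Tc v) _; rewrite ler_piMr ?sqr_ge0 //.
by rewrite l2norm_le // expr1n in v1.
Qed.

Lemma opnorm_le c : 0 <= c -> opbound c -> opnorm T <= c.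
Proof.
move=> c0 Tc; apply: sup_le_ub; last exact: opbound_set.
exists (l2norm (T (fun=> 0))), (fun=> 0) => //=.
by rewrite l2norm_le ?expr1n // /nsq big1 ?ler01 // => i _; rewrite cn0 expr0n.
Qed.

Lemma opnorm_ge0 c : 0 <= c -> opbound c -> 0 <= opnorm T.
Proof.
move=> c0 Tc; apply: (@le_trans _ _ (l2norm (T (fun=> 0)))).
  by rewrite l2normE sqrtr_ge0.
apply: (ub_le_sup _ _); first by exists c; apply: opbound_set.
exists (fun=> 0) => //=.
by rewrite l2norm_le ?expr1n // /nsq big1 ?ler01 // => i _; rewrite cn0 expr0n.
Qed.

(** [sup] of an unbounded set is a default value, so the crude bound [c] is what makes [opnorm]
    meaningful; homogeneity then reduces an arbitrary vector to the unit ball. *)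
Lemma opnormP c : T_homog -> 0 <= c -> opbound c -> opbound (opnorm T).
Proof.
move=> Th c0 Tc v.
have [v0|v0] := eqVneq (nsq v) 0.
  by rewrite (le_trans (Tc v)) // v0 !mulr0.
have s0 : 0 < l2norm v.
  by rewrite l2normE sqrtr_gt0 lt_neqAle eq_sym v0 nsq_ge0.
pose a : R[i] := (l2norm v)^-1%:C%C.
have a1 : cn a = (l2norm v)^-1 by rewrite cn_real ger0_norm // invr_ge0 ltW.
have : l2norm (T (fun i => a *: v i)) <= opnorm T.
  apply: (ub_le_sup _ _); first by exists c; apply: opbound_set.
  exists (fun i => a *: v i) => //=.
  by rewrite l2norm_le // expr1n nsqZ a1 -l2norm_sq -exprMn mulVf ?gt_eqF // expr1n.
rewrite l2norm_le ?(opnorm_ge0 c0 Tc) // Th nsqZ a1 exprVn -ler_pdivlMl.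
  by rewrite invrK l2norm_sq mulrC.
by rewrite invr_gt0 exprn_gt0.
Qed.

End OpNorm.

End RealNorm.

(** * Matrix norms and tuples *)

Section MatrixNorm.
Context {R : realType}.
Local Notation C := R[i].

Definition mapp {m n} (A : 'M[C]_(m, n)) (v : 'I_n -> C) : 'I_m -> C :=
  fun i => \sum_k A i k * v k.

Lemma mappD {m n} (A B : 'M[C]_(m, n)) v i :
  mapp (A + B) v i = mapp A v i + mapp B v i.
Proof.
by rewrite /mapp -big_split /=; apply: eq_bigr => k _; rewrite mxE mulrDl.
Qed.

Lemma mappM {m n p} (A : 'M[C]_(m, n)) (B : 'M[C]_(n, p)) v :
  mapp (A *m B) v = mapp A (mapp B v).
Proof.
apply/funext => i; rewrite /mapp.
under eq_bigr do rewrite mxE mulr_suml.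
rewrite exchange_big /=; apply: eq_bigr => j _.
by rewrite mulr_sumr; apply: eq_bigr => k _; rewrite mulrA.
Qed.

Lemma sum_delta {n} (F : 'I_n -> C) (i : 'I_n) :
  \sum_k (i == k)%:R * F k = F i.
Proof.
rewrite (bigD1 i) //= eqxx mul1r big1 ?addr0 // => k ki.
by rewrite eq_sym (negbTE ki) mul0r.
Qed.

Lemma mapp1 {n} (v : 'I_n -> C) : mapp 1%:M v = v.
Proof.
apply/funext => i; rewrite /mapp -[RHS]sum_delta.
by apply: eq_bigr => k _; rewrite mxE.
Qed.

Definition sumnorm {m n} (A : 'M[C]_(m, n)) : R := \sum_i \sum_j cn (A i j).

Lemma sumnorm_ge0 {m n} (A : 'M[C]_(m, n)) : 0 <= sumnorm A.
Proof. by apply: sumr_ge0 => i _; apply: sumr_ge0 => j _; apply: cn_ge0. Qed.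

Lemma nsqM (I : finType) (a : C) (v : I -> C) :
  nsq (fun i => a * v i) = cn a ^+ 2 * nsq v.
Proof. by rewrite /nsq mulr_sumr; apply: eq_bigr => i _; rewrite cnM exprMn. Qed.

Lemma nsq_le_sum (V : normedZmodType C) (I : finType) (v : I -> V) :
  nsq v <= (\sum_i cn (v i)) ^+ 2.
Proof.
have s0 : 0 <= \sum_i cn (v i) by apply: sumr_ge0 => i _; apply: cn_ge0.
rewrite expr2 mulr_suml; apply: ler_sum => i _; rewrite expr2.
apply: ler_wpM2l; first exact: cn_ge0.
by rewrite (bigD1 i) //= lerDl sumr_ge0 // => j _; apply: cn_ge0.
Qed.

(** Far from sharp: its main role is to bound the set whose supremum defines [mnorm]. *)
Lemma mapp_bound {m n} (A : 'M[C]_(m, n)) v :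
  nsq (mapp A v) <= sumnorm A ^+ 2 * nsq v.
Proof.
apply: le_trans (nsq_le_sum _) _.
have s0 : 0 <= Num.sqrt (nsq v) by rewrite sqrtr_ge0.
rewrite -[X in _ * X]sqr_sqrtr ?nsq_ge0 // -exprMn lerXn2r ?nnegrE //.
- by apply: sumr_ge0 => i _; apply: cn_ge0.
- by rewrite mulr_ge0 // sumnorm_ge0.
rewrite /sumnorm mulr_suml; apply: ler_sum => i _.
apply: le_trans (cn_sum _) _; rewrite mulr_suml; apply: ler_sum => k _.
rewrite cnM ler_wpM2l ?cn_ge0 //.
by rewrite -(ler_sqr (x := cn _)) ?nnegrE ?cn_ge0 // sqr_sqrtr ?nsq_ge0 // le_cn_nsq.
Qed.

Lemma mnormE {m n} (A : 'M[C]_(m, n)) :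
  mnorm A = @opnorm R C^o C^o m n (mapp A).
Proof. by []. Qed.

Lemma mnorm_ge0 {m n} (A : 'M[C]_(m, n)) : 0 <= mnorm A.
Proof.
rewrite mnormE; apply: (@opnorm_ge0 _ _ _ _ _ _ (sumnorm A)).
  exact: sumnorm_ge0.
exact: mapp_bound.
Qed.

Lemma mnormP {m n} (A : 'M[C]_(m, n)) v :
  nsq (mapp A v) <= mnorm A ^+ 2 * nsq v.
Proof.
rewrite mnormE; apply: (@opnormP R C^o C^o m n (mapp A) (sumnorm A)).
- move=> a w; apply/funext => i.
  rewrite /mapp [RHS]mulr_sumr; apply: eq_bigr => k _.
  by rewrite mulrCA.
- exact: sumnorm_ge0.
- exact: mapp_bound.
Qed.

Lemma mnorm_le {m n} (A : 'M[C]_(m, n)) (c : R) : 0 <= c ->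
  (forall v, nsq (mapp A v) <= c ^+ 2 * nsq v) -> mnorm A <= c.
Proof. by move=> c0 Ac; rewrite mnormE; apply: opnorm_le. Qed.

Lemma mnorm_le_sum {m n} (A : 'M[C]_(m, n)) : mnorm A <= sumnorm A.
Proof. by apply: mnorm_le; [exact: sumnorm_ge0|exact: mapp_bound]. Qed.

Lemma nsq_le_mnorm {m n} (A : 'M[C]_(m, n)) (v : 'I_n -> C) c :
  0 <= c -> nsq v <= c ^+ 2 -> nsq (mapp A v) <= (mnorm A * c) ^+ 2.
Proof.
move=> c0 vc; apply: le_trans (mnormP _ _) _.
by rewrite exprMn ler_wpM2l ?sqr_ge0.
Qed.

Lemma mnormD {m n} (A B : 'M[C]_(m, n)) : mnorm (A + B) <= mnorm A + mnorm B.
Proof.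
apply: mnorm_le => [|v]; first by rewrite addr_ge0 ?mnorm_ge0.
set s := Num.sqrt (nsq v).
have s2 : nsq v = s ^+ 2 by rewrite sqr_sqrtr ?nsq_ge0.
have s0 : 0 <= s by rewrite sqrtr_ge0.
rewrite (eq_nsq (mappD A B v)) s2 -exprMn mulrDl.
by apply: nsqD; rewrite ?mulr_ge0 ?mnorm_ge0 // nsq_le_mnorm // s2.
Qed.

Lemma mnormM {m n p} (A : 'M[C]_(m, n)) (B : 'M[C]_(n, p)) :
  mnorm (A *m B) <= mnorm A * mnorm B.
Proof.
apply: mnorm_le => [|v]; first by rewrite mulr_ge0 ?mnorm_ge0.
rewrite mappM exprMn -mulrA; apply: le_trans (mnormP _ _) _.
by rewrite ler_wpM2l ?sqr_ge0 // mnormP.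
Qed.

Lemma mnormZ_le {m n} (a : C) (A : 'M[C]_(m, n)) :
  mnorm (a *: A) <= cn a * mnorm A.
Proof.
apply: mnorm_le => [|v]; first by rewrite mulr_ge0 ?mnorm_ge0 ?cn_ge0.
rewrite (eq_nsq (v := fun i => a * mapp A v i)).
  by rewrite nsqM exprMn -[leRHS]mulrA ler_wpM2l ?sqr_ge0 // mnormP.
move=> i; rewrite /mapp [RHS]mulr_sumr; apply: eq_bigr => k _.
by rewrite mxE mulrA.
Qed.

Lemma mnorm0 {m n} : mnorm (0 : 'M[C]_(m, n)) = 0.
Proof.
apply/eqP; rewrite eq_le mnorm_ge0 andbT; apply: le_trans (mnorm_le_sum _) _.
by rewrite /sumnorm big1 // => i _; rewrite big1 // => j _; rewrite mxE cn0.
Qed.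

Lemma mnormN {m n} (A : 'M[C]_(m, n)) : mnorm (- A) = mnorm A.
Proof.
suff H (B : 'M[C]_(m, n)) : mnorm (- B) <= mnorm B.
  by apply/eqP; rewrite eq_le H /= -{1}(opprK A) H.
have -> : - B = (-1 : C) *: B by rewrite scaleN1r.
by rewrite (le_trans (mnormZ_le _ _)) // cnN /cn normr1 mul1r.
Qed.

Lemma mnormB {m n} (A B : 'M[C]_(m, n)) : mnorm (A - B) = mnorm (B - A).
Proof. by rewrite -mnormN opprB. Qed.

Lemma mnorm1_le {n} : mnorm (1%:M : 'M[C]_n) <= 1.
Proof. by apply: mnorm_le => // v; rewrite mapp1 expr1n mul1r. Qed.

Lemma mnorm_sum {m n} (I : Type) (r : seq I) (F : I -> 'M[C]_(m, n)) :
  mnorm (\sum_(i <- r) F i) <= \sum_(i <- r) mnorm (F i).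
Proof.
elim/big_ind2: _ => [|u a v b ua vb|//]; first by rewrite mnorm0.
by apply: le_trans (mnormD _ _) _; apply: lerD.
Qed.

Lemma mnorm_trans {m n} (A B D : 'M[C]_(m, n)) :
  mnorm (A - D) <= mnorm (A - B) + mnorm (B - D).
Proof. by rewrite -(subrKA B A (- D)) mnormD. Qed.

Lemma cn_le_mnorm {m n} (A : 'M[C]_(m, n)) i j : cn (A i j) <= mnorm A.
Proof.
rewrite -ler_sqr ?nnegrE ?cn_ge0 ?mnorm_ge0 //.
have := mnormP A (fun k => (j == k)%:R).
have -> : nsq (fun k => (j == k)%:R : C) = 1.
  rewrite /nsq (bigD1 j) //= eqxx /cn normr1 expr1n big1 ?addr0 // => k kj.
  by rewrite eq_sym (negbTE kj) normr0 expr0n.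
rewrite mulr1; apply: le_trans.
have -> : A i j = mapp A (fun k => (j == k)%:R) i.
  rewrite /mapp -[LHS](sum_delta (A i)).
  by apply: eq_bigr => k _; rewrite mulrC.
exact: le_cn_nsq.
Qed.

Lemma mnorm_eq0 {m n} (A : 'M[C]_(m, n)) : mnorm A = 0 -> A = 0.
Proof.
move=> A0; apply/matrixP => i j; rewrite mxE; apply: cn_eq0.
by apply/eqP; rewrite eq_le cn_ge0 andbT -A0 cn_le_mnorm.
Qed.

Lemma mnorm_small0 {m n} (A : 'M[C]_(m, n)) :
  (forall e : R, 0 < e -> mnorm A <= e) -> A = 0.
Proof.
move=> h; apply: mnorm_eq0; apply/eqP; rewrite eq_le mnorm_ge0 andbT.
by apply/ler_addgt0Pr => e e0; rewrite add0r h.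
Qed.

Lemma mnorm_lim_eq {m n} (A B : 'M[C]_(m, n)) :
  (forall e : R, 0 < e -> mnorm (A - B) <= e) -> A = B.
Proof. by move=> /mnorm_small0 /eqP; rewrite subr_eq0 => /eqP. Qed.

Context {d : nat}.

Lemma tnorm_ge0 {n} (X : mtuple R d n) : 0 <= tnorm X.
Proof.
by rewrite /tnorm; elim/big_ind: _ => // [x y x0 y0|j _];
  rewrite ?le_max ?x0 ?mnorm_ge0.
Qed.

Lemma le_tnorm {n} (X : mtuple R d n) j : mnorm (X j) <= tnorm X.
Proof. by rewrite /tnorm; apply: le_bigmax. Qed.

Lemma tnorm_le {n} (X : mtuple R d n) c :
  0 <= c -> (forall j, mnorm (X j) <= c) -> tnorm X <= c.
Proof. by move=> c0 Xc; rewrite /tnorm; apply: bigmax_le => // j _. Qed.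

Lemma tnorm_lt {n} (X : mtuple R d n) c :
  0 < c -> (forall j, mnorm (X j) < c) -> tnorm X < c.
Proof. by move=> c0 Xc; rewrite /tnorm; apply: bigmax_lt => // j _. Qed.

Lemma tdist_trans {n} (X Y Z : mtuple R d n) :
  tdist X Z <= tdist X Y + tdist Y Z.
Proof.
apply: tnorm_le => [|j]; first by rewrite addr_ge0 // tnorm_ge0.
apply: le_trans (mnorm_trans _ (Y j) _) _.
by apply: lerD; apply: (le_tnorm (fun j => _ j - _ j)).
Qed.

Lemma le_tdist {n} (X Y : mtuple R d n) j : mnorm (X j - Y j) <= tdist X Y.
Proof. exact: (le_tnorm (fun j => X j - Y j)). Qed.

Lemma tdistC {n} (X Y : mtuple R d n) : tdist X Y = tdist Y X.
Proof. by rewrite /tdist /tnorm; apply: eq_bigr => j _; rewrite mnormB. Qed.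

Lemma tdist_ge0 {n} (X Y : mtuple R d n) : 0 <= tdist X Y.
Proof. exact: tnorm_ge0. Qed.

Lemma tdistxx {n} (X : mtuple R d n) : tdist X X = 0.
Proof.
apply/eqP; rewrite eq_le tdist_ge0 andbT; apply: tnorm_le => // j.
by rewrite subrr mnorm0.
Qed.

Definition tscale {n} (r : R) (X : mtuple R d n) : mtuple R d n :=
  fun j => r%:C%C *: X j.

Lemma tscale_dist {n} (r : R) (X : mtuple R d n) : r <= 1 ->
  tdist (tscale r X) X <= (1 - r) * tnorm X.
Proof.
move=> r1; have r0 : 0 <= 1 - r by rewrite subr_ge0.
apply: tnorm_le => [|j]; first by rewrite mulr_ge0 // tnorm_ge0.
rewrite /tscale -mnormN opprB -{1}(scale1r (X j)) -scalerBl.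
apply: le_trans (mnormZ_le _ _) _.
have -> : 1 - r%:C%C = (1 - r)%:C%C :> C by rewrite rmorphB /= rmorph1.
by rewrite cn_real ger0_norm // ler_wpM2l // le_tnorm.
Qed.

Lemma tscale1 {n} (X : mtuple R d n) : tscale 1 X = X.
Proof. by apply/funext => j; rewrite /tscale scale1r. Qed.

Lemma tscaleA {n} (r s : R) (X : mtuple R d n) :
  tscale r (tscale s X) = tscale (r * s) X.
Proof. by apply/funext => j; rewrite /tscale scalerA rmorphM. Qed.

End MatrixNorm.

(** * Noncommutative polynomials *)

Section Polynomials.
Context {R : realType} {d : nat}.
Local Notation C := R[i].

Lemma word_eval_rcons {n} (w : seq 'I_d) j (X : mtuple R d n) :
  word_eval (rcons w j) X = word_eval w X *m X j.
Proof.
elim: w => [|k w IH] /=; first by rewrite mulmx1 mul1mx.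
by rewrite IH mulmxA.
Qed.

Lemma word_eval_twine {m n} (L : 'M[C]_(n, m)) (X : mtuple R d m)
    (Y : mtuple R d n) : (forall j, L *m X j = Y j *m L) ->
  forall w, L *m word_eval w X = word_eval w Y *m L.
Proof.
move=> LXY; elim=> [|j w IH] /=; first by rewrite mulmx1 mul1mx.
by rewrite mulmxA LXY -mulmxA IH mulmxA.
Qed.

Lemma ncpoly_eval_twine {m n} (L : 'M[C]_(n, m)) (X : mtuple R d m)
    (Y : mtuple R d n) : (forall j, L *m X j = Y j *m L) ->
  forall p, L *m ncpoly_eval p X = ncpoly_eval p Y *m L.
Proof.
move=> LXY p; rewrite /ncpoly_eval mulmx_sumr mulmx_suml.
apply: eq_bigr => t _.
by rewrite -scalemxAr -scalemxAl (word_eval_twine LXY).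
Qed.

Lemma word_eval_scale {n} (a : C) (w : seq 'I_d) (X : mtuple R d n) :
  word_eval w (fun j => a *: X j) = a ^+ size w *: word_eval w X.
Proof.
elim: w => [|j w IH] /=; first by rewrite expr0 scale1r.
by rewrite IH -scalemxAl -scalemxAr scalerA exprS.
Qed.

Definition hompoly (m : nat) (p : ncpoly R d) := all (fun t => size t.2 == m) p.

Lemma hompoly_scale {n} m (p : ncpoly R d) (a : C) (X : mtuple R d n) :
  hompoly m p ->
  ncpoly_eval p (fun j => a *: X j) = a ^+ m *: ncpoly_eval p X.
Proof.
move=> /allP hp; rewrite /ncpoly_eval scaler_sumr big_seq [RHS]big_seq.
apply: eq_bigr => t /hp /eqP <-.
by rewrite word_eval_scale !scalerA mulrC.
Qed.

Lemma tens11 {k n} : (1%:M : 'M[C]_k) *t (1%:M : 'M[C]_n) = 1%:M.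
Proof.
apply/matrixP => i j.
case: (mxtens_indexP i) => a b; case: (mxtens_indexP j) => a' b'.
rewrite tensmxE !mxE (can_eq (@mxtens_indexK _ _)) xpair_eqE.
by rewrite -natrM mulnb.
Qed.

Lemma word_eval_tens {k n} (A : 'M[C]_k) (w : seq 'I_d) (X : mtuple R d n) :
  word_eval w (fun j => A *t X j) = iter (size w) (mulmx A) 1%:M *t word_eval w X.
Proof.
elim: w => [|j w IH] /=; first by rewrite tens11.
by rewrite IH tensmx_mul.
Qed.

Lemma tensmx_sumr {k n} (A : 'M[C]_k) (I : Type) (r : seq I)
    (F : I -> 'M[C]_n) : A *t (\sum_(i <- r) F i) = \sum_(i <- r) A *t F i.
Proof.
elim/big_rec2: _ => [|i x y _ <-]; first by rewrite tensmx0.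
by apply/matrixP => a b; rewrite !mxE mulrDr.
Qed.

Lemma tensmxZr {k n} (A : 'M[C]_k) (a : C) (B : 'M[C]_n) :
  A *t (a *: B) = a *: (A *t B).
Proof. by apply/matrixP => i j; rewrite !mxE mulrCA. Qed.

(** All words of [p] contribute the same power of [A], so the value factors. In particular a zero
    [X] of [p] yields the zero [A *t X]. *)
Lemma hompoly_tens {k n} m (p : ncpoly R d) (A : 'M[C]_k) (X : mtuple R d n) :
  hompoly m p ->
  ncpoly_eval p (fun j => A *t X j) = iter m (mulmx A) 1%:M *t ncpoly_eval p X.
Proof.
move=> /allP hp; rewrite /ncpoly_eval tensmx_sumr big_seq [RHS]big_seq.
apply: eq_bigr => t /hp /eqP <-.
by rewrite word_eval_tens tensmxZr.
Qed.

Lemma word_eval_dsum {m n} (X : mtuple R d m) (Y : mtuple R d n) w :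
  word_eval w (dsum X Y) = block_mx (word_eval w X) 0 0 (word_eval w Y).
Proof.
elim: w => [|j w IH] /=; first by rewrite -scalar_mx_block.
by rewrite IH mulmx_block !mulmx0 !mul0mx !addr0 !add0r.
Qed.

Lemma ncpoly_eval_dsum {m n} (X : mtuple R d m) (Y : mtuple R d n) p :
  ncpoly_eval p (dsum X Y) = block_mx (ncpoly_eval p X) 0 0 (ncpoly_eval p Y).
Proof.
rewrite /ncpoly_eval; elim: p => [|t p IH].
  by rewrite !big_nil; apply/esym/block_mx0.
rewrite !big_cons IH word_eval_dsum scale_block_mx add_block_mx.
by rewrite !scaler0 !addr0.
Qed.

Lemma ncpoly_eval_cat {n} (p q : ncpoly R d) (X : mtuple R d n) :
  ncpoly_eval (p ++ q) X = ncpoly_eval p X + ncpoly_eval q X.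
Proof. by rewrite /ncpoly_eval big_cat. Qed.

Definition ncpoly_scale (a : C) (p : ncpoly R d) : ncpoly R d :=
  [seq (a * t.1, t.2) | t <- p].

Lemma ncpoly_evalZ {n} a (p : ncpoly R d) (X : mtuple R d n) :
  ncpoly_eval (ncpoly_scale a p) X = a *: ncpoly_eval p X.
Proof.
rewrite /ncpoly_eval big_map scaler_sumr; apply: eq_bigr => t _.
by rewrite scalerA.
Qed.

Lemma hompoly_cat m p q : hompoly m p -> hompoly m q -> hompoly m (p ++ q).
Proof. by move=> hp hq; rewrite /hompoly all_cat; apply/andP. Qed.

Lemma hompolyZ m a p : hompoly m p -> hompoly m (ncpoly_scale a p).
Proof. by rewrite /hompoly all_map. Qed.

Lemma ncpoly_eval1 {n} (X : mtuple R d n) :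
  ncpoly_eval [:: (1, [::])] X = 1%:M.
Proof. by rewrite /ncpoly_eval big_seq1 scale1r. Qed.

Definition ncvar (j : 'I_d) : ncpoly R d := [:: (1, [:: j])].

Lemma ncpoly_eval_var {n} j (X : mtuple R d n) : ncpoly_eval (ncvar j) X = X j.
Proof. by rewrite /ncpoly_eval big_seq1 scale1r /= mulmx1. Qed.

(** The constants here and in the next three lemmas do not depend on the size [n], as uniform
    continuity over all levels requires. *)
Lemma word_eval_bounded (c : R) w : 0 <= c -> exists2 K : R, 0 <= K &
  forall n (X : mtuple R d n), tnorm X <= c -> mnorm (word_eval w X) <= K.
Proof.
move=> c0; elim: w => [|j w [K K0 IH]] /=.
  by exists 1 => // n X _; apply: mnorm1_le.
exists (c * K); first by rewrite mulr_ge0.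
move=> n X Xc; apply: le_trans (mnormM _ _) _.
by apply: ler_pM; rewrite ?mnorm_ge0 ?IH // (le_trans (le_tnorm _ _)).
Qed.

Lemma ncpoly_eval_bounded (c : R) (p : ncpoly R d) : 0 <= c ->
  exists2 K : R, 0 <= K &
  forall n (X : mtuple R d n), tnorm X <= c -> mnorm (ncpoly_eval p X) <= K.
Proof.
move=> c0; elim: p => [|t p [K K0 IH]].
  by exists 0 => // n X _; rewrite /ncpoly_eval big_nil mnorm0.
have [K' K'0 H] := word_eval_bounded t.2 c0.
exists (cn t.1 * K' + K); first by rewrite addr_ge0 // mulr_ge0 // cn_ge0.
move=> n X Xc; rewrite /ncpoly_eval big_cons.
apply: le_trans (mnormD _ _) _; apply: lerD; last exact: IH.
apply: le_trans (mnormZ_le _ _) _.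
by rewrite ler_wpM2l ?cn_ge0 // H.
Qed.

Lemma word_eval_lip (c : R) w : 0 <= c -> exists2 K : R, 0 <= K &
  forall n (X Y : mtuple R d n), tnorm X <= c -> tnorm Y <= c ->
    mnorm (word_eval w X - word_eval w Y) <= K * tdist X Y.
Proof.
move=> c0; elim: w => [|j w [K K0 IH]] /=.
  by exists 0 => // n X Y _ _; rewrite subrr mnorm0 mul0r.
have [K' K'0 H] := word_eval_bounded w c0.
exists (K' + c * K); first by rewrite addr_ge0 // mulr_ge0.
move=> n X Y Xc Yc.
have -> : X j *m word_eval w X - Y j *m word_eval w Y =
    (X j - Y j) *m word_eval w X + Y j *m (word_eval w X - word_eval w Y).
  by rewrite mulmxBl mulmxBr subrKA.
apply: le_trans (mnormD _ _) _; rewrite mulrDl; apply: lerD.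
  apply: le_trans (mnormM _ _) _; rewrite mulrC.
  by apply: ler_pM; rewrite ?mnorm_ge0 ?H // le_tdist.
apply: le_trans (mnormM _ _) _; rewrite -mulrA.
by apply: ler_pM; rewrite ?mnorm_ge0 ?IH // (le_trans (le_tnorm _ _)).
Qed.

Lemma ncpoly_eval_lip (c : R) (p : ncpoly R d) : 0 <= c ->
  exists2 K : R, 0 <= K &
  forall n (X Y : mtuple R d n), tnorm X <= c -> tnorm Y <= c ->
    mnorm (ncpoly_eval p X - ncpoly_eval p Y) <= K * tdist X Y.
Proof.
move=> c0; elim: p => [|t p [K K0 IH]].
  by exists 0 => // n X Y _ _; rewrite /ncpoly_eval !big_nil subrr mnorm0 mul0r.
have [K' K'0 H] := word_eval_lip t.2 c0.
exists (cn t.1 * K' + K); first by rewrite addr_ge0 // mulr_ge0 // cn_ge0.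
move=> n X Y Xc Yc; rewrite /ncpoly_eval !big_cons opprD addrACA -scalerBr.
apply: le_trans (mnormD _ _) _; rewrite mulrDl; apply: lerD; last exact: IH.
apply: le_trans (mnormZ_le _ _) _.
by rewrite -mulrA ler_wpM2l ?cn_ge0 // H.
Qed.

End Polynomials.

Lemma big_mxtens {V : nmodType} {k n} (F : 'I_(k * n) -> V) :
  \sum_i F i = \sum_a \sum_b F (mxtens_index (a, b)).
Proof.
rewrite pair_big /= (reindex (@mxtens_index k n)) /=; last first.
  by exists (@mxtens_unindex k n) => i _; rewrite (mxtens_indexK, mxtens_unindexK).
by apply: eq_bigr => -[].
Qed.

(** * Pencils and operator balls *)

Section Hilbert.
Context {R : realType} (H : hilbert R).
Local Notation C := R[i].
Implicit Types u v w : H.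

Lemma hdot_cn v : hdot H v v = (cn v ^+ 2)%:C%C.
Proof. by rewrite -hdotE cnE -rmorphXn. Qed.

Lemma hdotDl u v w : hdot H (u + v) w = hdot H u w + hdot H v w.
Proof. by rewrite linearDl. Qed.

Lemma hdotZl (a : C) v w : hdot H (a *: v) w = a * hdot H v w.
Proof. by rewrite linearZl_LR. Qed.

Lemma hdotDr u v w : hdot H w (u + v) = hdot H w u + hdot H w v.
Proof. by rewrite linearD. Qed.

Lemma hdotZr (a : C) v w : hdot H w (a *: v) = Num.conj a * hdot H w v.
Proof. by rewrite linearZr_LR. Qed.

Lemma hdot_sym u v : hdot H u v = Num.conj (hdot H v u).
Proof. by rewrite [LHS]hermC expr0 mul1r. Qed.

Lemma hdot_suml (I : Type) (r : seq I) (F : I -> H) w :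
  hdot H (\sum_(i <- r) F i) w = \sum_(i <- r) hdot H (F i) w.
Proof.
by apply: (big_morph (fun u => hdot H u w)) => [u v|]; rewrite ?hdotDl ?linear0l.
Qed.

Lemma hdot_sumr (I : Type) (r : seq I) (F : I -> H) w :
  hdot H w (\sum_(i <- r) F i) = \sum_(i <- r) hdot H w (F i).
Proof. by rewrite linear_sum. Qed.

Lemma hdot_eq0 v : hdot H v v = 0 -> v = 0.
Proof.
rewrite hdot_cn => /(congr1 (@complex.Re R)) /= /eqP.
by rewrite sqrf_eq0 => /eqP /cn_eq0.
Qed.

Lemma conjM_cn (a : C) : a * Num.conj a = (cn a ^+ 2)%:C%C.
Proof. by rewrite -normCK cnE rmorphXn. Qed.

Lemma cauchy_schwarz u w : cn (hdot H u w) <= cn u * cn w.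
Proof.
have [->|w0] := eqVneq w 0; first by rewrite linear0r !cn0 mulr0.
have nw : 0 < cn w.
  by rewrite lt_neqAle cn_ge0 andbT eq_sym; apply: contra w0 => /eqP/cn_eq0 ->.
pose b : C := (cn w ^- 2)%:C%C.
have bb : Num.conj b = b.
  by rewrite conj_Creal //; apply/complex_realP; exists (cn w ^- 2).
have bw : b * hdot H w w = 1.
  rewrite hdot_cn -rmorphM mulVf ?rmorph1 //.
  by rewrite expf_neq0 // gt_eqF.
(* [a *: w] is the orthogonal projection of [u] onto [w]; the inequality is the positivity of the
   squared norm of the residual. *)
pose a := b * hdot H u w.
have : 0 <= hdot H (u + (- a) *: w) (u + (- a) *: w).
  by rewrite hdot_cn lecR sqr_ge0.
have -> : hdot H (u + (- a) *: w) (u + (- a) *: w) =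
    (cn u ^+ 2 - cn w ^- 2 * cn (hdot H u w) ^+ 2)%:C%C.
  have aa : Num.conj (- a) = - (b * Num.conj (hdot H u w)).
    by rewrite rmorphN /a rmorphM /= bb.
  rewrite hdotDl !hdotDr !hdotZl !hdotZr (hdot_sym w u) aa /a.
  have -> : (cn u ^+ 2 - cn w ^- 2 * cn (hdot H u w) ^+ 2)%:C%C =
      hdot H u u - b * (hdot H u w * Num.conj (hdot H u w)).
    by rewrite conjM_cn hdot_cn -rmorphM -rmorphB.
  have := bw; set ww := hdot H w w; set z := hdot H u w => bw1.
  transitivity (hdot H u u - b * (z * Num.conj z)
     - b * (z * Num.conj z) + (b * ww) * (b * (z * Num.conj z))).
    ring.
  rewrite bw1; ring.
rewrite lecR subr_ge0 mulrC ler_pdivrMr ?exprn_gt0 // => h.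
by rewrite -ler_sqr ?nnegrE ?cn_ge0 ?mulr_ge0 ?cn_ge0 // exprMn.
Qed.

End Hilbert.

Section Pencil.
Context {R : realType} {d : nat} (Q : pencil R d).
Local Notation C := R[i].

(** Convertible to [pencil_eval] on square tuples; rectangular shapes allow block rows and columns
    to be estimated separately. *)
Definition papp {m n} (X : 'I_d -> 'M[C]_(m, n)) (v : 'I_n -> pdom Q) :
    'I_m -> pcod Q :=
  fun i => \sum_(j < d) \sum_(k < n) X j i k *: pcoef Q j (v k).

Definition qbound {m n} (X : 'I_d -> 'M[C]_(m, n)) (q : R) :=
  forall v, nsq (papp X v) <= q ^+ 2 * nsq v.

Lemma papp_scale {m n} (a : C) (X : 'I_d -> 'M[C]_(m, n)) v i :
  papp (fun j => a *: X j) v i = a *: papp X v i.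
Proof.
rewrite /papp scaler_sumr; apply: eq_bigr => j _.
by rewrite scaler_sumr; apply: eq_bigr => k _; rewrite mxE scalerA.
Qed.

Lemma papp_homog {m n} (X : 'I_d -> 'M[C]_(m, n)) (a : C) v :
  papp X (fun i => a *: v i) = fun i => a *: papp X v i.
Proof.
apply/funext => i; rewrite /papp scaler_sumr; apply: eq_bigr => j _.
rewrite scaler_sumr; apply: eq_bigr => k _.
by rewrite linearZ /= !scalerA mulrC.
Qed.

Lemma papp_add {m n} (X Y : 'I_d -> 'M[C]_(m, n)) v i :
  papp (fun j => X j + Y j) v i = papp X v i + papp Y v i.
Proof.
rewrite /papp -big_split; apply: eq_bigr => j _ /=.
by rewrite -big_split; apply: eq_bigr => k _; rewrite mxE scalerDl.
Qed.

Lemma pcoef_bound : exists2 K : R, 0 <= K &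
  forall j v, cn (pcoef Q j v) <= K * cn v.
Proof.
have hj j : exists K : R, 0 <= K /\ forall v, cn (pcoef Q j v) <= K * cn v.
  have [M hM] := pcoef_bounded Q j; exists (cn M); split; first exact: cn_ge0.
  move=> v; rewrite -lecR.
  (* [M] is an arbitrary complex number, but [M * |v|] dominates a norm, hence is nonnegative and
     equal to its own modulus. *)
  have p0 : 0 <= M * `|v| by apply: le_trans (hM v); rewrite normr_ge0.
  by rewrite rmorphM /= -!cnE -(normr_id v) -normrM ger0_norm.
have [K hK] := choice hj.
exists (\sum_j K j); first by apply: sumr_ge0 => j _; case: (hK j).
move=> j v; apply: le_trans ((hK j).2 v) _.
apply: ler_wpM2r; first exact: cn_ge0.
by rewrite (bigD1 j) //= lerDl sumr_ge0 // => k _; case: (hK k).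
Qed.

(** The constant grows with the block size, so it serves only for continuity at one fixed level. *)
Lemma qbound_crude m n : exists2 K : R, 0 <= K &
  forall (X : 'I_d -> 'M[C]_(m, n)) c, 0 <= c ->
    (forall j, mnorm (X j) <= c) -> qbound X (K * c).
Proof.
have [K K0 hK] := pcoef_bound.
pose N : R := (\sum_(i < m) \sum_(j < d) \sum_(k < n) K).
have N0 : 0 <= N by do 3!apply: sumr_ge0 => ? _.
exists N => // X c c0 Xc v; apply: le_trans (nsq_le_sum _) _.
have s0 : 0 <= Num.sqrt (nsq v) by rewrite sqrtr_ge0.
rewrite -[X in _ * X]sqr_sqrtr ?nsq_ge0 // -exprMn lerXn2r ?nnegrE //.
- by apply: sumr_ge0 => i _; apply: cn_ge0.
- by rewrite !mulr_ge0.
rewrite /N -mulrA mulr_suml; apply: ler_sum => i _.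
apply: le_trans (cn_sum _) _; rewrite mulr_suml; apply: ler_sum => j _.
apply: le_trans (cn_sum _) _; rewrite mulr_suml; apply: ler_sum => k _.
rewrite cnZ mulrCA; apply: ler_pM; rewrite ?cn_ge0 //.
  by apply: le_trans (Xc j); apply: cn_le_mnorm.
apply: le_trans (hK _ _) _; apply: ler_wpM2l => //.
by rewrite -ler_sqr ?nnegrE ?cn_ge0 // sqr_sqrtr ?nsq_ge0 // le_cn_nsq.
Qed.

Lemma qboundW {m n} (X : 'I_d -> 'M[C]_(m, n)) p q :
  0 <= p -> p <= q -> qbound X p -> qbound X q.
Proof.
move=> p0 pq Xp v; apply: le_trans (Xp v) _.
by rewrite ler_wpM2r ?nsq_ge0 // lerXn2r ?nnegrE // (le_trans p0).
Qed.

Lemma qboundD {m n} (X Y : 'I_d -> 'M[C]_(m, n)) p q : 0 <= p -> 0 <= q ->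
  qbound X p -> qbound Y q -> qbound (fun j => X j + Y j) (p + q).
Proof.
move=> p0 q0 Xp Yq v; rewrite (eq_nsq (papp_add X Y v)).
set s := Num.sqrt (nsq v).
have s2 : nsq v = s ^+ 2 by rewrite sqr_sqrtr ?nsq_ge0.
have s0 : 0 <= s by rewrite sqrtr_ge0.
rewrite s2 -exprMn mulrDl.
by apply: nsqD; rewrite ?mulr_ge0 // exprMn -s2.
Qed.

Lemma qboundZ {m n} (X : 'I_d -> 'M[C]_(m, n)) (a : C) q :
  qbound X q -> qbound (fun j => a *: X j) (cn a * q).
Proof.
move=> Xq v; rewrite (eq_nsq (papp_scale a X v)) nsqZ exprMn -[leRHS]mulrA.
by rewrite ler_wpM2l ?sqr_ge0.
Qed.

Lemma qbound_closed {m n} (X : 'I_d -> 'M[C]_(m, n)) q : 0 <= q ->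
  (forall e, 0 < e -> qbound X (q + e)) -> qbound X q.
Proof.
move=> q0 Xq v; have [v0|v0] := eqVneq (nsq v) 0.
  by have := Xq 1 ltr01 v; rewrite v0 !mulr0.
have vp : 0 < nsq v by rewrite lt_neqAle eq_sym v0 nsq_ge0.
rewrite -ler_pdivrMr //; set z := _ / _.
have z0 : 0 <= z by rewrite divr_ge0 ?nsq_ge0.
have [//|qz] := lerP z (q ^+ 2).
have qs : q < Num.sqrt z by rewrite -ltr_sqr ?nnegrE ?sqrtr_ge0 // sqr_sqrtr.
(* Half of the gap between [q] and the actual quotient at [v]: the bound [q + e] would still be
   violated there. *)
have e0 : 0 < (Num.sqrt z - q) / 2 by rewrite divr_gt0 // subr_gt0.
have p0 : 0 <= q + (Num.sqrt z - q) / 2 by rewrite addr_ge0 // ltW.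
have := Xq _ e0 v; rewrite -ler_pdivrMr // -/z -{1}(sqr_sqrtr z0).
rewrite ler_sqr ?nnegrE ?sqrtr_ge0 // => h.
by exfalso; lra.
Qed.

(** Trades the supremum for an explicit bound [q] below 1, whose slack [1 - q] can be spent on
    perturbations. The crude bound ensures that the supremum is that of a bounded set. *)
Lemma opballP n (X : mtuple R d n) :
  opball Q n X <-> (0 < n)%N /\ exists q, [/\ 0 <= q, q < 1 & qbound X q].
Proof.
have [K K0 hK] := qbound_crude n n.
have XK := hK X (tnorm X) (tnorm_ge0 _) (le_tnorm X).
have K'0 : 0 <= K * tnorm X by rewrite mulr_ge0 // tnorm_ge0.
split=> [[n0 X1]|[n0 [q [q0 q1 Xq]]]]; split=> //.
  exists (opnorm (pencil_eval Q X)); split=> //.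
    exact: opnorm_ge0 XK.
  apply: opnormP XK => // a v; exact: papp_homog.
by apply: le_lt_trans q1; apply: opnorm_le.
Qed.

Lemma nsq_split {V : normedZmodType C} {m n} (v : 'I_(m + n) -> V) :
  nsq v = nsq (v \o lshift n) + nsq (v \o @rshift m n).
Proof. by rewrite /nsq big_split_ord. Qed.

Lemma papp_block_u {m1 m2 n1 n2} (A : 'I_d -> 'M[C]_(m1, n1))
    (B : 'I_d -> 'M[C]_(m1, n2)) (D : 'I_d -> 'M[C]_(m2, n1))
    (E : 'I_d -> 'M[C]_(m2, n2)) v i :
  papp (fun j => block_mx (A j) (B j) (D j) (E j)) v (lshift m2 i) =
  papp A (v \o lshift n2) i + papp B (v \o @rshift n1 n2) i.
Proof.
rewrite /papp -big_split; apply: eq_bigr => j _ /=.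
rewrite big_split_ord /=; congr (_ + _); apply: eq_bigr => k _.
  by rewrite block_mxEul.
by rewrite block_mxEur.
Qed.

Lemma papp_block_d {m1 m2 n1 n2} (A : 'I_d -> 'M[C]_(m1, n1))
    (B : 'I_d -> 'M[C]_(m1, n2)) (D : 'I_d -> 'M[C]_(m2, n1))
    (E : 'I_d -> 'M[C]_(m2, n2)) v i :
  papp (fun j => block_mx (A j) (B j) (D j) (E j)) v (rshift m1 i) =
  papp D (v \o lshift n2) i + papp E (v \o @rshift n1 n2) i.
Proof.
rewrite /papp -big_split; apply: eq_bigr => j _ /=.
rewrite big_split_ord /=; congr (_ + _); apply: eq_bigr => k _.
  by rewrite block_mxEdl.
by rewrite block_mxEdr.
Qed.

Lemma papp0 {m n} v i : papp (fun=> 0 : 'M[C]_(m, n)) v i = 0.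
Proof. by rewrite /papp big1 // => j _; rewrite big1 // => k _; rewrite mxE scale0r. Qed.

Lemma qbound_dsum {m n} (X : mtuple R d m) (Y : mtuple R d n) q :
  qbound X q -> qbound Y q -> qbound (dsum X Y) q.
Proof.
move=> Xq Yq v; rewrite !nsq_split mulrDr; apply: lerD.
  rewrite (eq_nsq (v := papp X (v \o lshift n))) // => i /=.
  by rewrite papp_block_u papp0 addr0.
rewrite (eq_nsq (v := papp Y (v \o @rshift m n))) // => i /=.
by rewrite papp_block_d papp0 add0r.
Qed.

(* [row_mono A] makes [A] act as a contraction on Hilbert-valued columns. *)
Definition row_mono {k} (A : 'M[C]_k) : Prop :=
  (forall a, exists b0, forall b, b != b0 -> A a b = 0) /\
  (forall b, \sum_a cn (A a b) ^+ 2 <= 1).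

Lemma row_mono_nsq {V : normedModType C} {k} (A : 'M[C]_k) (y : 'I_k -> V) :
  row_mono A -> nsq (fun a => \sum_b A a b *: y b) <= nsq y.
Proof.
move=> [A1 A2]; rewrite /nsq.
have -> : \sum_a cn (\sum_b A a b *: y b) ^+ 2 =
          \sum_a \sum_b cn (A a b) ^+ 2 * cn (y b) ^+ 2.
  apply: eq_bigr => a _; have [b0 hb] := A1 a.
  rewrite (bigD1 b0) //= big1 ?addr0 => [|b bb0]; last by rewrite hb ?scale0r.
  rewrite cnZ exprMn (bigD1 b0) //= [X in _ = _ + X]big1 ?addr0 // => b bb0.
  by rewrite hb // cn0 expr0n mul0r.
rewrite exchange_big /=; apply: ler_sum => b _.
by rewrite -mulr_suml ler_piMl ?sqr_ge0.
Qed.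

Lemma papp_tens {k n} (A : 'M[C]_k) (X : mtuple R d n) v a i :
  papp (fun j => A *t X j) v (mxtens_index (a, i)) =
  \sum_b A a b *: papp X (fun l => v (mxtens_index (b, l))) i.
Proof.
rewrite /papp; under [RHS]eq_bigr do rewrite scaler_sumr.
rewrite [RHS]exchange_big /=; apply: eq_bigr => j _.
rewrite big_mxtens; apply: eq_bigr => b _; rewrite scaler_sumr.
by apply: eq_bigr => l _; rewrite tensmxE scalerA.
Qed.

(** Up to regrouping indices, the value of [Q] at [A *t X] is [A] acting on the block outputs of
    [Q(X)]: contractivity of [A] is used for each inner index, then the bound on [X] for each
    block. *)
Lemma qbound_tens {k n} (A : 'M[C]_k) (X : mtuple R d n) q :
  row_mono A -> qbound X q -> qbound (fun j => A *t X j) q.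
Proof.
move=> Am Xq v; rewrite /nsq !big_mxtens.
under eq_bigr do under eq_bigr do rewrite papp_tens.
rewrite exchange_big /=.
apply: (@le_trans _ _ (\sum_(i < n) \sum_(b < k)
   cn (papp X (fun l => v (mxtens_index (b, l))) i) ^+ 2)).
  apply: ler_sum => i _.
  exact: (row_mono_nsq (fun b => papp X (fun l => v (mxtens_index (b, l))) i)).
rewrite exchange_big mulr_sumr /=; apply: ler_sum => b _.
exact: (Xq (fun l => v (mxtens_index (b, l)))).
Qed.

(** Test the bound on [v] extended by zero: only the second block column acts, and its two blocks
    give the two terms. *)
Lemma column_bound {m n} (c : 'I_d -> 'M[C]_(m, n)) (a : mtuple R d m)
    (b : mtuple R d n) (v : 'I_n -> pdom Q) :
  qbound (fun j => block_mx (a j) (c j) 0 (b j)) 1 ->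
  nsq (papp c v) + nsq (papp b v) <= nsq v.
Proof.
pose w : 'I_(m + n) -> pdom Q :=
  fun i => match fintype.split i with inl _ => 0 | inr k => v k end.
have wl i : w (lshift n i) = 0 by rewrite /w; case: fintype.splitP => // k /= ik;
  move: (ltn_ord i); rewrite ik ltnNge leq_addr.
have wr i : w (rshift m i) = v i.
  rewrite /w; case: fintype.splitP => [k /= ik|k /= /addnI ik].
    by move: (ltn_ord k); rewrite -ik ltnNge leq_addr.
  by congr v; apply: val_inj.
move=> /(_ w); rewrite expr1n mul1r (nsq_split w) nsq_split.
have -> : nsq (w \o lshift n) = 0.
  by rewrite /nsq big1 // => i _; rewrite /= wl cn0 expr0n.
rewrite add0r (eq_nsq wr) => /(le_trans _); apply.
have p0 r s (Z : 'I_d -> 'M[C]_(r, s)) i : papp Z (fun=> 0) i = 0.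
  rewrite /papp big1 // => j _; rewrite big1 // => k _.
  by rewrite linear0 scaler0.
have wl0 : w \o lshift n = fun=> 0 by apply/funext => i; exact: wl.
have wr0 : w \o @rshift m n = v by apply/funext => i; exact: wr.
rewrite le_eqVlt; apply/orP; left; apply/eqP; congr (_ + _); apply: eq_nsq => i /=.
  by rewrite papp_block_u wl0 wr0 p0 add0r.
by rewrite (papp_block_d a c (fun=> 0)) wl0 wr0 p0 add0r.
Qed.

End Pencil.

(** * Boundedness of operator balls *)

Section BallBounded.
Context {R : realType} {d : nat} (Q : pencil R d).
Local Notation C := R[i].

Let pair_row (vw : pdom Q * pcod Q) : 'rV[C]_d :=
  \row_j hdot (pcod Q) (pcoef Q j vw.1) vw.2.

Let ranks (r : nat) := exists k (f : 'I_k -> pdom Q * pcod Q),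
  \rank (\matrix_i pair_row (f i)) = r.

(* By linear independence, the functionals [c |-> <\sum_j c_j Q_j v, w>]
   span the dual of [C^d]. *)
Lemma pencil_separating : exists k (f : 'I_k -> pdom Q * pcod Q),
  row_full (\matrix_i pair_row (f i)).
Proof.
have exr : exists r, `[< ranks r >].
  exists (\rank (\matrix_(i < 0) pair_row ((fun=> (0, 0)) i))).
  by apply/asboolP; exists 0, (fun=> (0, 0)).
have ler r : `[< ranks r >] -> (r <= d)%N.
  by move=> /asboolP[k [f <-]]; apply: rank_leq_col.
(* Choose a family of maximal rank. If it were not full, some [c != 0] would be killed by all its
   rows; independence provides [v] with [w = sum_j c_j Q_j v != 0], and adding the pair [(v, w)]
   would raise the rank. *)
case: (ex_maxnP exr ler) => r /asboolP[k [f rf]] rmax.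
exists k, f; set M := \matrix_i _; apply/negPn/negP => nfull.
have [c /eqP Mc c0] : exists2 c : 'cV[C]_d, M *m c == 0 & c != 0.
  have : (cokermx M) != 0.
    by rewrite -mxrank_eq0 mxrank_coker subn_eq0 -ltnNge ltn_neqAle rank_leq_col andbT.
  case/matrix0Pn => i [j Mij]; exists (col j (cokermx M)).
    by rewrite colE mulmxA mulmx_coker mul0mx.
  by apply/matrix0Pn; exists i, 0; rewrite mxE.
have [vw vwc] : exists vw, pair_row vw *m c != 0.
  apply: contrapT => /forallNP h; move/negP: c0; apply; apply/eqP/matrixP => i j.
  rewrite [j]ord1 !mxE; apply: (pcoef_free Q (fun j => c j 0)) => v.
  apply: hdot_eq0; set w := (X in hdot _ _ X).
  have /negP/negPn/eqP/matrixP/(_ 0 0) := h (v, w); rewrite !mxE => <-.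
  rewrite {1}/w hdot_suml; apply: eq_bigr => l _.
  by rewrite hdotZl !mxE mulrC.
pose f' (i : 'I_k.+1) := if unlift ord0 i is Some i' then f i' else vw.
pose N := \matrix_i pair_row (f' i).
have MN : (M <= N)%MS.
  apply/row_subP => i; rewrite (_ : row i M = row (lift ord0 i) N) ?row_sub //.
  by rewrite !rowK /f' liftK.
have rN : (\rank N <= r)%N.
  by apply: rmax; apply/asboolP; exists k.+1, f'.
have NM : (N <= M)%MS.
  by rewrite -(mxrank_leqif_sup MN).2 rf eqn_leq rN -rf mxrankS.
have : (pair_row vw <= M)%MS.
  apply: submx_trans NM; rewrite (_ : pair_row vw = row ord0 N) ?row_sub //.
  by rewrite rowK /f' unlift_none.
move=> /submxP[D eD]; move/negP: vwc; apply.
by rewrite eD -mulmxA Mc mulmx0.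
Qed.

(** A left inverse [D] of the separating matrix recovers each [X j] as a fixed combination of
    compressions of [Q(X)] to single pairs of vectors. Each compression is bounded by
    Cauchy-Schwarz, so [c] is independent of [n]. *)
Lemma ball_bounded : exists2 c : R, 0 <= c &
  forall n (X : mtuple R d n), qbound Q X 1 -> tnorm X <= c.
Proof.
have [k [f full]] := pencil_separating.
set M := \matrix_i _ in full.
have [D eD] : exists D : 'M[C]_(d, k), 1%:M = D *m M.
  by apply/submxP; rewrite sub1mx.
pose c := \sum_j \sum_a cn (D j a) * (cn (f a).1 * cn (f a).2).
have c0 : 0 <= c.
  by apply: sumr_ge0 => j _; apply: sumr_ge0 => a _; rewrite !mulr_ge0 ?cn_ge0.
exists c => // n X X1; apply: tnorm_le => // j.
have -> : X j = \sum_a (D j a *: (\sum_l (M a l *: X l))).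
  transitivity (\sum_l (1%:M : 'M[C]_d) j l *: X l).
    rewrite (bigD1 j) //= mxE eqxx scale1r big1 ?addr0 // => l lj.
    by rewrite mxE eq_sym (negbTE lj) scale0r.
  rewrite eD; under eq_bigr do rewrite mxE scaler_suml.
  rewrite exchange_big /=; apply: eq_bigr => a _.
  by rewrite scaler_sumr; apply: eq_bigr => l _; rewrite scalerA.
apply: (@le_trans _ _ (\sum_a cn (D j a) * (cn (f a).1 * cn (f a).2))); last first.
  rewrite /c (bigD1 j) //= lerDl; apply: sumr_ge0 => i _; apply: sumr_ge0 => a _.
  by rewrite !mulr_ge0 ?cn_ge0.
apply: le_trans (mnorm_sum _ _) _; apply: ler_sum => a _.
apply: le_trans (mnormZ_le _ _) _; apply: ler_wpM2l; first exact: cn_ge0.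
apply: mnorm_le => [|v]; first by rewrite mulr_ge0 ?cn_ge0.
apply: (@le_trans _ _ (nsq (fun i => hdot (pcod Q)
    (papp X (fun i => v i *: (f a).1) i) (f a).2))).
  rewrite le_eqVlt; apply/orP; left; apply/eqP/eq_nsq => i.
  rewrite /mapp /papp hdot_suml.
  under eq_bigr do rewrite summxE mulr_suml.
  rewrite exchange_big /=; apply: eq_bigr => l _.
  rewrite hdot_suml; apply: eq_bigr => k' _.
  by rewrite hdotZl linearZ hdotZl !mxE; ring.
apply: (@le_trans _ _ (cn (f a).2 ^+ 2 *
    nsq (papp X (fun i => v i *: (f a).1)))).
  rewrite /nsq mulr_sumr; apply: ler_sum => i _.
  rewrite mulrC -exprMn lerXn2r ?nnegrE ?mulr_ge0 ?cn_ge0 //.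
  exact: cauchy_schwarz.
have := X1 (fun i => v i *: (f a).1); rewrite expr1n mul1r => h.
apply: le_trans (ler_wpM2l (sqr_ge0 _) h) _.
have -> : nsq (fun i => v i *: (f a).1) = cn (f a).1 ^+ 2 * nsq v.
  by rewrite /nsq mulr_sumr; apply: eq_bigr => i _; rewrite cnZ exprMn mulrC.
by rewrite exprMn mulrA [X in X * _ <= _]mulrC.
Qed.

End BallBounded.

(** * Intertwining and similarity *)

Section NcDomains.
Context {R : realType}.
Local Notation C := R[i].

Definition inV {d} {V : ncdom R d} {n} {X : mtuple R d n} (h : V n X) : V n :=
  SigSub (mem_set h).

Lemma val_inV {d} {V : ncdom R d} {n} (X : mtuple R d n) (h : V n X) :
  val (inV h) = X.
Proof. by []. Qed.

Lemma memV {d} {V : ncdom R d} {n} (X : V n) : V n (val X).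
Proof. exact: set_mem (valP X). Qed.

Definition dsum_closed {d} (V : ncdom R d) := forall m n (X : mtuple R d m) (Y : mtuple R d n),
  V m X -> V n Y -> V (m + n)%N (dsum X Y).

Definition shear {m n} (L : 'M[C]_(n, m)) : 'M[C]_(m + n) := block_mx 1%:M 0 L 1%:M.

Lemma shear_unit {m n} (L : 'M[C]_(n, m)) : shear L \in unitmx.
Proof. by rewrite unitmxE /shear det_lblock !det1 mulr1 unitr1. Qed.

Lemma tconj_fix {d n} (E : 'M[C]_n) (X : mtuple R d n) : E \in unitmx ->
  (forall j, E *m X j = X j *m E) <-> tconj E X = X.
Proof.
move=> uE; split=> [h|h j].
  by apply/funext => j; rewrite /tconj -mulmxA -h mulKmx.
have hj : X j = invmx E *m X j *m E by rewrite -{1}h.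
by rewrite {1}hj -mulmxA mulKVmx.
Qed.

Lemma shear_dsum {d m n} (L : 'M[C]_(n, m)) (X : mtuple R d m) (Y : mtuple R d n) j :
  (shear L *m dsum X Y j = dsum X Y j *m shear L) <-> (L *m X j = Y j *m L).
Proof.
rewrite /shear /dsum !mulmx_block !mulmx0 !mul0mx !mulmx1 !mul1mx !addr0 !add0r.
by split=> [/eq_block_mx[]|->].
Qed.

(** The similarity axiom is applied with [X (+) Y] as both source and target. *)
Lemma nc_twine {d l} {V : ncdom R d} (f : tupfun V l) : dsum_closed V ->
  is_nc f -> forall m n (X : V m) (Y : V n) (L : 'M[C]_(n, m)),
  (forall j, L *m val X j = val Y j *m L) ->
  forall j, L *m f _ X j = f _ Y j *m L.
Proof.
move=> Vd [fd fs] m n X Y L LXY j.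
pose Z := inV (Vd _ _ _ _ (memV X) (memV Y)).
have fZ : f _ Z = dsum (f _ X) (f _ Y) by apply: fd.
have uE := shear_unit L.
have ZE : val Z = tconj (shear L) (val Z).
  by apply/esym/tconj_fix => // k; apply/shear_dsum.
have /esym/tconj_fix := fs _ _ Z Z uE ZE.
by move=> /(_ uE j); rewrite fZ => /shear_dsum.
Qed.

Lemma scal_twine {d} {V : ncdom R d} (f : scalfun V) : dsum_closed V ->
  is_nc (tupfun_of_scal f) -> forall m n (X : V m) (Y : V n) (L : 'M[C]_(n, m)),
  (forall j, L *m val X j = val Y j *m L) -> L *m f _ X = f _ Y *m L.
Proof.
by move=> Vd fnc m n X Y L LXY; apply: (nc_twine Vd fnc LXY ord0).
Qed.

(** The working form of a homogeneous subvariety, on which everything below is built. The full ball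
    is the case where [P] is empty, so the Taylor formula can be used on the ball before it is known
    that [V] has this form. *)
Definition pvar {d} (Q : pencil R d) (P : set (ncpoly R d)) (V : ncdom R d) : Prop :=
  (forall p, P p -> exists m : nat, hompoly m p) /\
  forall n (X : mtuple R d n), V n X <-> opball Q n X /\ forall p, P p -> ncpoly_eval p X = 0.

Section Pvar.
(* [ncdom] unfolds to a product: automatic implicit arguments would hide the size
   argument of [V]. *)
Unset Implicit Arguments.
Context {d : nat} {Q : pencil R d} {P : set (ncpoly R d)} {V : ncdom R d}.
Set Implicit Arguments.
Hypothesis VP : pvar Q P V.

Lemma pvar_qbound n (X : mtuple R d n) : V n X -> exists q, [/\ 0 <= q, q < 1 & qbound Q X q].
Proof. by move=> /VP.2 [/opballP [_]]. Qed.

Lemma pvar_gt0 n (X : mtuple R d n) : V n X -> (0 < n)%N.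
Proof. by move=> /VP.2 [/opballP []]. Qed.

Lemma pvar_qbound1 n (X : mtuple R d n) : V n X -> qbound Q X 1.
Proof. by move=> /pvar_qbound [q [q0 q1]]; apply: qboundW => //; apply: ltW. Qed.

Lemma pvar_poly n (X : mtuple R d n) p : V n X -> P p -> ncpoly_eval p X = 0.
Proof. by move=> /VP.2 [_]; apply. Qed.

Lemma pvarI n (X : mtuple R d n) q : (0 < n)%N -> 0 <= q -> q < 1 -> qbound Q X q ->
  (forall p, P p -> ncpoly_eval p X = 0) -> V n X.
Proof. by move=> n0 q0 q1 Xq pX; apply/VP.2; split=> //; apply/opballP; split=> //; exists q. Qed.

Lemma pvar_dsum : dsum_closed V.
Proof.
move=> m n X Y VX VY.
have [q [q0 q1 Xq]] := pvar_qbound VX; have [r [r0 r1 Yr]] := pvar_qbound VY.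
apply: (@pvarI _ _ (Num.max q r)).
- by rewrite addn_gt0 (pvar_gt0 VX).
- by rewrite le_max q0.
- by rewrite gt_max q1 r1.
- by apply: qbound_dsum; [apply: qboundW Xq|apply: qboundW Yr] => //;
    rewrite le_max lexx ?orbT.
- move=> p Pp; rewrite ncpoly_eval_dsum.
  by rewrite (pvar_poly VX Pp) (pvar_poly VY Pp) block_mx0.
Qed.

Lemma pvar_scale n (X : mtuple R d n) (a : C) : cn a <= 1 -> V n X -> V n (fun j => a *: X j).
Proof.
move=> a1 VX; have [q [q0 q1 Xq]] := pvar_qbound VX.
apply: (@pvarI _ _ (cn a * q)).
- exact: pvar_gt0 VX.
- by rewrite mulr_ge0 ?cn_ge0.
- by apply: le_lt_trans q1; rewrite ler_piMl.
- exact: qboundZ.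
- move=> p Pp; have [m hm] := VP.1 p Pp.
  by rewrite (hompoly_scale _ _ hm) (pvar_poly VX Pp) scaler0.
Qed.

Lemma pvar_tscale n (X : mtuple R d n) r : 0 <= r -> r <= 1 -> V n X -> V n (tscale r X).
Proof. by move=> r0 r1; apply: pvar_scale; rewrite cn_real ger0_norm. Qed.

Lemma pvar_sub k n (B : 'M[C]_(k, n)) (A : mtuple R d n) (T : mtuple R d k) :
  row_free B -> V n A -> opball Q k T -> (forall j, B *m A j = T j *m B) -> V k T.
Proof.
move=> Bf VA QT BT; apply/VP.2; split=> // p Pp.
have /row_freeP[D BD] := Bf.
rewrite -[LHS]mulmx1 -BD mulmxA -(ncpoly_eval_twine BT).
by rewrite (pvar_poly VA Pp) mulmx0 mul0mx.
Qed.

Lemma pvar_tens k n (A : 'M[C]_k) (X : mtuple R d n) : (0 < k)%N ->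
  row_mono A -> V n X -> V (k * n)%N (fun j => A *t X j).
Proof.
move=> k0 Am VX; have [q [q0 q1 Xq]] := pvar_qbound VX.
apply: (@pvarI _ _ q) => //; first by rewrite muln_gt0 k0 (pvar_gt0 VX).
  exact: qbound_tens.
move=> p Pp; have [m hm] := VP.1 p Pp.
by rewrite (hompoly_tens _ _ hm) (pvar_poly VX Pp) tensmx0.
Qed.

Lemma pvar_bounded : exists2 c : R, 0 <= c &
  forall n (X : mtuple R d n), V n X -> tnorm X <= c.
Proof.
have [c c0 hc] := ball_bounded Q; exists c => // n X VX.
exact: hc (pvar_qbound1 VX).
Qed.

End Pvar.
End NcDomains.

(** * The Taylor formula *)

Section Krylov.
Context {R : realType} {d n : nat}.
Local Notation C := R[i].
Variables (A : mtuple R d n) (u : 'rV[C]_n).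

(** The row space spanned by the vectors [u *m word_eval w A] with [w] of length [m]. Keeping the
    degrees apart is what later yields homogeneous polynomials. *)
Fixpoint krylov m : 'M[C]_n :=
  if m is m'.+1 then (\sum_j <<krylov m' *m A j>>)%MS else <<u>>%MS.

Lemma krylov_poly m (w : 'rV[C]_n) : (w <= krylov m)%MS ->
  exists2 p, hompoly m p & w = u *m ncpoly_eval p A.
Proof.
elim: m w => [|m IH] w /=.
  rewrite genmxE => /sub_rVP[a ->]; exists [:: (a, [::])] => //.
  by rewrite /ncpoly_eval big_seq1 /= -scalemxAr mulmx1.
move=> /sub_sumsmxP[v ->].
elim/big_ind: _ => [|x y [p hp ->] [q hq ->]|j _].
- by exists [::] => //; rewrite /ncpoly_eval big_nil mulmx0.
- by exists (p ++ q); [exact: hompoly_cat|rewrite ncpoly_eval_cat mulmxDr].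
have : (v j *m <<krylov m *m A j>> <= krylov m *m A j)%MS.
  by apply: submx_trans (submxMl _ _) _; rewrite genmxE.
move=> /submxP[D ->]; rewrite mulmxA.
have [p hp ->] := IH _ (submxMl D (krylov m)).
exists [seq (t.1, rcons t.2 j) | t <- p].
  rewrite /hompoly all_map; apply: sub_all hp => t /= /eqP <-.
  by rewrite size_rcons.
rewrite /ncpoly_eval big_map -mulmxA mulmx_suml; congr (_ *m _).
by apply: eq_bigr => t _ /=; rewrite word_eval_rcons scalemxAl.
Qed.

Definition krylovs N := (\sum_(m < N) krylov m)%MS.

Lemma krylovs_poly N (w : 'rV[C]_n) : (w <= krylovs N)%MS ->
  exists2 p : nat -> ncpoly R d, (forall m, hompoly m (p m)) &
    w = \sum_(m < N) u *m ncpoly_eval (p m) A.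
Proof.
move=> /sub_sumsmxP[v ->].
have h (m : 'I_N) : exists p, hompoly m p /\ v m *m krylov m = u *m ncpoly_eval p A.
  by have [p hp e] := krylov_poly (submxMl (v m) (krylov m)); exists p.
have [p hp] := choice h.
(* Degrees from [N] on receive the empty sum, which is homogeneous of every degree. *)
exists (fun m => if insub m is Some i then p i else [::]).
  by move=> m; case: insubP => // i _ <-; case: (hp i).
by apply: eq_bigr => m _; rewrite valK; case: (hp m).
Qed.

Variable N : nat.
Hypothesis nilA : forall w, size w = N -> word_eval w A = 0.

Lemma krylov_nil : krylov N = 0.
Proof.
apply/eqP; rewrite -submx0; apply/row_subP => i.
have [p hp ->] := krylov_poly (row_sub i (krylov N)).
rewrite /ncpoly_eval big_seq big1 ?mulmx0 ?sub0mx // => t tp.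
by rewrite nilA ?scaler0 //; apply/eqP; move/allP: hp => /(_ t tp).
Qed.

(** Multiplication by [A j] raises the degree by one, and degree [N] vanishes by nilpotency. *)
Lemma krylovs_stable j : (krylovs N *m A j <= krylovs N)%MS.
Proof.
apply/row_subP => i; rewrite row_mul.
have /sub_sumsmxP[v ->] := row_sub i (krylovs N).
rewrite mulmx_suml; apply: summx_sub => m _; rewrite -mulmxA.
apply: submx_trans (submxMl _ _) _.
have : (krylov m *m A j <= krylov m.+1)%MS.
  by rewrite /= (sumsmx_sup j) // genmxE.
have [mN|mN] := boolP (m.+1 < N)%N.
  by move=> /submx_trans; apply; rewrite (sumsmx_sup (Ordinal mN)).
have -> : m.+1 = N by apply/eqP; rewrite eqn_leq ltn_ord leqNgt mN.
by rewrite krylov_nil => /submx_trans; apply; rewrite sub0mx.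
Qed.

End Krylov.

Section Cyclic.
Context {R : realType}.
Local Notation C := R[i].
Unset Implicit Arguments.
Context {d : nat} {Q : pencil R d} {P : set (ncpoly R d)} {V : ncdom R d}.
Set Implicit Arguments.
Hypothesis VP : pvar Q P V.

(* The cyclic subspace of [u] is invariant, so the restriction of [e A] to it is
   again a point of [V]; nilpotency allows for the small factor [e]. *)
Lemma cyclic_poly (f : scalfun V) n (A : mtuple R d n) (u : 'rV[C]_n) N :
  is_nc (tupfun_of_scal f) -> V n A ->
  (forall w, size w = N -> word_eval w A = 0) ->
  exists e : R, [/\ 0 < e, e <= 1 & forall VA : V n (tscale e A),
    exists2 p : nat -> ncpoly R d, (forall m, hompoly m (p m)) &
    u *m f _ (inV VA) = \sum_(m < N) u *m ncpoly_eval (p m) A].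
Proof.
move=> fnc VA nilA; set W := krylovs A u N.
pose B := row_base W; pose k := \rank W.
pose T : mtuple R d k := fun j => B *m A j *m pinvmx B.
have BT j : B *m A j = T j *m B.
  rewrite /T mulmxKpV // eq_row_base; apply: submx_trans (krylovs_stable u nilA j).
  by rewrite submxMr // eq_row_base.
have [K K0 hK] := qbound_crude Q k k.
have TK : qbound Q T (K * tnorm T) by apply: hK; [exact: tnorm_ge0|exact: le_tnorm].
set c := K * tnorm T in TK.
have c0 : 0 <= c by rewrite mulr_ge0 // tnorm_ge0.
have c1 : 0 < 1 + c by rewrite ltr_pwDl.
(* [T] expresses the restriction of [A] to [W] in an arbitrary basis, so its size under [Q] is
   uncontrolled; this factor gives [e * c < 1]. *)
pose e := (1 + c)^-1.
have e0 : 0 < e by rewrite invr_gt0.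
have e1 : e <= 1 by rewrite invf_le1 // lerDl.
exists e; split=> // VeA.
suff : (u *m f _ (inV VeA) <= W)%MS by apply: krylovs_poly.
have [u0|u0] := eqVneq u 0; first by rewrite u0 mul0mx sub0mx.
have uW : (u <= W)%MS.
  have N0 : (0 < N)%N.
    rewrite lt0n; apply: contra u0 => /eqP N0.
    have := nilA [::] (esym N0); rewrite /= => h.
    by rewrite -[u]mulmx1 h mulmx0.
  by rewrite (sumsmx_sup (Ordinal N0)) //= genmxE.
have k0 : (0 < k)%N.
  by rewrite lt0n mxrank_eq0; apply: contra u0 => /eqP W0; rewrite W0 submx0 in uW.
have VT : V k (tscale e T).
  apply: (@pvar_sub _ _ _ _ _ VP _ _ B (tscale e A)) => //.
  - exact: row_base_free.
  - apply/opballP; split=> //; exists (e * c); split.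
    + by rewrite mulr_ge0 // ltW.
    + by rewrite /e mulrC ltr_pdivrMr // mul1r ltrDr.
    + have := qboundZ (e%:C%C) TK; rewrite cn_real ger0_norm ?(ltW e0) //.
  - by move=> j; rewrite /tscale -scalemxAr BT scalemxAl.
have Bf : B *m f _ (inV VeA) = f _ (inV VT) *m B.
  apply: (scal_twine (pvar_dsum VP) fnc) => j.
  by rewrite !val_inV /tscale -scalemxAr BT scalemxAl.
have uB : u = u *m pinvmx B *m B by rewrite mulmxKpV // eq_row_base.
by rewrite uB -mulmxA Bf mulmxA (submx_trans (submxMl _ _)) // eq_row_base.
Qed.

End Cyclic.

(** * Jordan blocks and a contraction with a prescribed eigenvalue *)

Section Jordan.
Context {R : realType}.
Local Notation C := R[i].

Definition jordan N : 'M[C]_N := \matrix_(a, b) (b == a.+1 :> nat)%:R.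

Lemma jordan_pow N m (a b : 'I_N) :
  iter m (mulmx (jordan N)) 1%:M a b = (b == (a + m)%N :> nat)%:R.
Proof.
elim: m a b => [|m IH] a b; first by rewrite mxE addn0 eq_sym.
rewrite iterS mxE; have [aN|aN] := boolP (a.+1 < N)%N.
  rewrite (bigD1 (Ordinal aN)) //= IH mxE /= eqxx mul1r big1 ?addr0 => [|c ca].
    by rewrite addSnnS.
  rewrite mxE (_ : (c == a.+1 :> nat) = false) ?mul0r //.
  by apply: contraNF ca => /eqP ca; apply/eqP/val_inj.
rewrite big1 => [|c _].
  rewrite (_ : (b == (a + m.+1)%N :> nat) = false) //.
  apply: contraNF aN => /eqP bam; rewrite (leq_ltn_trans _ (ltn_ord b)) //.
  by rewrite bam addnS ltnS leq_addr.
rewrite mxE (_ : (c == a.+1 :> nat) = false) ?mul0r //.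
by apply: contraNF aN => /eqP <-.
Qed.

Lemma sum_le1 N (F : 'I_N -> R) (a0 : 'I_N) : F a0 <= 1 ->
  (forall a, a != a0 -> F a = 0) -> \sum_a F a <= 1.
Proof. by move=> F0 Fa; rewrite (bigD1 a0) //= big1 ?addr0. Qed.

Lemma cn1 : cn (1 : C) = 1.
Proof. by rewrite /cn normr1. Qed.

Lemma row_mono1 n : row_mono (1%:M : 'M[C]_n).
Proof.
split=> [a|b]; first by exists a => b ba; rewrite mxE eq_sym (negbTE ba).
apply: (@sum_le1 _ _ b); first by rewrite mxE eqxx cn1 expr1n.
by move=> a ab; rewrite mxE (negbTE ab) cn0 expr0n.
Qed.

Lemma row_mono_jordan N : row_mono (jordan N).
Proof.
split=> [a|b].
  have [aN|aN] := boolP (a.+1 < N)%N.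
    exists (Ordinal aN) => b ba; rewrite mxE (_ : (b == a.+1 :> nat) = false) //.
    by apply: contraNF ba => /eqP ba; apply/eqP/val_inj.
  exists a => b _; rewrite mxE (_ : (b == a.+1 :> nat) = false) //.
  by apply: contraNF aN => /eqP <-.
have [b0|b0] := posnP b.
  by rewrite big1 ?ler01 // => a _; rewrite mxE b0 /= cn0 expr0n.
have bN : (b.-1 < N)%N by rewrite (leq_ltn_trans (leq_pred _)).
apply: (@sum_le1 _ _ (Ordinal bN)).
  by rewrite mxE /= prednK // eqxx cn1 expr1n.
move=> a ab; rewrite mxE (_ : (b == a.+1 :> nat) = false) ?cn0 ?expr0n //.
apply: contraNF ab => /eqP ab; apply/eqP/val_inj => /=.
by rewrite ab.
Qed.

(* The Jordan block with its last row and column replaced so that [r] becomes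
   an eigenvalue. *)
Definition tmat N (r : R) : 'M[C]_N.+1 := \matrix_(a, b)
  (if b == a.+1 :> nat then (if b == N :> nat then (1 - r)%:C%C else 1)
   else if (a == N :> nat) && (b == N :> nat) then r%:C%C else 0).

(** Only the last column can have two nonzero entries, [1 - r] and [r], and
    [(1 - r) ^ 2 + r ^ 2 <= 1]. *)
Lemma row_mono_tmat N r : 0 <= r -> r <= 1 -> row_mono (tmat N r).
Proof.
move=> r0 r1; have r10 : 0 <= 1 - r by rewrite subr_ge0.
split=> [a|b].
  have [aN|aN] := ltnP a N.
    have aN' : (a.+1 < N.+1)%N by [].
    exists (Ordinal aN') => b ba; rewrite mxE (_ : (b == a.+1 :> nat) = false).
      by rewrite ltn_eqF.
    by apply: contraNF ba => /eqP ba; apply/eqP/val_inj.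
  have aE : a = N :> nat by apply/eqP; rewrite eqn_leq -ltnS ltn_ord.
  exists ord_max => b ba; rewrite mxE aE (_ : (b == N.+1 :> nat) = false).
    rewrite eqxx /= (_ : (b == N :> nat) = false) //.
    by apply: contraNF ba => /eqP ba; apply/eqP/val_inj.
  by rewrite ltn_eqF.
have [b0|b0] := posnP b.
  apply: (@sum_le1 _ _ ord_max).
    rewrite mxE b0 /=; case: ifP => _; last by rewrite cn0 expr0n.
    by rewrite cn_real expr_le1 // ger0_norm.
  move=> a aN; rewrite mxE b0 /= (_ : (a == N :> nat) = false).
    by rewrite cn0 expr0n.
  by apply: contraNF aN => /eqP aN; apply/eqP/val_inj.
have bN : (b.-1 < N)%N by rewrite prednK // -ltnS.
rewrite big_ord_recr /= (bigD1 (Ordinal bN)) //= big1 ?addr0 => [|a ab]; last first.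
  rewrite mxE /= (_ : (b == a.+1 :> nat) = false) ?(ltn_eqF (ltn_ord a)) ?cn0 ?expr0n //.
  apply: contraNF ab => /eqP ab; apply/eqP/val_inj => /=.
  by rewrite ab.
rewrite !mxE /= prednK // eqxx /= (ltn_eqF (ltn_ord b)) eqxx /=.
case: ifP => _.
  rewrite !cn_real !ger0_norm //.
  by rewrite -subr_ge0 (_ : 1 - _ = 2 * (r * (1 - r))); [rewrite !mulr_ge0|ring].
by rewrite cn1 cn0 expr1n expr0n addr0.
Qed.

(** Eigenvector of [tmat N r] for [r]. The last entry compensates the weight [1 - r], and it becomes
    the constant in the Taylor remainder. *)
Definition tvec N (r : R) (a : 'I_N.+1) : C :=
  if a == N :> nat then (r ^+ N / (1 - r))%:C%C else (r ^+ a)%:C%C.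

Lemma tmat_vec N r (a : 'I_N.+1) : r < 1 -> 
  mapp (tmat N r) (@tvec N r) a = r%:C%C * tvec r a.
Proof.
move=> r1; have r10 : 1 - r != 0 by rewrite gt_eqF // subr_gt0.
rewrite /mapp; have [aN|aN] := ltnP a N.
  have aN' : (a.+1 < N.+1)%N by [].
  rewrite (bigD1 (Ordinal aN')) //= big1 ?addr0 => [|b ba]; last first.
    rewrite mxE (_ : (b == a.+1 :> nat) = false).
      by rewrite (ltn_eqF aN) mul0r.
    by apply: contraNF ba => /eqP ba; apply/eqP/val_inj.
  rewrite mxE eqxx /tvec /= (ltn_eqF aN) -rmorphM -exprS.
  case: ifP => [/eqP ->|_]; last by rewrite mul1r.
  by rewrite -rmorphM; congr (_%:C%C); field.
have aE : a = N :> nat by apply/eqP; rewrite eqn_leq -ltnS ltn_ord.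
rewrite (bigD1 ord_max) //= big1 ?addr0 => [|b ba]; last first.
  rewrite mxE aE (ltn_eqF (ltn_ord b)) eqxx /= (_ : (b == N :> nat) = false) ?mul0r //.
  by apply: contraNF ba => /eqP ba; apply/eqP/val_inj.
rewrite mxE /= aE (ltn_eqF (ltnSn N)) eqxx /=.
by rewrite /tvec /= aE eqxx.
Qed.

(** The column [l] tensored with the identity of size [D], written out so that its width is [D] and
    not [1 * D]. *)
Definition tcol {k D} (l : 'I_k -> C) : 'M[C]_(k * D, D) :=
  \matrix_(q, b) (l (mxtens_unindex q).1 * ((mxtens_unindex q).2 == b)%:R).

Lemma tcolE {k D} (l : 'I_k -> C) a (i b : 'I_D) :
  tcol l (mxtens_index (a, i)) b = l a * (i == b)%:R.
Proof. by rewrite mxE mxtens_indexK. Qed.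

Lemma mul_tcol {k D D'} (l : 'I_k -> C) (Z : 'M[C]_(D, D')) a i b :
  (tcol l *m Z) (mxtens_index (a, i)) b = l a * Z i b.
Proof.
rewrite mxE; under eq_bigr do rewrite tcolE -mulrA.
by rewrite -mulr_sumr (sum_delta (Z^~ b)).
Qed.

Lemma tens_tcol {k D} (A : 'M[C]_k) (M : 'M[C]_D) (l : 'I_k -> C) :
  (A *t M) *m tcol l = tcol (mapp A l) *m M.
Proof.
apply/matrixP => q b; case: (mxtens_indexP q) => a i.
rewrite mul_tcol mxE big_mxtens /mapp mulr_suml; apply: eq_bigr => c _.
rewrite (eq_bigr (fun j => (b == j)%:R * (A a c * l c * M i j))) => [|j _].
  by rewrite (sum_delta (fun j => A a c * l c * M i j)).
by rewrite tensmxE tcolE eq_sym; ring.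
Qed.

Lemma mul_by_tcol {k D m} (Z : 'M[C]_(m, k * D)) (l : 'I_k -> C) q b :
  (Z *m tcol l) q b = \sum_a Z q (mxtens_index (a, b)) * l a.
Proof.
rewrite mxE big_mxtens; apply: eq_bigr => a _.
rewrite (eq_bigr (fun j => (b == j)%:R * (Z q (mxtens_index (a, j)) * l a))) => [|j _].
  by rewrite (sum_delta (fun j => Z q (mxtens_index (a, j)) * l a)).
by rewrite tcolE eq_sym; ring.
Qed.

End Jordan.

Section DiagTensor.
Context {R : realType}.
Local Notation C := R[i].

Definition dg {k} (g : 'I_k -> C) : 'M[C]_k :=
  \matrix_(a, b) ((a == b)%:R * g a).

Lemma dg_mull {k l} (g : 'I_k -> C) (Z : 'M[C]_(k, l)) a b :
  (dg g *m Z) a b = g a * Z a b.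
Proof.
rewrite mxE -[RHS](sum_delta (fun c => g a * Z c b)).
by apply: eq_bigr => c _; rewrite mxE mulrA.
Qed.

Lemma dg_mulr {k l} (g : 'I_k -> C) (Z : 'M[C]_(l, k)) a b :
  (Z *m dg g) a b = Z a b * g b.
Proof.
rewrite mxE -[RHS](sum_delta (fun c => Z a c * g c)).
by apply: eq_bigr => c _; rewrite mxE eq_sym mulrCA.
Qed.

Lemma dg_tens {k D} (g : 'I_k -> C) :
  dg g *t (1%:M : 'M[C]_D) = dg (fun q => g (mxtens_unindex q).1).
Proof.
apply/matrixP => q q'; case: (mxtens_indexP q) => a i.
case: (mxtens_indexP q') => b j; rewrite tensmxE !mxE mxtens_indexK.
by rewrite (can_eq (@mxtens_indexK _ _)) xpair_eqE -mulnb natrM mulrAC.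
Qed.

Lemma dg_tens_mull {k D l} (g : 'I_k -> C) (Z : 'M[C]_(k * D, l)) a i b :
  ((dg g *t 1%:M) *m Z) (mxtens_index (a, i)) b = g a * Z (mxtens_index (a, i)) b.
Proof. by rewrite dg_tens dg_mull mxtens_indexK. Qed.

Lemma dg_tens_mulr {k D l} (g : 'I_k -> C) (Z : 'M[C]_(l, k * D)) a i b :
  (Z *m (dg g *t 1%:M)) b (mxtens_index (a, i)) = Z b (mxtens_index (a, i)) * g a.
Proof. by rewrite dg_tens dg_mulr mxtens_indexK. Qed.

End DiagTensor.

(** * Homogeneous polynomials as linear relations between words *)

Section WordMatrix.
Context {R : realType} {d : nat}.
Local Notation C := R[i].

(** The left kernel is the space of coefficient vectors of the homogeneous polynomials of degree [m]
    vanishing at [X]. *)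
Definition wordmx m {n} (X : mtuple R d n) : 'M[C]_(#|{: m.-tuple 'I_d}|, n * n) :=
  \matrix_(a < #|{: m.-tuple 'I_d}|) mxvec (word_eval (tval (enum_val a)) X).

Lemma hompoly_wordmx m (p : ncpoly R d) : hompoly m p ->
  exists c : 'rV[C]_#|{: m.-tuple 'I_d}|, forall n (X : mtuple R d n),
    mxvec (ncpoly_eval p X) = c *m wordmx m X.
Proof.
elim: p => [_|t p IH /= /andP[ht /IH[c hc]]].
  by exists 0 => n X; rewrite mul0mx /ncpoly_eval big_nil linear0.
exists (t.1 *: delta_mx 0 (enum_rank (Tuple ht)) + c) => n X.
rewrite mulmxDl -hc /ncpoly_eval big_cons linearD linearZ /=; congr (_ + _).
by rewrite -scalemxAl -rowE rowK enum_rankK.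
Qed.

Lemma mul_wordmx m (c : 'rV[C]_#|{: m.-tuple 'I_d}|) n (X : mtuple R d n) :
  c *m wordmx m X = mxvec (\sum_a c 0 a *: word_eval (tval (enum_val a)) X).
Proof.
rewrite mulmx_sum_row linear_sum; apply: eq_bigr => a _.
by rewrite rowK linearZ.
Qed.

Lemma wordmx_dsum m (c : 'rV[C]_#|{: m.-tuple 'I_d}|) n n' (X : mtuple R d n)
    (Y : mtuple R d n') :
  c *m wordmx m (dsum X Y) = 0 -> c *m wordmx m X = 0 /\ c *m wordmx m Y = 0.
Proof.
rewrite !mul_wordmx => /eqP; rewrite mxvec_eq0 => /eqP.
have -> : \sum_a c 0 a *: word_eval (tval (enum_val a)) (dsum X Y) =
    block_mx (\sum_a c 0 a *: word_eval (tval (enum_val a)) X) 0 0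
             (\sum_a c 0 a *: word_eval (tval (enum_val a)) Y).
  elim: (index_enum _) => [|a r IH]; first by rewrite !big_nil block_mx0.
  by rewrite !big_cons IH word_eval_dsum scale_block_mx add_block_mx !scaler0 !addr0.
by rewrite -block_mx0 => /eq_block_mx [-> _ _ ->]; split; exact: linear0.
Qed.

(* A point of maximal rank detects all homogeneous polynomials of degree [m]
   vanishing on [V]. *)
Lemma universal_point (V : ncdom R d) m : dsum_closed V ->
  (exists n (X : mtuple R d n), V n X) ->
  exists n (X : mtuple R d n), V n X /\ forall p, hompoly m p ->
    ncpoly_eval p X = 0 -> forall n' (Y : mtuple R d n'), V n' Y ->
    ncpoly_eval p Y = 0.
Proof.
move=> Vd [n0 [X0 VX0]].
pose rk (r : nat) := exists n (X : mtuple R d n), V n X /\ \rank (wordmx m X) = r.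
have exr : exists r, `[< rk r >].
  by exists (\rank (wordmx m X0)); apply/asboolP; exists n0, X0.
have ler r : `[< rk r >] -> (r <= #|{: m.-tuple 'I_d}|)%N.
  by move=> /asboolP[n [X [_ <-]]]; apply: rank_leq_row.
case: (ex_maxnP exr ler) => r /asboolP[n [X [VX rX]]] rmax.
exists n, X; split=> // p hp pX n' Y VY.
have [c hc] := hompoly_wordmx hp.
have cX : c *m wordmx m X = 0 by rewrite -hc pX linear0.
(* Passing from [X] to [X (+) Y] can only shrink the left kernel. As the rank at [X] is maximal, the
   two kernels agree, so a relation at [X] also holds at [Y]. *)
set S := dsum X Y.
have kSX : (kermx (wordmx m S) <= kermx (wordmx m X))%MS.
  apply/row_subP => i; apply/sub_kermxP.
  have /sub_kermxP := row_sub i (kermx (wordmx m S)).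
  by move=> /wordmx_dsum[].
have rS : (\rank (wordmx m S) <= \rank (wordmx m X))%N.
  by rewrite rX; apply: rmax; apply/asboolP; exists (n + n')%N, S; split=> //; apply: Vd.
have kXS : (kermx (wordmx m X) <= kermx (wordmx m S))%MS.
  rewrite -(mxrank_leqif_sup kSX).2 eqn_leq mxrankS //= !mxrank_ker.
  exact: leq_sub2l.
have /sub_kermxP /wordmx_dsum[_ cY] : (c <= kermx (wordmx m S))%MS.
  by apply: submx_trans kXS; apply/sub_kermxP.
by apply/eqP; rewrite -mxvec_eq0 hc cY.
Qed.

End WordMatrix.

(** * Taylor polynomials at one point *)

Section Taylor.
Context {R : realType}.
Local Notation C := R[i].
Unset Implicit Arguments.
Context {d : nat} {Q : pencil R d} {P : set (ncpoly R d)} {V : ncdom R d}.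
Variable f : scalfun V.
Set Implicit Arguments.
Hypothesis VP : pvar Q P V.
Hypothesis fnc : is_nc (tupfun_of_scal f).

Lemma pvar_jordan N n (X : mtuple R d n) :
  V n X -> V (N.+1 * n)%N (fun j => jordan N.+1 *t X j).
Proof. by apply: (pvar_tens VP) => //; apply: row_mono_jordan. Qed.

Lemma jordan_nil N n (X : mtuple R d n) w : size w = N ->
  word_eval w (fun j => jordan N *t X j) = 0.
Proof.
move=> wN; rewrite word_eval_tens wN.
rewrite (_ : iter N _ _ = 0) ?tens0mx //; apply/matrixP => a b.
by rewrite jordan_pow mxE (ltn_eqF (leq_trans (ltn_ord b) (leq_addl a N))).
Qed.

Definition inJ N n (X : mtuple R d n) (VX : V n X) : V (N.+1 * n)%N :=
  inV (pvar_jordan N VX).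

(** The cyclic subspace argument gives polynomials for one row vector, whereas all [n] rows of the
    first block row of [f(J (x) X)] must share the same polynomials. Hence it is applied to [n]
    copies of [J (x) X], with one vector that marks the i-th row in the i-th copy. *)
Lemma taylor_pointwise N n (X : mtuple R d n) (VX : V n X) :
  exists2 p : nat -> ncpoly R d, (forall m, hompoly m (p m)) &
  forall (m : 'I_N.+1) i j,
    f _ (inJ N VX) (mxtens_index (ord0, i)) (mxtens_index (m, j)) =
    ncpoly_eval (p m) X i j.
Proof.
set D := (N.+1 * n)%N; set JX : mtuple R d D := fun j => jordan N.+1 *t X j.
pose A : mtuple R d (n * D) := fun j => 1%:M *t JX j.
(* In the copy numbered [i], [u] is the unit vector at block 0, position [i]. The maps [K i] below
   are the embeddings of the copies. *)
pose u : 'rV[C]_(n * D) := \row_q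
  let ai := mxtens_unindex (mxtens_unindex q).2 in
  ((ai.1 == ord0) && ((mxtens_unindex q).1 == ai.2))%:R.
pose VJ := pvar_jordan N VX.
have VA : V (n * D)%N A.
  apply: (pvar_tens VP); [exact: pvar_gt0 VP _ _ VX|exact: row_mono1|exact: VJ].
have nilA w : size w = N.+1 -> word_eval w A = 0.
  by move=> wN; rewrite word_eval_tens jordan_nil // tensmx0.
have [e [e0 e1]] := cyclic_poly VP u fnc VA nilA.
move=> /(_ (pvar_tscale VP (ltW e0) e1 VA)) [p hp up].
have ne0 : e%:C%C != 0 :> C by rewrite fmorph_eq0 gt_eqF.
pose VeJ := pvar_tscale VP (ltW e0) e1 VJ.
pose K (i : 'I_n) : 'M[C]_(n * D, D) := tcol (fun k => (i == k)%:R).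
have KA i j : K i *m JX j = A j *m K i.
  rewrite /A /K tens_tcol; congr (tcol _ *m _); apply/funext => a.
  by rewrite mapp1.
have uK i (Z : 'M[C]_D) q : (u *m K i *m Z) 0 q = Z (mxtens_index (ord0, i)) q.
  rewrite mxE; rewrite -[RHS](sum_delta (fun l => Z l q)); apply: eq_bigr => l _.
  congr (_ * _); rewrite mul_by_tcol.
  rewrite (eq_bigr (fun a => (i == a)%:R * u 0 (mxtens_index (a, l)))) => [|a _].
    rewrite (sum_delta (fun a => u 0 (mxtens_index (a, l)))).
    case: (mxtens_indexP l) => a b; rewrite mxE !mxtens_indexK.
    rewrite (can_eq (@mxtens_indexK _ _)) xpair_eqE.
    by rewrite [ord0 == a]eq_sym.
  by rewrite mulrC.
have fK i : K i *m f _ (inV VeJ) = f _ (inV (pvar_tscale VP (ltW e0) e1 VA)) *m K i.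
  apply: (scal_twine (pvar_dsum VP) fnc) => j.
  by rewrite !val_inV /tscale -scalemxAr -scalemxAl KA.
have fe (m : 'I_N.+1) i j :
    f _ (inV VeJ) (mxtens_index (ord0, i)) (mxtens_index (m, j)) =
    ncpoly_eval (p m) X i j.
  rewrite -uK -mulmxA fK mulmxA up mulmx_suml summxE.
  rewrite (bigD1 m) //= big1 ?addr0 => [|m' m'm];
    rewrite -mulmxA -(ncpoly_eval_twine (KA i)) mulmxA uK (hompoly_tens _ _ (hp _))
      tensmxE jordan_pow add0n.
    by rewrite eqxx mul1r.
  by rewrite (_ : (m == m' :> nat) = false) ?mul0r // eq_sym; apply/negbTE.
(* The diagonal of powers of [e] conjugates [e J] into [J]; this removes the factor [e] that was
   needed to stay in [V]. *)
pose g (a : 'I_N.+1) : C := e%:C%C ^+ a.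
pose Dg := dg g.
have DJ j : (Dg *t 1%:M) *m (e%:C%C *: JX j) = JX j *m (Dg *t 1%:M).
  rewrite -scalemxAr /JX !tensmx_mul mul1mx mulmx1.
  apply/matrixP => q q'; case: (mxtens_indexP q) => a i.
  case: (mxtens_indexP q') => b k; rewrite mxE !tensmxE mulrA; congr (_ * _).
  rewrite dg_mull dg_mulr !mxE /g.
  by case: eqP => [->|_]; rewrite ?(mulr1, mul1r) ?exprS // !mulr0 mul0r.
have fD : (Dg *t 1%:M) *m f _ (inV VeJ) = f _ (inV VJ) *m (Dg *t 1%:M).
  by apply: (scal_twine (pvar_dsum VP) fnc) => j; rewrite !val_inV DJ.
(* Block [(0, m)] of [f(J (x) X)] is [e ^- m] times that of [f(e J (x) X)]. *)
exists (fun m => ncpoly_scale (e%:C%C ^- m) (p m)).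
  by move=> m; apply: hompolyZ.
move=> m i j; rewrite ncpoly_evalZ mxE -fe.
have := congr1 (fun M : 'M[C]_D => M (mxtens_index (ord0, i)) (mxtens_index (m, j))) fD.
rewrite dg_tens_mull dg_tens_mulr /g expr0 mul1r => ->.
by rewrite mulrC mulfK // expf_neq0.
Qed.

End Taylor.

(** * Coordinate embeddings and submatrices *)

Section Selection.
Context {R : realType}.
Local Notation C := R[i].

Definition sel {k k'} (h : 'I_k -> 'I_k') : 'M[C]_(k', k) :=
  \matrix_(a, b) (a == h b)%:R.

Lemma sel_mull {k k' l} (h : 'I_k -> 'I_k') (Z : 'M[C]_(k, l)) a b :
  injective h -> (sel h *m Z) (h a) b = Z a b.
Proof.
move=> hi; rewrite mxE -[RHS](sum_delta (fun c => Z c b)).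
by apply: eq_bigr => c _; rewrite mxE (inj_eq hi).
Qed.

Lemma sel_mulr {k k' l} (h : 'I_k -> 'I_k') (Z : 'M[C]_(l, k')) a b :
  (Z *m sel h) a b = Z a (h b).
Proof.
rewrite mxE -[RHS](sum_delta (fun c => Z a c)).
by apply: eq_bigr => c _; rewrite mxE eq_sym mulrC.
Qed.

Lemma sel_id {k} : sel id = 1%:M :> 'M[C]_k.
Proof. by apply/matrixP => a b; rewrite !mxE. Qed.

Definition tens_map {k k' n n'} (h : 'I_k -> 'I_k') (g : 'I_n -> 'I_n')
    (q : 'I_(k * n)) : 'I_(k' * n') :=
  mxtens_index (h (mxtens_unindex q).1, g (mxtens_unindex q).2).

Lemma tens_mapE {k k' n n'} (h : 'I_k -> 'I_k') (g : 'I_n -> 'I_n') a i :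
  tens_map h g (mxtens_index (a, i)) = mxtens_index (h a, g i).
Proof. by rewrite /tens_map mxtens_indexK. Qed.

Lemma tens_map_inj {k k' n n'} (h : 'I_k -> 'I_k') (g : 'I_n -> 'I_n') :
  injective h -> injective g -> injective (tens_map h g).
Proof.
move=> hi gi q q'; case: (mxtens_indexP q) => a i; case: (mxtens_indexP q') => b j.
by rewrite !tens_mapE => /(can_inj (@mxtens_indexK _ _)) [/hi -> /gi ->].
Qed.

Lemma tens_sel {k k' n n'} (h : 'I_k -> 'I_k') (g : 'I_n -> 'I_n') :
  sel h *t sel g = sel (tens_map h g).
Proof.
apply/matrixP => q q'; case: (mxtens_indexP q) => a i.
case: (mxtens_indexP q') => b j; rewrite tensmxE !mxE tens_mapE.
by rewrite (can_eq (@mxtens_indexK _ _)) xpair_eqE -natrM mulnb.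
Qed.

Lemma mnorm_corner {k n} (Z : 'M[C]_(k * n)) (a b : 'I_k) :
  mnorm (\matrix_(i < n, j < n) Z (mxtens_index (a, i)) (mxtens_index (b, j)))
    <= mnorm Z.
Proof.
apply: mnorm_le => [|v]; first exact: mnorm_ge0.
pose w (q : 'I_(k * n)) : C := (b == (mxtens_unindex q).1)%:R * v (mxtens_unindex q).2.
have -> : nsq v = nsq w.
  rewrite /nsq big_mxtens (bigD1 b) //= [X in _ = _ + X]big1 ?addr0 => [|c cb].
    by apply: eq_bigr => i _; rewrite /w mxtens_indexK eqxx mul1r.
  rewrite big1 // => i _; rewrite /w mxtens_indexK /= eq_sym (negbTE cb) mul0r.
  by rewrite cn0 expr0n.
apply: le_trans (mnormP Z w).
rewrite [leRHS]/nsq big_mxtens (bigD1 a) //= ler_wpDr ?sumr_ge0 // => [c _|].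
  by apply: sumr_ge0 => i _; rewrite sqr_ge0.
rewrite le_eqVlt; apply/orP; left; apply/eqP; apply: eq_bigr => i _.
congr (cn _ ^+ 2); rewrite /mapp big_mxtens (bigD1 b) //= [X in _ = _ + X]big1 ?addr0.
  by apply: eq_bigr => j _; rewrite mxE /w mxtens_indexK eqxx mul1r.
move=> c cb; rewrite big1 // => j _.
by rewrite /w mxtens_indexK /= eq_sym (negbTE cb) mul0r mulr0.
Qed.

End Selection.

(** * Taylor polynomials common to all points, and the remainder *)

Section TaylorUniform.
Context {R : realType}.
Local Notation C := R[i].
Unset Implicit Arguments.
Context {d : nat} {Q : pencil R d} {P : set (ncpoly R d)} {V : ncdom R d}.
Variable f : scalfun V.
Set Implicit Arguments.
Hypothesis VP : pvar Q P V.
Hypothesis fnc : is_nc (tupfun_of_scal f).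

(** An intertwining coordinate embedding exhibits [f X] as a submatrix of [f Y]; this compares
    values at points of different sizes. *)
Lemma scal_sel k k' (h : 'I_k -> 'I_k') (X : V k) (Y : V k') :
  injective h -> (forall j, sel h *m val X j = val Y j *m sel h) ->
  forall a b, f _ X a b = f _ Y (h a) (h b).
Proof.
move=> hi XY a b; rewrite -sel_mulr -(scal_twine (pvar_dsum VP) fnc XY).
by rewrite sel_mull.
Qed.

Lemma jordan_coef_sel N n n' (X : mtuple R d n) (Y : mtuple R d n')
    (VX : V n X) (VY : V n' Y) (h : 'I_n -> 'I_n') : injective h ->
  (forall j, sel h *m X j = Y j *m sel h) -> forall a b i j,
  f _ (inJ VP N VX) (mxtens_index (a, i)) (mxtens_index (b, j)) =
  f _ (inJ VP N VY) (mxtens_index (a, h i)) (mxtens_index (b, h j)).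
Proof.
move=> hi hXY a b i j.
have hT : injective (tens_map (@id 'I_N.+1) h) by apply: tens_map_inj.
rewrite -!(tens_mapE id h); apply: scal_sel => // l.
by rewrite -tens_sel sel_id !val_inV !tensmx_mul mulmx1 mul1mx hXY.
Qed.

Lemma sel_dsum_l n n' (X : mtuple R d n) (Y : mtuple R d n') j :
  sel (lshift n') *m X j = dsum X Y j *m sel (lshift n').
Proof.
have -> : sel (lshift n') = col_mx 1%:M 0 :> 'M[C]_(n + n', n).
  apply/matrixP => a b; rewrite mxE -[a]splitK.
  case: (fintype.split a) => c /=; first by rewrite col_mxEu mxE (inj_eq (@lshift_inj _ _)).
  by rewrite col_mxEd mxE eq_rlshift.
rewrite /dsum mul_col_mx mul1mx mul0mx mul_block_col !mulmx1 !mulmx0 addr0.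
by rewrite addr0.
Qed.

Lemma sel_dsum_r n n' (X : mtuple R d n) (Y : mtuple R d n') j :
  sel (@rshift n n') *m Y j = dsum X Y j *m sel (@rshift n n').
Proof.
have -> : sel (@rshift n n') = col_mx 0 1%:M :> 'M[C]_(n + n', n').
  apply/matrixP => a b; rewrite mxE -[a]splitK.
  case: (fintype.split a) => c /=; first by rewrite col_mxEu mxE eq_lrshift.
  by rewrite col_mxEd mxE (inj_eq (@rshift_inj _ _)).
rewrite /dsum mul_col_mx mul1mx mul0mx mul_block_col !mulmx1 !mulmx0 add0r.
by rewrite add0r.
Qed.

(** Pointwise polynomials depend on the point, so they are taken at a universal point [X0] of each
    degree. The polynomial [q] found at [X0 (+) Y] agrees with [p] at [X0], hence on all of [V], and
    [q] computes the block at [Y]. *)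
Lemma taylor_uniform N : exists2 p : nat -> ncpoly R d,
  (forall m, hompoly m (p m)) &
  forall n (X : mtuple R d n) (VX : V n X) (m : 'I_N.+1) i j,
    f _ (inJ VP N VX) (mxtens_index (ord0, i)) (mxtens_index (m, j)) =
    ncpoly_eval (p m) X i j.
Proof.
suff h (m : 'I_N.+1) : exists p, hompoly m p /\
    forall n (X : mtuple R d n) (VX : V n X) i j,
    f _ (inJ VP N VX) (mxtens_index (ord0, i)) (mxtens_index (m, j)) =
    ncpoly_eval p X i j.
  have [p hp] := choice h.
  exists (fun m => if insub m is Some i then p i else [::]).
    by move=> m; case: insubP => // i _ <-; case: (hp i).
  by move=> n X VX m i j; rewrite valK; case: (hp m).
have [Vne|Ve] := pselect (exists n (X : mtuple R d n), V n X); last first.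
  by exists [::]; split=> // n X VX; case: Ve; exists n, X.
have [n0 [X0 [VX0 univ]]] := universal_point m (pvar_dsum VP) Vne.
have [p hp pX0] := taylor_pointwise VP fnc N VX0.
exists (p m); split=> // n Y VY i j.
have VS := pvar_dsum VP VX0 VY.
have [q hq qS] := taylor_pointwise VP fnc N VS.
have qX0 : ncpoly_eval (q m) X0 = ncpoly_eval (p m) X0.
  apply/matrixP => a b; rewrite -pX0.
  rewrite (jordan_coef_sel VX0 VS (@lshift_inj _ _) (sel_dsum_l X0 Y)) qS.
  by rewrite ncpoly_eval_dsum block_mxEul.
have qpY : ncpoly_eval (q m) Y = ncpoly_eval (p m) Y.
  have qp0 : ncpoly_eval (q m ++ ncpoly_scale (-1) (p m)) X0 = 0.
    by rewrite ncpoly_eval_cat ncpoly_evalZ scaleN1r qX0 subrr.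
  have := univ _ (hompoly_cat (hq m) (hompolyZ (-1) (hp m))) qp0 _ _ VY.
  by rewrite ncpoly_eval_cat ncpoly_evalZ scaleN1r => /eqP; rewrite subr_eq0 => /eqP.
rewrite (jordan_coef_sel VY VS (@rshift_inj _ _) (sel_dsum_r X0 Y)) qS.
by rewrite ncpoly_eval_dsum block_mxEdr qpY.
Qed.

Lemma taylor_remainder N : exists2 p : nat -> ncpoly R d,
  (forall m, hompoly m (p m)) &
  forall n (X : mtuple R d n) (r : R) (VrX : V n (tscale r X)) (M : R),
    V n X -> 0 <= r -> r < 1 -> (forall n X, mnorm (f n X) <= M) ->
    mnorm (f _ (inV VrX) - \sum_(m < N.+1) (r ^+ m)%:C%C *: ncpoly_eval (p m) X)
      <= r ^+ N.+1 / (1 - r) * M.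
Proof.
have [p hp pJ] := taylor_uniform N; exists p => // n X r VrX M VX r0 r1 fM.
have VT : V (N.+2 * n)%N (fun j => tmat N.+1 r *t X j).
  by apply: (pvar_tens VP) => //; apply: row_mono_tmat => //; apply: ltW.
(* The eigenvector equation, tensored with the identity, intertwines [r X] with [tmat (x) X]. *)
have fL : tcol (@tvec R N.+1 r) *m f _ (inV VrX) =
    f _ (inV VT) *m tcol (@tvec R N.+1 r).
  apply: (scal_twine (pvar_dsum VP) fnc) => j; rewrite !val_inV tens_tcol.
  apply/matrixP => q b; case: (mxtens_indexP q) => a i.
  by rewrite !mul_tcol tmat_vec // mxE mulrCA mulrA.
(* On the first [N.+1] coordinates [tmat N.+1 r] acts as [jordan N.+1], so these blocks are the
   Taylor polynomials. *)
have fJ (m : 'I_N.+1) i j :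
    f _ (inV VT) (mxtens_index (ord0, i)) (mxtens_index (widen_ord (leqnSn _) m, j)) =
    ncpoly_eval (p m) X i j.
  rewrite -(pJ _ _ VX); set w := widen_ord _.
  have wi : injective w by move=> a b /(congr1 val) ab; apply: val_inj.
  have hT : injective (tens_map w (@id 'I_n)) by apply: tens_map_inj.
  have -> : ord0 = w ord0 by apply: val_inj.
  rewrite -!(tens_mapE w id); apply/esym/scal_sel => // l.
  rewrite -tens_sel sel_id !val_inV !tensmx_mul mulmx1 mul1mx; congr (_ *t _).
  apply/matrixP => a b; rewrite [RHS]sel_mulr [RHS]mxE /= (ltn_eqF (ltn_ord b)) andbF.
  have [aN|aN] := ltnP a N.+1.
    have -> : a = w (Ordinal aN) by apply: val_inj.
    by rewrite sel_mull // mxE /=; case: ifP.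
  rewrite (_ : (b == a.+1 :> nat) = false); last first.
    by rewrite ltn_eqF // ltnS (leq_trans _ aN) // ltnW.
  rewrite mxE big1 // => c _.
  rewrite mxE (_ : (a == w c) = false) ?mul0r //; apply/negbTE; rewrite -val_eqE /=.
  by rewrite gtn_eqF // (leq_trans (ltn_ord c)).
(* The first block row of [fL] expresses [f(r X)] through the blocks of [f(tmat (x) X)], weighted by
   the entries of [tvec]. The remainder is thus exactly one block, weighted by the last entry. *)
have -> : f _ (inV VrX) - \sum_(m < N.+1) (r ^+ m)%:C%C *: ncpoly_eval (p m) X =
   (r ^+ N.+1 / (1 - r))%:C%C *: \matrix_(i, j)
     f _ (inV VT) (mxtens_index (ord0, i)) (mxtens_index (ord_max, j)).
  apply/eqP; rewrite subr_eq; apply/eqP/matrixP => i j.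
  have := congr1 (fun Z : 'M[C]_(N.+2 * n, n) => Z (mxtens_index (ord0, i)) j) fL.
  rewrite mul_tcol mul_by_tcol big_ord_recr /= {1 3}/tvec /= eqxx expr0 mul1r => ->.
  rewrite addrC [RHS]mxE [in RHS]mxE mulrC [in RHS]mxE; congr (_ + _).
  rewrite summxE; apply: eq_bigr => m _.
  by rewrite fJ mxE /tvec /= (ltn_eqF (ltn_ord m)) mulrC.
apply: le_trans (mnormZ_le _ _) _.
have c0 : 0 <= r ^+ N.+1 / (1 - r) by rewrite divr_ge0 ?exprn_ge0 // subr_ge0 ltW.
rewrite cn_real ger0_norm // ler_wpM2l //.
exact: le_trans (mnorm_corner _ _ _) (fM _ _).
Qed.

End TaylorUniform.

(** * Homogeneous subvarieties *)

Section Subvarieties.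
Context {R : realType}.
Local Notation C := R[i].

Lemma geometric_small (K r e : R) : 0 <= r -> r < 1 -> 0 < e ->
  exists N, r ^+ N.+1 * K <= e.
Proof.
move=> r0 r1 e0; have [K0|K0] := lerP K 0.
  by exists 0; apply: le_trans (ltW e0); rewrite mulr_ge0_le0 ?exprn_ge0.
have h : (r ^+ n @[n --> \oo] --> 0)%classic by apply: cvg_expr; rewrite ger0_norm.
have [N _ hN] : \forall n \near \oo, `|0 - r ^+ n| < e / K.
  by move/cvgrPdist_lt: h; apply; rewrite divr_gt0.
exists N; rewrite -ler_pdivlMr // ltW //.
have := hN N.+1 (leqnSn N); rewrite /= sub0r normrN ger0_norm ?exprn_ge0 //.
Qed.

(** Letting [r] tend to 0 kills the constant coefficient; dividing by [r] then shifts the others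
    down, and the induction proceeds. *)
Lemma poly_coef0 (g : nat -> C) N (K : R) :
  (forall r : R, 0 < r -> r <= 2^-1 ->
    cn (\sum_(m < N) (r ^+ m)%:C%C * g m) <= r ^+ N * K) ->
  forall m, (m < N)%N -> g m = 0.
Proof.
elim: N g => [//|N IH] g hg.
have K0 : 0 <= K.
  have h0 : (0 : R) < 2^-1 by [].
  have := hg _ h0 (lexx _); move=> /(le_trans (cn_ge0 _)).
  by rewrite pmulr_rge0 // exprn_gt0.
pose S (r : R) : C := \sum_(m < N) (r ^+ m)%:C%C * g m.+1.
have split r : \sum_(m < N.+1) (r ^+ m)%:C%C * g m = g 0 + r%:C%C * S r.
  rewrite big_ord_recl expr0 mul1r; congr (_ + _); rewrite mulr_sumr.
  by apply: eq_bigr => m _ /=; rewrite /bump /= add1n exprS rmorphM mulrA.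
pose B := \sum_(m < N) cn (g m.+1).
have SB r : 0 < r -> r <= 2^-1 -> cn (S r) <= B.
  move=> r0 r1; apply: le_trans (cn_sum _) _; apply: ler_sum => m _.
  rewrite cnM cn_real ger0_norm ?exprn_ge0 ?(ltW r0) // ler_piMl ?cn_ge0 //.
  by rewrite exprn_ile1 ?(ltW r0) // (le_trans r1) // invf_le1 // ler1n //.
have B0 : 0 <= B by apply: sumr_ge0 => m _; apply: cn_ge0.
have g0 : g 0 = 0.
  apply: cn_eq0; apply/eqP; rewrite eq_le cn_ge0 andbT.
  apply/ler_addgt0Pr => e e0; rewrite add0r.
  pose r := Num.min 2^-1 (e / (K + B + 1)).
  have KB : 0 < K + B + 1 by rewrite ltr_wpDl // addr_ge0.
  have r0 : 0 < r by rewrite lt_min divr_gt0 // invr_gt0 ltr0n.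
  have r1 : r <= 2^-1 by rewrite ge_min lexx.
  have re : r * (K + B + 1) <= e by rewrite -ler_pdivlMr // ge_min lexx orbT.
  have -> : g 0 = (g 0 + r%:C%C * S r) + - (r%:C%C * S r) by rewrite addrK.
  apply: le_trans (cnD _ _) _; rewrite cnN -split.
  apply: le_trans re; apply: (@le_trans _ _ (r * K + r * B)).
    apply: lerD.
      apply: le_trans (hg r r0 r1) _; rewrite exprS -mulrA ler_wpM2l ?(ltW r0) //.
      rewrite ler_piMl // exprn_ile1 ?(ltW r0) // (le_trans r1) // invf_le1 // ler1n //.
    by rewrite cnM cn_real ger0_norm ?(ltW r0) // ler_wpM2l ?SB // ltW.
  by rewrite -mulrDr ler_wpM2l ?(ltW r0) // lerDl.
move=> [|m] //; rewrite ltnS => mN.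
apply: (IH (fun m => g m.+1)) mN => r r0 r1.
have := hg r r0 r1; rewrite split g0 add0r cnM cn_real ger0_norm ?(ltW r0) //.
by rewrite exprS -mulrA ler_pM2l.
Qed.

Context {d : nat}.
Variable Q : pencil R d.

Lemma pvar_ball : pvar Q set0 (opball Q).
Proof. by split=> // n X; split=> [|[]]. Qed.

(** Let [X] be a zero of these polynomials and [g] one of the defining functions. By homogeneity [g]
    vanishes at [s Z] for all [Z] in [V], so its Taylor polynomials vanish on [V], hence at [X]. The
    formula at [Y = r^-1 X], still in the ball for [r] between [q] and 1, leaves only the
    remainder. *)
Lemma subvariety_pvar (V : ncdom R d) : subvariety Q V -> homogeneous V ->
  pvar Q [set p | (exists m : nat, hompoly m p) /\
    forall n (X : mtuple R d n), V n X -> ncpoly_eval p X = 0] V.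
Proof.
move=> [S SH VS] Vh; split=> [p [] //|n X]; split=> [VX|[QX pX]].
  split=> [|p [_]]; last exact.
  by move: VX; rewrite VS => -[Y _ <-]; apply: memV.
rewrite VS; exists (inV QX) => // g Sg.
have [gnc [M gM]] := SH _ Sg.
have M0 : 0 <= M by apply: le_trans (gM _ (inV QX)); apply: mnorm_ge0.
have /opballP[n0 [q [q0 q1 Xq]]] := QX.
pose r := (1 + q) / 2.
have rq : q < r by rewrite /r; lra.
have r0 : 0 < r by apply: le_lt_trans rq.
have r1 : r < 1 by rewrite /r; lra.
pose Y : mtuple R d n := tscale r^-1 X.
have XY : tscale r Y = X by rewrite tscaleA divff ?gt_eqF // tscale1.
have QY : opball Q n Y.
  apply/opballP; split=> //; exists (r^-1 * q); split.
  - by rewrite mulr_ge0 // invr_ge0 ltW.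
  - by rewrite mulrC ltr_pdivrMr // mul1r.
  - by have := qboundZ (r^-1%:C%C) Xq; rewrite cn_real ger0_norm // invr_ge0 ltW.
apply: mnorm_small0 => e e0.
have [N hN] := geometric_small (M / (1 - r)) (ltW r0) r1 e0.
apply: le_trans hN.
have [p hp pg] := taylor_remainder pvar_ball gnc N.
have pY (m : 'I_N.+1) : ncpoly_eval (p m) Y = 0.
  have Pp : ncpoly_eval (p m) X = 0.
    apply: pX; split; first by exists (m : nat).
    move=> n' Z VZ; apply/matrixP => i j; rewrite mxE.
    (* The factor 2 bounds [1 / (1 - s)] for [s] at most one half. *)
    apply: (@poly_coef0 (fun m => ncpoly_eval (p m) Z i j) N.+1 (2 * M)) => // s s0 s2.
    have s1 : s < 1 by rewrite (le_lt_trans s2) // invf_lt1 // ltr1n.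
    have QZ : opball Q n' Z.
      by move: VZ; rewrite VS => -[Z' _ <-]; apply: memV.
    have VsZ : V n' (tscale s Z).
      by apply: Vh => //; rewrite cnE lecR cn_real ger0_norm ltW.
    have QsZ : opball Q n' (tscale s Z).
      by move: VsZ; rewrite VS => -[Z' _ <-]; apply: memV.
    have gZ : g _ (inV QsZ) = 0.
      have := VsZ; rewrite VS => -[Z' hZ' eZ].
      by rewrite -(hZ' g Sg); congr (g _ _); apply: val_inj; rewrite eZ.
    have := pg _ Z s QsZ M QZ (ltW s0) s1 gM.
    rewrite gZ sub0r mnormN => h.
    have := le_trans (cn_le_mnorm _ i j) h.
    rewrite summxE (eq_bigr (fun m : 'I_N.+1 =>
      (s ^+ m)%:C%C * ncpoly_eval (p m) Z i j)) => [|k _]; last by rewrite mxE.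
    move=> /le_trans; apply; rewrite -mulrA ler_wpM2l ?exprn_ge0 ?(ltW s0) //.
    rewrite ler_wpM2r // -[leRHS]invrK lef_pV2 ?posrE ?subr_gt0 ?invr_gt0 ?ltr0n //.
    by lra.
  by rewrite /Y /tscale (hompoly_scale _ _ (hp m)) Pp scaler0.
have QrY : opball Q n (tscale r Y) by rewrite XY.
have -> : inV QX = inV QrY by apply: val_inj; rewrite /= XY.
have := pg _ Y r QrY M QY (ltW r0) r1 gM.
rewrite big1 => [|m _]; last by rewrite pY scaler0.
by rewrite subr0 mulrAC mulrA.
Qed.

End Subvarieties.

(** * Closures and continuous extensions *)

Section Completeness.
Context {R : realType}.
Local Notation C := R[i].

(** The hypothesis is the Cauchy condition in one-sided form, and the limit is the supremum of the
    eventual lower bounds. *)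
Lemma real_complete (u : nat -> R) :
  (forall e, 0 < e -> exists N, forall i j, (N <= i)%N -> (N <= j)%N ->
     u i <= u j + e) ->
  exists l, forall e, 0 < e -> exists N, forall i, (N <= i)%N -> `|u i - l| <= e.
Proof.
move=> uc; pose E := [set x | exists N, forall i, (N <= i)%N -> x <= u i].
have lowE e N : (forall i j, (N <= i)%N -> (N <= j)%N -> u i <= u j + e) ->
    E (u N - e).
  by move=> h; exists N => i Ni; rewrite lerBlDr h.
have upE e N : (forall i j, (N <= i)%N -> (N <= j)%N -> u i <= u j + e) ->
    ubound E (u N + e).
  move=> h x [M hM]; apply: le_trans (hM _ (leq_maxr N M)) _.
  by apply: h => //; apply: leq_maxl.
exists (sup E) => e e0.
have e2 : 0 < e / 2 by rewrite divr_gt0.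
have [N hN] := uc _ e2; exists N => i Ni.
have l1 : u N - e / 2 <= sup E.
  apply: (ub_le_sup _ (lowE _ _ hN)); exists (u N + e / 2); exact: upE.
have l2 : sup E <= u N + e / 2.
  by apply: sup_le_ub (upE _ _ hN); exists (u N - e / 2); apply: lowE.
have i1 := hN i N Ni (leqnn N); have i2 := hN N i (leqnn N) Ni.
rewrite ler_norml; apply/andP; split; lra.
Qed.

Lemma cn_le_ReIm (z : C) : cn z <= `|complex.Re z| + `|complex.Im z|.
Proof.
rewrite /cn normc_def /= -[leRHS]ger0_norm ?addr_ge0 // -sqrtr_sqr ler_wsqrtr //.
by rewrite sqrrD !real_normK ?num_real // -addrA lerD2l lerDr mulrn_wge0 // mulr_ge0.
Qed.

Lemma Re_le_cn (z : C) : `|complex.Re z| <= cn z.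
Proof. by have := normc_ge_Re z; rewrite cnE lecR. Qed.

Lemma Im_le_cn (z : C) : `|complex.Im z| <= cn z.
Proof.
rewrite /cn normc_def /= -sqrtr_sqr ler_wsqrtr //.
by rewrite lerDr sqr_ge0.
Qed.

Lemma mat_complete {m n} (u : nat -> 'M[C]_(m, n)) :
  (forall e : R, 0 < e -> exists N, forall i j, (N <= i)%N -> (N <= j)%N ->
     mnorm (u i - u j) <= e) ->
  exists L, forall e : R, 0 < e -> exists N, forall i, (N <= i)%N ->
    mnorm (u i - L) <= e.
Proof.
move=> uc.
have lim (g : C -> R) (ga : forall x y, g (x - y) = g x - g y)
    (gb : forall x, `|g x| <= cn x) (ab : 'I_m * 'I_n) :
    exists l, forall e, 0 < e -> exists N, forall i, (N <= i)%N ->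
      `|g (u i ab.1 ab.2) - l| <= e.
  apply: (real_complete (u := fun i => g (u i ab.1 ab.2))) => e e0.
  have [N hN] := uc e e0; exists N => i j Ni Nj.
  have := le_trans (cn_le_mnorm _ ab.1 ab.2) (hN i j Ni Nj).
  move=> /(le_trans (gb _)); rewrite !mxE ga => /(le_trans (ler_norm _)).
  by rewrite lerBlDl.
have [lr hr] := choice (lim _ (fun x y : C => raddfB (@complex.Re R) x y) Re_le_cn).
have [li hi] := choice (lim _ (fun x y : C => raddfB (@complex.Im R) x y) Im_le_cn).
pose L : 'M[C]_(m, n) := \matrix_(a, b) (lr (a, b) +i* li (a, b))%C.
exists L => e e0.
(* There are [m * n] entries, each with a real and an imaginary error; the [+ 1] keeps the
   denominator positive for empty matrices. *)
pose e' := e / (2 * (m * n)%:R + 1).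
have d0 : 0 < 2 * (m * n)%:R + 1 :> R by rewrite ltr_wpDl // mulr_ge0.
have e'0 : 0 < e' by rewrite divr_gt0.
have hN ab : exists N, forall i, (N <= i)%N -> cn (u i ab.1 ab.2 - L ab.1 ab.2) <= 2 * e'.
  have [N1 h1] := hr ab e' e'0; have [N2 h2] := hi ab e' e'0.
  exists (maxn N1 N2) => i; rewrite geq_max => /andP[/h1 {}h1 /h2 {}h2].
  apply: le_trans (cn_le_ReIm _) _.
  rewrite !raddfB /= /L !mxE -surjective_pairing /=.
  by rewrite mulr_natl mulr2n lerD.
have [N {}hN] := choice hN.
exists (\max_ab N ab)%N => i Ni; apply: le_trans (mnorm_le_sum _) _.
apply: (@le_trans _ _ (\sum_(a < m) \sum_(b < n) (2 * e'))).
  apply: ler_sum => a _; apply: ler_sum => b _; rewrite !mxE.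
  by have := hN (a, b) i; rewrite /= !mxE; apply; apply: leq_trans Ni; apply: (leq_bigmax (a, b)).
rewrite !sumr_const !card_ord -mulrnA mulnC -[(2 * e') *+ _]mulr_natr /e'.
have -> : 2 * (e / (2 * (m * n)%:R + 1)) * (m * n)%:R =
    e * (2 * (m * n)%:R) / (2 * (m * n)%:R + 1) by field; rewrite gt_eqF.
by rewrite ler_pdivrMr // ler_wpM2l ?(ltW e0) // lerDl.
Qed.

End Completeness.

Section SupNorm.
Context {R : realType} {d : nat}.
Unset Implicit Arguments.
Context {V : ncdom R d}.
Set Implicit Arguments.
Local Notation C := R[i].

Definition sbounded (f : scalfun V) (M : R) := forall n (X : V n), mnorm (f n X) <= M.

Lemma le_supnorm (f : scalfun V) M n (X : V n) :
  sbounded f M -> mnorm (f n X) <= supnorm f.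
Proof.
move=> fM; apply: ub_le_sup; last by exists n, X.
by exists M => _ [k [Y ->]].
Qed.

(** If [V] is empty, the supremum is that of the empty set, namely 0; this case is covered by
    [0 <= M]. *)
Lemma supnorm_le (f : scalfun V) M : 0 <= M -> sbounded f M -> supnorm f <= M.
Proof.
move=> M0 fM; have [[n [X _]]|ne] := pselect (exists n (X : V n), True).
  apply: sup_le_ub; first by exists (mnorm (f n X)), n, X.
  by move=> _ [k [Y ->]].
rewrite /supnorm (_ : [set r | _] = set0) ?sup0 //.
by apply/seteqP; split=> // r [n [X _]]; case: ne; exists n, X.
Qed.

Definition suc (f : scalfun V) := forall e : R, 0 < e -> exists2 dl : R, 0 < dl &
  forall n (X Y : V n), tdist (val X) (val Y) < dl -> mnorm (f n X - f n Y) < e.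

End SupNorm.

Section Closure.
Context {R : realType}.
Local Notation C := R[i].
Unset Implicit Arguments.
Context {d : nat} {Q : pencil R d} {P : set (ncpoly R d)} {V : ncdom R d}.
Set Implicit Arguments.
Hypothesis VP : pvar Q P V.

Lemma sub_cl n (X : mtuple R d n) : V n X -> ncclosure V n X.
Proof. by move=> VX e e0; exists X => //; rewrite tdistxx. Qed.

Lemma cl_closed n (X : mtuple R d n) :
  (forall e : R, 0 < e -> exists2 Y, ncclosure V n Y & tdist X Y < e) ->
  ncclosure V n X.
Proof.
move=> h e e0; have e2 : 0 < e / 2 by rewrite divr_gt0.
have [Y clY XY] := h _ e2; have [Z VZ YZ] := clY _ e2.
exists Z => //; apply: le_lt_trans (tdist_trans _ Y _) _.
by rewrite (splitr e) ltrD.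
Qed.

Lemma cl_gt0 n (X : mtuple R d n) : ncclosure V n X -> (0 < n)%N.
Proof. by move=> /(_ 1 ltr01) [Y /(pvar_gt0 VP)]. Qed.

Lemma cl_qbound n (X : mtuple R d n) : ncclosure V n X -> qbound Q X 1.
Proof.
move=> clX; apply: qbound_closed => // e e0.
have [K K0 hK] := qbound_crude Q n n.
have eK : 0 < e / (K + 1) by rewrite divr_gt0 // ltr_wpDl.
have [Y VY XY] := clX _ eK.
have -> : X = fun j => Y j + (X j - Y j) by apply/funext => j; rewrite addrC subrK.
apply: qboundD => //; first exact: ltW.
  exact (pvar_qbound1 VP VY).
have KX : K * tdist X Y <= e.
  apply: (@le_trans _ _ (K * (e / (K + 1)))); first by rewrite ler_wpM2l // ltW.
  by rewrite mulrCA ler_piMr ?(ltW e0) // ler_pdivrMr ?ltr_wpDl // mul1r lerDl.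
apply: qboundW KX _; first by rewrite mulr_ge0 // tdist_ge0.
by apply: hK; [exact: tdist_ge0|exact: le_tdist].
Qed.

Lemma cl_bounded : exists2 c : R, 0 <= c &
  forall n (X : mtuple R d n), ncclosure V n X -> tnorm X <= c.
Proof.
have [c c0 hc] := ball_bounded Q; exists c => // n X clX.
exact: hc (cl_qbound clX).
Qed.

Lemma cl_poly n (X : mtuple R d n) p : ncclosure V n X -> P p ->
  ncpoly_eval p X = 0.
Proof.
move=> clX Pp; have [c c0 hc] := cl_bounded.
have [K K0 hK] := ncpoly_eval_lip p c0.
apply: mnorm_small0 => e e0.
have eK : 0 < e / (K + 1) by rewrite divr_gt0 // ltr_wpDl.
have [Y VY XY] := clX _ eK.
rewrite -[ncpoly_eval p X]subr0 -(pvar_poly VP VY Pp).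
apply: le_trans (hK _ _ _ (hc _ _ clX) (hc _ _ (sub_cl VY))) _.
apply: (@le_trans _ _ (K * (e / (K + 1)))); first by rewrite ler_wpM2l // ltW.
by rewrite mulrCA ler_piMr ?(ltW e0) // ler_pdivrMr ?ltr_wpDl // mul1r lerDl.
Qed.

Lemma cl_scale n (X : mtuple R d n) r : (0 < n)%N -> qbound Q X 1 ->
  (forall p, P p -> ncpoly_eval p X = 0) -> 0 <= r -> r < 1 -> V n (tscale r X).
Proof.
move=> n0 X1 pX r0 r1; apply: (@pvarI _ _ _ _ _ VP _ _ r) => //.
  by have := qboundZ (r%:C%C) X1; rewrite cn_real ger0_norm // mulr1.
move=> p Pp; have [m hm] := VP.1 p Pp.
by rewrite (hompoly_scale _ _ hm) pX // scaler0.
Qed.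

Lemma cl_tscale n (X : mtuple R d n) r : ncclosure V n X -> 0 <= r -> r < 1 ->
  V n (tscale r X).
Proof.
move=> clX; apply: cl_scale; [exact: cl_gt0 clX|exact: cl_qbound|].
by move=> p Pp; apply: cl_poly.
Qed.

(** Validity for all [r] close to 1 from below, the regime in which [r X] approaches a boundary
    point [X] from inside [V]. The condition [dl <= 1] keeps these [r] positive. *)
Definition evr (p : R -> Prop) : Prop := exists2 dl : R, 0 < dl <= 1 &
  forall r, 1 - dl < r -> r < 1 -> p r.

Lemma evr_and p q : evr p -> evr q -> evr (fun r => p r /\ q r).
Proof.
move=> [a /andP[a0 a1] ha] [b /andP[b0 b1] hb]; exists (Num.min a b).
  by rewrite lt_min a0 b0 ge_min a1.
move=> r rab r1; split; [apply: ha|apply: hb] => //; apply: le_lt_trans rab;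
  by rewrite lerD2l lerN2 ge_min lexx ?orbT.
Qed.

Lemma evr_ex p : evr p -> exists r, [/\ 0 <= r, r < 1 & p r].
Proof.
move=> [a /andP[a0 a1] ha]; exists (1 - a / 2); split; first by lra.
  by lra.
by apply: ha; lra.
Qed.

Lemma evrW (p q : R -> Prop) : (forall r, 0 <= r -> r < 1 -> p r -> q r) ->
  evr p -> evr q.
Proof.
move=> pq [a /andP[a0 a1] ha]; exists a; first by rewrite a0.
by move=> r ra r1; apply: pq => //; [lra|apply: ha].
Qed.

Lemma evr_tdist n (X : mtuple R d n) (e : R) : 0 < e ->
  evr (fun r => tdist (tscale r X) X < e).
Proof.
move=> e0; have c0 : 0 < tnorm X + 1 by rewrite ltr_wpDl // tnorm_ge0.
exists (Num.min 1 (e / (tnorm X + 1))); first by rewrite lt_min ltr01 divr_gt0 // ge_min lexx.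
move=> r h r1; apply: le_lt_trans (tscale_dist _ (ltW r1)) _.
have {}h : 1 - r < e / (tnorm X + 1).
  apply: (@lt_le_trans _ _ (Num.min 1 (e / (tnorm X + 1)))); first by lra.
  by rewrite ge_min lexx orbT.
rewrite ltr_pdivlMr // in h; apply: le_lt_trans h.
by rewrite ler_wpM2l ?subr_ge0 ?(ltW r1) // lerDl.
Qed.

(** Converse of [cl_qbound] and [cl_poly]: such an [X] is the limit of the points [r X], which lie
    in [V]. *)
Lemma clI n (X : mtuple R d n) : (0 < n)%N -> qbound Q X 1 ->
  (forall p, P p -> ncpoly_eval p X = 0) -> ncclosure V n X.
Proof.
move=> n0 X1 pX e e0; have [r [r0 r1 rX]] := evr_ex (evr_tdist X e0).
by exists (tscale r X); [exact: cl_scale|rewrite tdistC].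
Qed.

End Closure.

Section Halves.
Context {R : realType}.

Lemma ltr_halves (a b e : R) : a < e / 2 -> b < e / 2 -> a + b < e.
Proof. lra. Qed.

Lemma ltr_leD2 (a b e : R) : a < e / 2 -> b <= e / 2 -> a + b < e.
Proof. lra. Qed.

Lemma ler_halves (a b e : R) : a < e / 2 -> b < e / 2 -> a + b <= e.
Proof. lra. Qed.

Lemma two_thirds (e : R) : 0 < e -> e / 3 + e / 3 < e.
Proof. lra. Qed.

Lemma ltr_thirds (x y a b c e : R) : x <= a + y -> y <= b + c ->
  a < e / 3 -> b < e / 3 -> c < e / 3 -> x < e.
Proof. lra. Qed.

End Halves.

(** * Continuous extension to the closure *)

Section ContExt.
Context {R : realType}.
Local Notation C := R[i].
Unset Implicit Arguments.
Context {d : nat} {Q : pencil R d} {P : set (ncpoly R d)} {V : ncdom R d}.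
Set Implicit Arguments.
Hypothesis VP : pvar Q P V.

Definition clV n (X : V n) : ncclosure V n := inV (sub_cl (memV X)).

Lemma cl_approx n (X : ncclosure V n) (e : R) : 0 < e ->
  exists Y : V n, tdist (val Y) (val X) < e.
Proof. by move=> /(memV X) [Y VY XY]; exists (inV VY); rewrite tdistC. Qed.

Definition limit_at (f : scalfun V) n (X : ncclosure V n) (L : 'M[C]_n) :=
  forall e : R, 0 < e -> exists2 dl : R, 0 < dl &
    forall Y : V n, tdist (val Y) (val X) < dl -> mnorm (f n Y - L) < e.

Lemma cext_lim (f : scalfun V) n (X : ncclosure V n) : suc f ->
  exists L, limit_at f X L.
Proof.
move=> fc; have h0 : 0 < 2^-1 :> R by rewrite invr_gt0 ltr0n.
have h1 : 2^-1 < 1 :> R by rewrite invf_lt1 // ltr1n.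
have hY k : exists Y : V n, tdist (val Y) (val X) < 2^-1 ^+ k.
  by apply: cl_approx; rewrite exprn_gt0.
have [Y {}hY] := choice hY.
have small (e : R) : 0 < e -> exists N, forall i, (N <= i)%N -> tdist (val (Y i)) (val X) < e.
  move=> e0; have [N hN] := geometric_small 1 (ltW h0) h1 e0.
  exists N.+1 => i Ni; apply: lt_le_trans (hY i) _; apply: le_trans hN.
  by rewrite mulr1 ler_wiXn2l // ltW.
have [L hL] : exists L, forall e : R, 0 < e -> exists N, forall i, (N <= i)%N ->
    mnorm (f n (Y i) - L) <= e.
  apply: mat_complete => e e0; have [dl dl0 hdl] := fc e e0.
  have dl2 : 0 < dl / 2 by rewrite divr_gt0.
  have [N hN] := small _ dl2; exists N => i j Ni Nj; apply/ltW/hdl.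
  apply: le_lt_trans (tdist_trans _ (val X) _) _.
  by apply: ltr_halves; [exact: hN|rewrite tdistC; exact: hN].
exists L => e e0; have e2 : 0 < e / 2 by rewrite divr_gt0.
have [dl dl0 hdl] := fc _ e2; have dl2 : 0 < dl / 2 by rewrite divr_gt0.
exists (dl / 2) => // Z ZX.
have [N1 hN1] := small _ dl2; have [N2 hN2] := hL _ e2.
pose i := maxn N1 N2.
apply: le_lt_trans (mnorm_trans _ (f n (Y i)) _) _.
apply: ltr_leD2; last exact: hN2 (leq_maxr _ _).
apply: hdl; apply: le_lt_trans (tdist_trans _ (val X) _) _.
apply: ltr_halves; first exact: ZX.
rewrite tdistC; apply: hN1; exact: leq_maxl.
Qed.

Lemma limit_at_uniq (f : scalfun V) n (X : ncclosure V n) L L' :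
  limit_at f X L -> limit_at f X L' -> L = L'.
Proof.
move=> hL hL'; apply: mnorm_lim_eq => e e0.
have e2 : 0 < e / 2 by rewrite divr_gt0.
have [a a0 ha] := hL _ e2; have [b b0 hb] := hL' _ e2.
have ab : 0 < Num.min a b by rewrite lt_min a0.
have [Y] := cl_approx X ab; rewrite lt_min => /andP[/ha Ya /hb Yb].
apply: le_trans (mnorm_trans _ (f n Y) _) _.
by apply: ler_halves; [rewrite mnormB|].
Qed.

Lemma cext_uniq (f : scalfun V) n (X : ncclosure V n) L :
  limit_at f X L -> cext f n X = L.
Proof.
move=> hL; apply: (limit_at_uniq _ hL).
exact: (@xgetPex _ 0 (limit_at f X) (ex_intro _ L hL)).
Qed.

(** One [dl] serves all points of the closure at all levels. *)
Lemma cextP (f : scalfun V) : suc f -> forall e : R, 0 < e ->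
  exists2 dl : R, 0 < dl & forall n (X : ncclosure V n) (Y : V n),
    tdist (val Y) (val X) < dl -> mnorm (f n Y - cext f n X) < e.
Proof.
move=> fc e e0; have e2 : 0 < e / 2 by rewrite divr_gt0.
have [dl dl0 hdl] := fc _ e2; have dl2 : 0 < dl / 2 by rewrite divr_gt0.
exists (dl / 2) => // n X Y YX.
have [L hL] := cext_lim X fc; rewrite (cext_uniq hL).
have [a a0 ha] := hL _ e2.
have ab : 0 < Num.min a (dl / 2) by rewrite lt_min a0.
have [Z] := cl_approx X ab; rewrite lt_min => /andP[/ha Za ZX].
apply: le_lt_trans (mnorm_trans _ (f n Z) _) _.
apply: ltr_halves; last exact: Za.
apply: hdl; apply: le_lt_trans (tdist_trans _ (val X) _) _.
by apply: ltr_halves; [exact: YX|rewrite tdistC; exact: ZX].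
Qed.

Lemma cext_limit (f : scalfun V) n (X : ncclosure V n) : suc f ->
  limit_at f X (cext f n X).
Proof. by move=> fc; have [L hL] := cext_lim X fc; rewrite (cext_uniq hL). Qed.

Lemma cext_suc (f : scalfun V) : suc f -> suc (cext f).
Proof.
move=> fc e e0; have e3 : 0 < e / 3 by rewrite divr_gt0.
have [a a0 ha] := cextP fc e3; have [b b0 hb] := fc _ e3.
have b3 : 0 < b / 3 by rewrite divr_gt0.
exists (b / 3) => // n X Y XY.
have ab : 0 < Num.min a (b / 3) by rewrite lt_min a0.
have [X'] := cl_approx X ab; rewrite lt_min => /andP[/ha XX X'X].
have [Y'] := cl_approx Y ab; rewrite lt_min => /andP[/ha YY Y'Y].
have XY' : mnorm (f n X' - f n Y') < e / 3.
  apply: hb; apply: (ltr_thirds (tdist_trans _ (val X) _) (tdist_trans _ (val Y) _)).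
  - exact: X'X.
  - exact: XY.
  - by rewrite tdistC; exact: Y'Y.
apply: (ltr_thirds (mnorm_trans _ (f n X') _) (mnorm_trans _ (f n Y') _)).
- by rewrite mnormB; exact: XX.
- exact: XY'.
- exact: YY.
Qed.

Lemma cext_evr (f : scalfun V) n (X : ncclosure V n) (e : R) : suc f -> 0 < e ->
  evr (fun r => forall VrX : V n (tscale r (val X)),
    mnorm (f n (inV VrX) - cext f n X) < e).
Proof.
move=> fc e0; have [dl dl0 hdl] := cextP fc e0.
apply: evrW (evr_tdist (val X) dl0) => r r0 r1 rX VrX.
exact: hdl.
Qed.

Lemma cext_sbounded (f : scalfun V) M : suc f -> sbounded f M ->
  sbounded (cext f) M.
Proof.
move=> fc fM n X; apply/ler_addgt0Pr => e e0.
have [r [r0 r1 h]] := evr_ex (cext_evr X fc e0).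
have VrX := cl_tscale VP (memV X) r0 r1.
rewrite -(subrK (f n (inV VrX)) (cext f n X)).
apply: le_trans (mnormD _ _) _; rewrite addrC lerD //.
by rewrite mnormB ltW.
Qed.

(** A sum instead of the maximum, which is enough for passing to limits. *)
Lemma mnorm_block_diag {m n} (A : 'M[C]_m) (B : 'M[C]_n) :
  mnorm (block_mx A 0 0 B) <= mnorm A + mnorm B.
Proof.
apply: mnorm_le => [|v]; first by rewrite addr_ge0 ?mnorm_ge0.
rewrite !nsq_split mulrDr.
have le_sqr (a b : R) : 0 <= a -> 0 <= b -> a ^+ 2 <= (a + b) ^+ 2.
  by move=> a0 b0; rewrite lerXn2r ?nnegrE ?addr_ge0 // lerDl.
have hA := mnormP A (v \o lshift n); have hB := mnormP B (v \o @rshift m n).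
apply: lerD.
  rewrite (eq_nsq (v := mapp A (v \o lshift n))) => [|i /=]; last first.
    rewrite /mapp big_split_ord /= [X in _ + X]big1 ?addr0 => [|k _]; last first.
      by rewrite block_mxEur mxE mul0r.
    by apply: eq_bigr => k _; rewrite block_mxEul.
  by apply: le_trans hA _; rewrite ler_wpM2r ?nsq_ge0 // le_sqr ?mnorm_ge0.
rewrite (eq_nsq (v := mapp B (v \o @rshift m n))) => [|i /=]; last first.
  rewrite /mapp big_split_ord /= [X in X + _]big1 ?add0r => [|k _]; last first.
    by rewrite block_mxEdl mxE mul0r.
  by apply: eq_bigr => k _; rewrite block_mxEdr.
apply: le_trans hB _; rewrite ler_wpM2r ?nsq_ge0 // addrC.
by rewrite le_sqr ?mnorm_ge0.
Qed.

(** The approximation is radial with a common [r]: scaling commutes with direct sums and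
    similarities, so the approximating points satisfy the same relations exactly. *)
Lemma cext_nc (f : scalfun V) : suc f -> is_nc (tupfun_of_scal f) ->
  is_nc (tupfun_of_scal (cext f)).
Proof.
move=> fc [fd fs]; split=> [m n X Y Z ZE|n S X Y Su YE]; apply/funext => o.
  rewrite /tupfun_of_scal /dsum; apply: mnorm_lim_eq => e e0.
  have e3 : 0 < e / 3 by rewrite divr_gt0.
  have [r [r0 r1 [[hX hY] hZ]]] := evr_ex (evr_and (evr_and (cext_evr X fc e3)
    (cext_evr Y fc e3)) (cext_evr Z fc e3)).
  have VX := cl_tscale VP (memV X) r0 r1; have VY := cl_tscale VP (memV Y) r0 r1.
  have VZ := cl_tscale VP (memV Z) r0 r1.
  have fZ : f _ (inV VZ) = block_mx (f _ (inV VX)) 0 0 (f _ (inV VY)).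
    have := fd _ _ (inV VX) (inV VY) (inV VZ) => /(_ _)/(congr1 (fun T => T o)); apply.
    rewrite !val_inV ZE; apply/funext => j.
    by rewrite /tscale /dsum scale_block_mx !scaler0.
  apply: le_trans (mnorm_trans _ (f _ (inV VZ)) _) _.
  have -> : e = e / 3 + (e / 3 + e / 3) by field.
  apply: lerD; first by rewrite mnormB ltW.
  rewrite {1}fZ opp_block_mx add_block_mx !subr0.
  by apply: le_trans (mnorm_block_diag _ _) _; apply: lerD; apply: ltW.
rewrite /tupfun_of_scal /tconj; apply: mnorm_lim_eq => e e0.
pose K := mnorm (invmx S) * mnorm S + 1.
have K0 : 0 < K by rewrite ltr_wpDl // mulr_ge0 ?mnorm_ge0.
have e2 : 0 < e / 2 by rewrite divr_gt0.
have eK : 0 < e / 2 / K by rewrite divr_gt0.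
have [r [r0 r1 [hX hY]]] := evr_ex (evr_and (cext_evr X fc eK) (cext_evr Y fc e2)).
have VX := cl_tscale VP (memV X) r0 r1; have VY := cl_tscale VP (memV Y) r0 r1.
have fY : f _ (inV VY) = invmx S *m f _ (inV VX) *m S.
  have := fs _ S (inV VX) (inV VY) Su => /(_ _)/(congr1 (fun T => T o)); apply.
  rewrite !val_inV YE; apply/funext => j.
  by rewrite /tscale /tconj -scalemxAr -scalemxAl.
apply: le_trans (mnorm_trans _ (f _ (inV VY)) _) _.
rewrite [leRHS](splitr e); apply: lerD; first by rewrite mnormB ltW.
rewrite fY -mulmxBl -mulmxBr.
apply: le_trans (mnormM _ _) _.
apply: le_trans (ler_wpM2r (mnorm_ge0 _) (mnormM _ _)) _.
rewrite mulrAC; apply: (@le_trans _ _ (K * (e / 2 / K))).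
  by apply: ler_pM; rewrite ?mulr_ge0 ?mnorm_ge0 ?lerDl // ltW.
by rewrite mulrC divfK // gt_eqF.
Qed.

Lemma suc_lin (f g : scalfun V) a : suc f -> suc g -> suc (a *: f + g).
Proof.
move=> fc gc e e0; have a0 : 0 < cn a + 1 by rewrite ltr_wpDl // cn_ge0.
have ea : 0 < e / 2 / (cn a + 1) by rewrite !divr_gt0.
have e2 : 0 < e / 2 by rewrite divr_gt0.
have [p p0 hp] := fc _ ea; have [q q0 hq] := gc _ e2.
exists (Num.min p q); first by rewrite lt_min p0.
move=> n X Y; rewrite lt_min => /andP[/hp fXY /hq gXY].
have -> : (a *: f + g) n X - (a *: f + g) n Y = a *: (f n X - f n Y) + (g n X - g n Y).
  by rewrite scalerBr opprD addrACA.
apply: le_lt_trans (mnormD _ _) _; rewrite (splitr e) ler_ltD //.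
apply: le_trans (mnormZ_le _ _) _.
apply: (@le_trans _ _ ((cn a + 1) * (e / 2 / (cn a + 1)))).
  by apply: ler_pM; rewrite ?cn_ge0 ?mnorm_ge0 ?lerDl // ltW.
by rewrite mulrC divfK // gt_eqF.
Qed.

Lemma cext_lin (f g : scalfun V) a n (X : ncclosure V n) : suc f -> suc g ->
  cext (a *: f + g) n X = a *: cext f n X + cext g n X.
Proof.
move=> fc gc; apply: cext_uniq => e e0.
have a0 : 0 < cn a + 1 by rewrite ltr_wpDl // cn_ge0.
have ea : 0 < e / 2 / (cn a + 1) by rewrite !divr_gt0.
have e2 : 0 < e / 2 by rewrite divr_gt0.
have [p p0 hp] := cext_limit X fc ea; have [q q0 hq] := cext_limit X gc e2.
exists (Num.min p q); first by rewrite lt_min p0.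
move=> Y; rewrite lt_min => /andP[/hp fXY /hq gXY].
have -> : (a *: f + g) n Y - (a *: cext f n X + cext g n X) =
    a *: (f n Y - cext f n X) + (g n Y - cext g n X).
  by rewrite scalerBr opprD addrACA.
apply: le_lt_trans (mnormD _ _) _; rewrite (splitr e) ler_ltD //.
apply: le_trans (mnormZ_le _ _) _.
apply: (@le_trans _ _ ((cn a + 1) * (e / 2 / (cn a + 1)))).
  by apply: ler_pM; rewrite ?cn_ge0 ?mnorm_ge0 ?lerDl // ltW.
by rewrite mulrC divfK // gt_eqF.
Qed.

Lemma cext_mul (f g : scalfun V) n (X : ncclosure V n) M : suc f -> suc g ->
  sbounded g M -> cext (f * g) n X = cext f n X *m cext g n X.
Proof.
move=> fc gc gM; apply: cext_uniq => e e0.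
pose F := mnorm (cext f n X).
have F0 : 0 < F + 1 by rewrite ltr_wpDl // mnorm_ge0.
have M0 : 0 < `|M| + 1 by rewrite ltr_wpDl.
have eF : 0 < e / 2 / (F + 1) by rewrite !divr_gt0.
have eM : 0 < e / 2 / (`|M| + 1) by rewrite !divr_gt0.
have [p p0 hp] := cext_limit X fc eM; have [q q0 hq] := cext_limit X gc eF.
exists (Num.min p q); first by rewrite lt_min p0.
move=> Y; rewrite lt_min => /andP[/hp fXY /hq gXY].
have -> : (f * g) n Y - cext f n X *m cext g n X =
    (f n Y - cext f n X) *m g n Y + cext f n X *m (g n Y - cext g n X).
  by rewrite mulmxBl mulmxBr subrKA.
apply: le_lt_trans (mnormD _ _) _; rewrite (splitr e) ler_ltD //.
  apply: le_trans (mnormM _ _) _.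
  apply: (@le_trans _ _ (e / 2 / (`|M| + 1) * (`|M| + 1))); last by rewrite divfK // gt_eqF.
  apply: ler_pM; rewrite ?mnorm_ge0 ?(ltW fXY) //.
  by apply: le_trans (gM _ _) _; apply: le_trans (ler_norm _) _; rewrite lerDl.
apply: le_lt_trans (mnormM _ _) _.
apply: (@le_lt_trans _ _ ((F + 1) * mnorm (g n Y - cext g n X))).
  by rewrite ler_wpM2r ?mnorm_ge0 // lerDl.
by rewrite mulrC -ltr_pdivlMr.
Qed.

Lemma cext_of_closed (h : scalfun (ncclosure V)) n (X : ncclosure V n) :
  suc h -> cext (fun n (X : V n) => h n (clV X)) n X = h n X.
Proof.
move=> hc; apply: cext_uniq => e e0; have [dl dl0 hdl] := hc e e0.
by exists dl => // Y YX; apply: hdl.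
Qed.

Lemma ncpoly_suc (W : ncdom R d) (p : ncpoly R d) (c : R) : 0 <= c ->
  (forall n (X : mtuple R d n), W n X -> tnorm X <= c) -> suc (ncpoly_fun W p).
Proof.
move=> c0 Wc e e0; have [K K0 hK] := ncpoly_eval_lip p c0.
have K1 : 0 < K + 1 by rewrite ltr_wpDl.
exists (e / (K + 1)); first by rewrite divr_gt0.
move=> n X Y XY; apply: le_lt_trans (hK _ _ _ (Wc _ _ (memV X)) (Wc _ _ (memV Y))) _.
rewrite ltr_pdivlMr // in XY; apply: le_lt_trans XY.
by rewrite mulrC ler_wpM2l ?tdist_ge0 // lerDl.
Qed.

Lemma ncpoly_nc (W : ncdom R d) (p : ncpoly R d) :
  is_nc (tupfun_of_scal (ncpoly_fun W p)).
Proof.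
split=> [m n X Y Z ZE|n S X Y Su YE]; apply/funext => o; rewrite /tupfun_of_scal /ncpoly_fun.
  by rewrite ZE ncpoly_eval_dsum.
have SY j : S *m val Y j = val X j *m S by rewrite YE /tconj -mulmxA mulKVmx.
by rewrite /tconj -mulmxA -(ncpoly_eval_twine SY) mulKmx.
Qed.

Lemma ncpoly_sbounded (W : ncdom R d) (p : ncpoly R d) (c : R) : 0 <= c ->
  (forall n (X : mtuple R d n), W n X -> tnorm X <= c) ->
  exists M, sbounded (ncpoly_fun W p) M.
Proof.
move=> c0 Wc; have [K K0 hK] := ncpoly_eval_bounded p c0.
by exists K => n X; apply: hK; apply: Wc; apply: memV.
Qed.

Lemma cext_poly p n (X : ncclosure V n) :
  cext (ncpoly_fun V p) n X = ncpoly_eval p (val X).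
Proof.
have [c c0 hc] := cl_bounded VP.
exact: (cext_of_closed X (@ncpoly_suc (ncclosure V) p c c0 hc)).
Qed.

Lemma Aalg_suc (f : scalfun V) : Aalg V f -> suc f.
Proof.
move=> [[_ [M fM]] happ] e e0.
have e3 : 0 < e / 3 by rewrite divr_gt0.
have [p hp] := happ _ e3.
have [c c0 hc] := pvar_bounded VP.
have [K hK] := ncpoly_sbounded p c0 hc.
have bnd : sbounded (f - ncpoly_fun V p) (M + K).
  by move=> n X; apply: le_trans (mnormD _ _) _; rewrite mnormN lerD // ?fM ?hK.
have fp n X : mnorm (f n X - ncpoly_fun V p n X) < e / 3.
  exact: le_lt_trans (le_supnorm X bnd) hp.
have [dl dl0 hdl] := ncpoly_suc p c0 hc e3.
exists dl => // n X Y XY.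
apply: (ltr_thirds (mnorm_trans _ (ncpoly_fun V p n X) _)
  (mnorm_trans _ (ncpoly_fun V p n Y) _)).
- exact: fp.
- exact: hdl.
- by rewrite mnormB; exact: fp.
Qed.

(** Since [V] is bounded, uniform continuity makes [f(r X)] uniformly close to [f(X)], and [f(r X)]
    is a uniform limit of Taylor sums for fixed [r < 1]. *)
Lemma suc_Aalg (f : scalfun V) : Hinf V f -> suc f -> Aalg V f.
Proof.
move=> fH fc; split=> // e e0; have [fnc [M fM]] := fH.
have [c c0 hc] := pvar_bounded VP.
have e3 : 0 < e / 3 by rewrite divr_gt0.
have [dl dl0 hdl] := fc _ e3.
have c1 : 0 < c + 1 by rewrite ltr_wpDl.
(* The gap [1 - r]: small enough that [r X] is within [dl] of every [X] in [V], and at most one half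
   so that [r] is nonnegative. *)
pose t := Num.min (2^-1) (dl / 2 / (c + 1)).
have t0 : 0 < t by rewrite lt_min !divr_gt0 // invr_gt0 ltr0n.
have t2 : t <= 2^-1 by rewrite ge_min lexx.
have tc : t * c < dl.
  apply: (@le_lt_trans _ _ (t * (c + 1))); first by rewrite ler_wpM2l ?(ltW t0) // lerDl.
  rewrite -ltr_pdivlMr //; apply: (@le_lt_trans _ _ (dl / 2 / (c + 1))).
    by rewrite ge_min lexx orbT.
  by rewrite ltr_pM2r ?invr_gt0 // ltr_pdivrMr // ltr_pMr // ltr1n.
have h2 : 2^-1 = 1 / 2 :> R by rewrite mul1r.
pose r := 1 - t.
have r0 : 0 <= r by rewrite subr_ge0 (le_trans t2) // h2 ler_pdivrMr // mul1r ler1n.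
have r1 : r < 1 by rewrite /r ltrBlDr ltrDl.
have [N hN] := geometric_small (M / (1 - r)) r0 r1 e3.
have [p hp pf] := taylor_remainder VP fnc N.
pose q : ncpoly R d :=
  flatten [seq ncpoly_scale ((r ^+ m)%:C%C) (p m) | m <- iota 0 N.+1].
have qE n (X : mtuple R d n) :
    ncpoly_eval q X = \sum_(m < N.+1) (r ^+ m)%:C%C *: ncpoly_eval (p m) X.
  rewrite -(big_mkord xpredT (fun m => (r ^+ m)%:C%C *: ncpoly_eval (p m) X)).
  rewrite /index_iota subn0 /q; elim: (iota _ _) => [|m s IH] /=.
    by rewrite big_nil /ncpoly_eval big_nil.
  by rewrite ncpoly_eval_cat ncpoly_evalZ IH big_cons.
exists q; apply: (@le_lt_trans _ _ (e / 3 + e / 3)); first last.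
  exact: two_thirds.
apply: supnorm_le => [|n X]; first by rewrite addr_ge0 // ltW.
have VrX := pvar_tscale VP r0 (ltW r1) (memV X).
apply: le_trans (mnorm_trans _ (f n (inV VrX)) _) _; apply: lerD.
  apply/ltW/hdl; rewrite tdistC; apply: le_lt_trans (tscale_dist _ (ltW r1)) _.
  rewrite (_ : 1 - r = t); last by rewrite /r; ring.
  by apply: le_lt_trans tc; rewrite ler_wpM2l ?(ltW t0) // hc //; apply: memV.
rewrite /ncpoly_fun qE; apply: le_trans hN.
by have := pf _ _ _ VrX M (memV X) r0 r1 fM; rewrite mulrAC mulrA.
Qed.

Lemma Aalg_poly p : Aalg V (ncpoly_fun V p).
Proof.
have [c c0 hc] := pvar_bounded VP.
apply: suc_Aalg; last exact: ncpoly_suc hc.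
by split; [exact: ncpoly_nc|exact: ncpoly_sbounded hc].
Qed.

Lemma Aalg_lin a (f g : scalfun V) : Aalg V f -> Aalg V g -> Aalg V (a *: f + g).
Proof.
move=> fA gA; have [[[fd fs] [M fM]] _] := fA; have [[[gd gs] [K gK]] _] := gA.
apply: suc_Aalg; last by apply: suc_lin; apply: Aalg_suc.
split.
  split=> [m n X Y Z ZE|n S X Y Su YE]; apply/funext => o; rewrite /tupfun_of_scal /=.
    have := congr1 (fun T => T o) (fd _ _ _ _ _ ZE).
    have := congr1 (fun T => T o) (gd _ _ _ _ _ ZE).
    rewrite /tupfun_of_scal /dsum => hg hf.
    transitivity (a *: f _ Z + g _ Z) => //; rewrite hf hg.
    by rewrite scale_block_mx add_block_mx !scaler0 !addr0.
  have := congr1 (fun T => T o) (fs _ _ _ _ Su YE).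
  have := congr1 (fun T => T o) (gs _ _ _ _ Su YE).
  rewrite /tupfun_of_scal /tconj => hg hf.
  transitivity (a *: f _ Y + g _ Y) => //; rewrite hf hg.
  by rewrite mulmxDr mulmxDl -scalemxAr -scalemxAl.
exists (cn a * M + K) => n X; apply: le_trans (mnormD _ _) _; rewrite lerD //.
by apply: le_trans (mnormZ_le _ _) _; rewrite ler_wpM2l ?cn_ge0.
Qed.

Lemma Aalg_sbounded (f : scalfun V) : Aalg V f -> exists M, sbounded f M.
Proof. by case=> -[_]. Qed.

Lemma Aalg_nc (f : scalfun V) : Aalg V f -> is_nc (tupfun_of_scal f).
Proof. by case=> -[]. Qed.

End ContExt.

(** * From homomorphisms to maps *)

Section MxBlockNorm.
Context {R : realType}.
Local Notation C := R[i].

Lemma big_tagnat {T : nmodType} k n (F : 'I_k -> 'I_n -> T) :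
  \sum_(s < \sum_(i < k) n) F (tagnat.sig1 s) (tagnat.sig2 s) = \sum_a \sum_i F a i.
Proof. by rewrite sig_big_dep (reindex _ tagnat.sig_bij_on). Qed.

(** With [bapp], this describes block matrices acting on doubly indexed vectors, so that [\mxblock]
    is estimated without its index encoding. *)
Definition dsq {k n} (c : 'I_k -> 'I_n -> C) : R := \sum_a \sum_i cn (c a i) ^+ 2.

Definition bapp {k n} (B : 'I_k -> 'I_k -> 'M[C]_n) (c : 'I_k -> 'I_n -> C) :=
  fun a i => \sum_b \sum_l B a b i l * c b l.

Lemma nsq_bapp {k n} (B : 'I_k -> 'I_k -> 'M[C]_n) (c : 'I_k -> 'I_n -> C) :
  nsq (mapp (\mxblock_(a < k, b < k) B a b)
    (fun s => c (tagnat.sig1 s) (tagnat.sig2 s))) = dsq (bapp B c).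
Proof.
rewrite /nsq /dsq -big_tagnat; apply: eq_bigr => s _; congr (cn _ ^+ 2).
rewrite /mapp /bapp -big_tagnat; apply: eq_bigr => t _.
by rewrite mxE.
Qed.

Lemma nsq_tagnat {k n} (c : 'I_k -> 'I_n -> C) :
  nsq (fun s : 'I_(\sum_(i < k) n) => c (tagnat.sig1 s) (tagnat.sig2 s)) = dsq c.
Proof. by rewrite /nsq /dsq -big_tagnat. Qed.

Lemma mnorm_mxblockP {k n} (B : 'I_k -> 'I_k -> 'M[C]_n) c :
  dsq (bapp B c) <= mnorm (\mxblock_(a < k, b < k) B a b) ^+ 2 * dsq c.
Proof. by rewrite -nsq_bapp -(nsq_tagnat c) mnormP. Qed.

Lemma mnorm_mxblock_le {k n} (B : 'I_k -> 'I_k -> 'M[C]_n) (M : R) : 0 <= M ->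
  (forall c, dsq (bapp B c) <= M ^+ 2 * dsq c) ->
  mnorm (\mxblock_(a < k, b < k) B a b) <= M.
Proof.
move=> M0 BM; apply: mnorm_le => // w.
pose c a i := w (@tagnat.Rank k (fun=> n) a i).
have -> : w = fun s => c (tagnat.sig1 s) (tagnat.sig2 s).
  by apply/funext => s; rewrite /c tagnat.sig2K.
by rewrite nsq_bapp nsq_tagnat.
Qed.

End MxBlockNorm.

(** * Orthonormal families and Bessel's inequality *)

Section GramSchmidt.
Context {R : realType} (H : hilbert R).
Local Notation C := R[i].

(* Orthonormal up to zero vectors, which keep the family indexed by a fixed type. *)
Definition onz {I : eqType} (e : I -> H) : Prop :=
  (forall a b, a != b -> hdot H (e a) (e b) = 0) /\
  (forall a, hdot H (e a) (e a) = 1 \/ e a = 0).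

(** For an [onz] family this is membership in the span, stated so that the coordinates are given by
    inner products. *)
Definition inspan {I : finType} (e : I -> H) (v : H) : Prop :=
  v = \sum_a hdot H v (e a) *: e a.

Lemma inspan0 {I : finType} (e : I -> H) : inspan e 0.
Proof. by rewrite /inspan big1 // => a _; rewrite linear0l scale0r. Qed.

Lemma inspanD {I : finType} (e : I -> H) u v :
  inspan e u -> inspan e v -> inspan e (u + v).
Proof.
rewrite /inspan => {1}-> {1}->; rewrite -big_split; apply: eq_bigr => a _ /=.
by rewrite hdotDl scalerDl.
Qed.

Lemma inspanZ {I : finType} (e : I -> H) (x : C) v :
  inspan e v -> inspan e (x *: v).
Proof.
rewrite /inspan => {1}->; rewrite scaler_sumr; apply: eq_bigr => a _ /=.
by rewrite hdotZl scalerA.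
Qed.

Lemma inspan_sum {I : finType} (e : I -> H) (J : Type) (r : seq J) (F : J -> H) :
  (forall j, inspan e (F j)) -> inspan e (\sum_(j <- r) F j).
Proof.
move=> h; elim/big_ind: _ => [|u v hu hv|//]; first exact: inspan0.
exact: inspanD.
Qed.

Lemma hdot_onz {I : finType} (e : I -> H) (c : I -> C) :
  onz e -> forall b, hdot H (\sum_a c a *: e a) (e b) = c b * hdot H (e b) (e b).
Proof.
move=> [e1 _] b; rewrite hdot_suml (bigD1 b) //= big1 ?addr0 ?hdotZl // => a ab.
by rewrite hdotZl e1 ?mulr0.
Qed.

Lemma onz_sqr {I : finType} (e : I -> H) (c : I -> C) : onz e ->
  hdot H (\sum_a c a *: e a) (\sum_a c a *: e a) =
  \sum_a (cn (c a) ^+ 2)%:C%C * hdot H (e a) (e a).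
Proof.
move=> eo; rewrite hdot_sumr; apply: eq_bigr => b _.
by rewrite hdotZr hdot_onz // mulrA -conjM_cn [Num.conj _ * _]mulrC.
Qed.

Lemma cn_onz_le {I : finType} (e : I -> H) (c : I -> C) : onz e ->
  cn (\sum_a c a *: e a) ^+ 2 <= \sum_a cn (c a) ^+ 2.
Proof.
move=> eo; rewrite -lecR -hdot_cn onz_sqr // rmorph_sum /=; apply: ler_sum => a _.
case: (eo.2 a) => ->; first by rewrite mulr1.
by rewrite linear0l mulr0 lecR sqr_ge0.
Qed.

Lemma cn_inspan {I : finType} (e : I -> H) v : onz e -> inspan e v ->
  cn v ^+ 2 = \sum_a cn (hdot H v (e a)) ^+ 2.
Proof.
move=> eo ve; apply: complexI; rewrite -hdot_cn {1 2}ve onz_sqr //.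
rewrite rmorph_sum; apply: eq_bigr => a _ /=.
by case: (eo.2 a) => ->; rewrite ?mulr1 // !linear0r ?mulr0 cn0 expr0n.
Qed.

Lemma bessel {I : finType} (e : I -> H) v : onz e ->
  \sum_a cn (hdot H v (e a)) ^+ 2 <= cn v ^+ 2.
Proof.
move=> eo; pose s := \sum_a hdot H v (e a) *: e a.
pose B := \sum_a cn (hdot H v (e a)) ^+ 2.
have ss : hdot H s s = B%:C%C.
  rewrite /s onz_sqr // rmorph_sum; apply: eq_bigr => a _ /=.
  by case: (eo.2 a) => ->; rewrite ?mulr1 // !linear0r ?mulr0 cn0 expr0n.
have vs : hdot H v s = B%:C%C.
  rewrite /s hdot_sumr rmorph_sum; apply: eq_bigr => a _ /=.
  by rewrite hdotZr -conjM_cn mulrC.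
have sv : hdot H s v = B%:C%C.
  by rewrite hdot_sym vs conj_Creal //; apply/complex_realP; exists B.
have : 0 <= hdot H (v + (-1) *: s) (v + (-1) *: s) by rewrite hdot_cn lecR sqr_ge0.
rewrite hdotDl !hdotDr !hdotZl !hdotZr ss vs sv rmorphN rmorph1 !mulN1r hdot_cn.
by rewrite opprK addrA subrK -rmorphB lecR subr_ge0.
Qed.

Lemma gram_schmidt n (v : nat -> H) : exists e : 'I_n -> H, onz e /\
  forall k : 'I_n, inspan e (v k).
Proof.
elim: n => [|n [e [eo ve]]].
  by exists (fun=> 0); split=> [|[]//]; split=> // -[].
pose w := v n - \sum_a hdot H (v n) (e a) *: e a.
have we a : hdot H w (e a) = 0.
  rewrite /w -scaleN1r hdotDl hdotZl hdot_onz // mulN1r.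
  by case: (eo.2 a) => ->; rewrite ?mulr1 ?subrr // !linear0r ?mulr0 subr0.
(* As the inverse of 0 is 0, a dependent vector contributes the zero vector, which [onz] allows. *)
pose x : H := (cn w)^-1%:C%C *: w.
have xx : hdot H x x = 1 \/ x = 0.
  have [w0|w0] := eqVneq (cn w) 0; [right|left].
    by rewrite /x (cn_eq0 w0) scaler0.
  rewrite /x hdotZl hdotZr hdot_cn conj_Creal; last by apply/complex_realP; exists (cn w)^-1.
  by rewrite -!rmorphM /= (_ : _ * _ = 1) ?rmorph1 //; field.
have xe a : hdot H x (e a) = 0 by rewrite /x hdotZl we mulr0.
pose e' (a : 'I_n.+1) := if unlift ord_max a is Some b then e b else x.
have e'l a : e' (lift ord_max a) = e a by rewrite /e' liftK.
have e'm : e' ord_max = x by rewrite /e' unlift_none.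
have eo' : onz e'.
  split=> [a b|a].
    case: (unliftP ord_max a) => [a'|] ->; case: (unliftP ord_max b) => [b'|] ->;
      rewrite ?e'l ?e'm ?eqxx // => ab.
    - by apply: eo.1; apply: contra ab => /eqP ->.
    - by rewrite hdot_sym xe rmorph0.
  by case: (unliftP ord_max a) => [a'|] ->; rewrite ?e'l ?e'm //; apply: eo.2.
have spn u : inspan e u -> inspan e' u.
  move=> hu; rewrite /inspan big_ord_recr /= e'm.
  have -> : hdot H u x = 0.
    rewrite hdot_sym hu hdot_sumr big1 ?rmorph0 // => a _.
    by rewrite hdotZr xe mulr0.
  rewrite scale0r addr0 {1}hu; apply: eq_bigr => a _.
  have -> : widen_ord (leqnSn n) a = lift ord_max a by apply: val_inj; rewrite /= /bump leqNgt ltn_ord.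
  by rewrite e'l.
exists e'; split=> // k; case: (unliftP ord_max k) => [k'|] ->.
  by rewrite lift_max; apply/spn/ve.
have xs : inspan e' x.
  rewrite /inspan big_ord_recr /= e'm big1 ?add0r => [|a _].
    by case: xx => ->; rewrite ?scale1r // scaler0.
  have -> : widen_ord (leqnSn n) a = lift ord_max a by apply: val_inj; rewrite /= /bump leqNgt ltn_ord.
  by rewrite e'l xe scale0r.
have -> : v (@ord_max n) = (cn w)%:C%C *: x + \sum_a hdot H (v n) (e a) *: e a.
  rewrite /x scalerA -rmorphM /=; have [w0|w0] := eqVneq (cn w) 0.
    by rewrite w0 mul0r scale0r add0r; apply/eqP; rewrite -subr_eq0 -/w (cn_eq0 w0).
  by rewrite mulfV // rmorph1 scale1r /w subrK.
apply: inspanD; first exact: inspanZ.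
apply: inspan_sum => a; apply: inspanZ; apply: spn.
rewrite /inspan (bigD1 a) //= big1 ?addr0 => [|b ba].
  by case: (eo.2 a) => ->; rewrite ?scale1r // scaler0.
by rewrite eo.1 ?scale0r // eq_sym.
Qed.

(** Complete contractivity concerns square matrices; padding by zeros gives the families in the
    domain and in the codomain a common length. *)
Lemma onz_pad {m n} (e : 'I_m -> H) : onz e ->
  onz (fun a : 'I_(m + n) => if fintype.split a is inl b then e b else 0).
Proof.
move=> eo; split=> [a b|a].
  rewrite -{1}(splitK a) -{1}(splitK b).
  case: (fintype.split a) (fintype.split b) => [a'|a'] [b'|b'] /=;
    rewrite ?linear0l ?linear0r //.
  by rewrite (inj_eq (@lshift_inj _ _)); apply: eo.1.
by case: (fintype.split a) => a'; [apply: eo.2|right].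
Qed.

Lemma onz_padr {m n} (e : 'I_n -> H) : onz e ->
  onz (fun a : 'I_(m + n) => if fintype.split a is inr b then e b else 0).
Proof.
move=> eo; split=> [a b|a].
  rewrite -{1}(splitK a) -{1}(splitK b).
  case: (fintype.split a) (fintype.split b) => [a'|a'] [b'|b'] /=;
    rewrite ?linear0l ?linear0r //.
  by rewrite (inj_eq (@rshift_inj _ _)); apply: eo.1.
by case: (fintype.split a) => a'; [right|apply: eo.2].
Qed.

Lemma inspan_pad {m n} (e : 'I_m -> H) v : inspan e v ->
  inspan (fun a : 'I_(m + n) => if fintype.split a is inl b then e b else 0) v.
Proof.
move=> hv; rewrite /inspan big_split_ord /= [X in _ + X]big1 ?addr0 => [|a _].
  rewrite {1}hv; apply: eq_bigr => a _.
  by rewrite (unsplitK (inl a)).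
by rewrite (unsplitK (inr a)) scaler0.
Qed.

Lemma inspan_padr {m n} (e : 'I_n -> H) v : inspan e v ->
  inspan (fun a : 'I_(m + n) => if fintype.split a is inr b then e b else 0) v.
Proof.
move=> hv; rewrite /inspan big_split_ord /= [X in X + _]big1 ?add0r => [|a _].
  rewrite {1}hv; apply: eq_bigr => a _.
  by rewrite (unsplitK (inr a)).
by rewrite (unsplitK (inl a)) scaler0.
Qed.

End GramSchmidt.

(** * Finite compressions of a pencil *)

Section Compression.
Context {R : realType} {d : nat} (Q : pencil R d).
Local Notation C := R[i].

(** The block entry of [Q(X)] between the families [e] and [f]. As a linear polynomial in [X] it
    defines an element of the algebra. *)
Definition compr {k} (e : 'I_k -> pdom Q) (f : 'I_k -> pcod Q) {n} (X : mtuple R d n)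
    (a b : 'I_k) : 'M[C]_n :=
  \sum_j hdot (pcod Q) (pcoef Q j (e b)) (f a) *: X j.

Lemma bapp_compr {k} (e : 'I_k -> pdom Q) (f : 'I_k -> pcod Q) {n} (X : mtuple R d n)
    c a i :
  bapp (compr e f X) c a i =
  hdot (pcod Q) (papp X (fun l => \sum_b c b l *: e b) i) (f a).
Proof.
rewrite /bapp /papp hdot_suml.
under eq_bigr do under eq_bigr do rewrite summxE mulr_suml.
under eq_bigr do rewrite exchange_big /=.
rewrite exchange_big /=; apply: eq_bigr => j _.
rewrite hdot_suml exchange_big /=; apply: eq_bigr => l _.
rewrite hdotZl linear_sum hdot_suml mulr_sumr; apply: eq_bigr => b _.
by rewrite linearZ hdotZl mxE; ring.
Qed.

(** The block matrix factors into three contractions: synthesis along [e], then [Q(X)], then the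
    coefficients along [f], by Bessel. *)
Lemma compr_le {k} (e : 'I_k -> pdom Q) (f : 'I_k -> pcod Q) {n} (X : mtuple R d n) :
  onz e -> onz f -> qbound Q X 1 ->
  mnorm (\mxblock_(a < k, b < k) compr e f X a b) <= 1.
Proof.
move=> eo fo X1; apply: mnorm_mxblock_le => // c; rewrite expr1n mul1r /dsq.
under eq_bigr do under eq_bigr do rewrite bapp_compr.
rewrite exchange_big /=; pose v l := \sum_b c b l *: e b.
apply: (@le_trans _ _ (nsq (papp X v))).
  by apply: ler_sum => i _; apply: bessel.
have := X1 v; rewrite expr1n mul1r => /le_trans; apply.
rewrite [leRHS]exchange_big /=; apply: ler_sum => l _.
exact: cn_onz_le.
Qed.

(* A finite compression of [Q(Y)] already sees the vectors [v] and [Q(Y) v]. *)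
Lemma qbound_compr {n} (Y : mtuple R d n) :
  (forall k (e : 'I_k -> pdom Q) (f : 'I_k -> pcod Q), onz e -> onz f ->
    mnorm (\mxblock_(a < k, b < k) compr e f Y a b) <= 1) -> qbound Q Y 1.
Proof.
move=> hY v; rewrite expr1n mul1r.
have [e0 [e0o e0v]] := gram_schmidt n (fun k => if insub k is Some i then v i else 0).
(* The finitely many vectors [Q_j v_i] span the components of [Q(Y) v], whatever [Y] is. *)
pose qv (k : nat) : pcod Q := if insub k is Some q then
  let ji : 'I_d * 'I_n := mxtens_unindex q in pcoef Q ji.1 (v ji.2) else 0.
have [f0 [f0o f0v]] := gram_schmidt (d * n) qv.
pose e (a : 'I_(n + d * n)) := if fintype.split a is inl b then e0 b else 0.
pose f (a : 'I_(n + d * n)) := if fintype.split a is inr b then f0 b else 0.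
have eo : onz e by apply: onz_pad.
have fo : onz f by apply: onz_padr.
have ev l : inspan e (v l).
  by apply: inspan_pad; have := e0v l; rewrite valK.
have fQ j l : inspan f (pcoef Q j (v l)).
  by apply: inspan_padr; have := f0v (mxtens_index (j, l)); rewrite /qv valK mxtens_indexK.
have fv i : inspan f (papp Y v i).
  by apply: inspan_sum => j; apply: inspan_sum => l; apply: inspanZ.
pose c (b : 'I_(n + d * n)) l := hdot (pdom Q) (v l) (e b).
have vc : (fun l => \sum_b c b l *: e b) = v by apply/funext => l; rewrite -(ev l).
have -> : nsq v = dsq c.
  rewrite /dsq exchange_big /=; apply: eq_bigr => l _.
  by rewrite (cn_inspan eo (ev l)).
have -> : nsq (pencil_eval Q Y v) = dsq (bapp (compr e f Y) c).
  rewrite /dsq exchange_big /=; apply: eq_bigr => i _.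
  rewrite (cn_inspan fo (fv i)); apply: eq_bigr => a _.
  by rewrite bapp_compr vc.
apply: le_trans (mnorm_mxblockP _ _) _.
rewrite ler_piMl ?expr_le1 ?mnorm_ge0 ?hY //.
by apply: sumr_ge0 => a _; apply: sumr_ge0 => i _; rewrite sqr_ge0.
Qed.

End Compression.

Section MxBlockBounds.
Context {R : realType}.
Local Notation C := R[i].

Lemma mnorm_mxblock_single {k n} (B : 'M[C]_n) (a0 b0 : 'I_k) :
  mnorm (\mxblock_(a < k, b < k) if (a == a0) && (b == b0) then B else 0) <= mnorm B.
Proof.
apply: mnorm_mxblock_le => [|c]; first exact: mnorm_ge0.
have bE i : bapp (fun a b => if (a == a0) && (b == b0) then B else 0) c a0 i =
    mapp B (c b0) i.
  rewrite /bapp (bigD1 b0) //= [X in _ + X]big1 ?addr0 => [|b bb0].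
    by apply: eq_bigr => l _; rewrite !eqxx.
  by rewrite big1 // => l _; rewrite (negbTE bb0) andbF mxE mul0r.
rewrite /dsq (bigD1 a0) //= [X in _ + X]big1 ?addr0 => [|a aa0].
  under eq_bigr do rewrite bE.
  apply: le_trans (mnormP B (c b0)) _; rewrite ler_wpM2l ?sqr_ge0 //.
  rewrite [leRHS](bigD1 b0) //= lerDl; apply: sumr_ge0 => b _.
  by apply: sumr_ge0 => i _; rewrite sqr_ge0.
rewrite big1 // => i _; rewrite /bapp big1 ?cn0 ?expr0n // => b _.
by rewrite big1 // => l _; rewrite (negbTE aa0) mxE mul0r.
Qed.

Lemma mnorm_mxblock_sum {k n} (B : 'I_k -> 'I_k -> 'M[C]_n) :
  mnorm (\mxblock_(a < k, b < k) B a b) <= \sum_a \sum_b mnorm (B a b).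
Proof.
have -> : \mxblock_(a < k, b < k) B a b = \sum_a0 \sum_b0
    \mxblock_(a < k, b < k) if (a == a0) && (b == b0) then B a0 b0 else 0.
  apply/matrixP => s t; rewrite summxE mxE (bigD1 (tagnat.sig1 s)) //=.
  rewrite [X in _ = _ + X]big1 ?addr0 => [|a0 sa0].
    rewrite summxE (bigD1 (tagnat.sig1 t)) //= [X in _ = _ + X]big1 ?addr0 => [|b0 tb0].
      by rewrite mxE !eqxx.
    by rewrite mxE [_ == b0]eq_sym (negbTE tb0) andbF mxE.
  rewrite summxE big1 // => b0 _.
  by rewrite mxE [_ == a0]eq_sym (negbTE sa0) mxE.
apply: le_trans (mnorm_sum _ _) _; apply: ler_sum => a _.
apply: le_trans (mnorm_sum _ _) _; apply: ler_sum => b _.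
exact: mnorm_mxblock_single.
Qed.

Lemma mnorm_mxblock1 {n} (B : 'I_1 -> 'I_1 -> 'M[C]_n) :
  mnorm (B ord0 ord0) <= mnorm (\mxblock_(a < 1, b < 1) B a b).
Proof.
apply: mnorm_le => [|v]; first exact: mnorm_ge0.
have dsq1 (c : 'I_1 -> 'I_n -> C) : dsq c = nsq (c ord0).
  by rewrite /dsq big_ord_recl big_ord0 addr0.
have := mnorm_mxblockP B (fun _ => v); rewrite !dsq1 (eq_nsq (v := mapp (B ord0 ord0) v)) //.
by move=> i; rewrite /bapp big_ord_recl big_ord0 addr0.
Qed.

Context {d : nat}.
Unset Implicit Arguments.
Context {V : ncdom R d}.
Set Implicit Arguments.

Lemma le_supnorm_mx {k} (f : 'M[scalfun V]_k) n (X : V n) :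
  (forall i j, exists M, sbounded (f i j) M) ->
  mnorm (\mxblock_(i < k, j < k) f i j n X) <= supnorm_mx f.
Proof.
move=> fb; have [M hM] := choice (fun ij : 'I_k * 'I_k => fb ij.1 ij.2).
apply: ub_le_sup; last by exists n, X.
exists (\sum_a \sum_b M (a, b)) => _ [m [Y ->]].
apply: le_trans (mnorm_mxblock_sum _) _; apply: ler_sum => a _.
by apply: ler_sum => b _; apply: (hM (a, b)).
Qed.

Lemma supnorm_mx_le {k} (f : 'M[scalfun V]_k) M : 0 <= M ->
  (forall n (X : V n), mnorm (\mxblock_(i < k, j < k) f i j n X) <= M) ->
  supnorm_mx f <= M.
Proof.
move=> M0 fM; have [[n [X _]]|ne] := pselect (exists n (X : V n), True).
  apply: sup_le_ub; first by exists (mnorm (\mxblock_(i < k, j < k) f i j n X)), n, X.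
  by move=> _ [m [Y ->]].
rewrite /supnorm_mx (_ : [set r | _] = set0) ?sup0 //.
by apply/seteqP; split=> // r [n [X _]]; case: ne; exists n, X.
Qed.

End MxBlockBounds.

Section Tuples.
Context {R : realType}.
Local Notation C := R[i].

Lemma bigmin_pos (I : finType) (F : I -> R) : (forall i, 0 < F i) ->
  exists2 m : R, 0 < m <= 1 & forall i, m <= F i.
Proof.
move=> F0; exists (\big[Num.min/1]_i F i).
  by rewrite bigmin_le_id andbT; apply: lt_bigmin => // i _; apply: F0.
by move=> i; apply: bigmin_le.
Qed.

Lemma evr_all (I : finType) (p : I -> R -> Prop) : (forall i, evr (p i)) ->
  evr (fun r => forall i, p i r).
Proof.
move=> h; have h' i : exists a, 0 < a /\ forall r, 1 - a < r -> r < 1 -> p i r.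
  by have [a /andP[a0 _] ha] := h i; exists a.
have [a ha] := choice h'.
have [m m0 hm] := bigmin_pos (fun i => (ha i).1).
exists m => // r rm r1 i; apply: (ha i).2 => //; apply: le_lt_trans rm.
by rewrite lerD2l lerN2.
Qed.

Unset Implicit Arguments.
Context {d l : nat} {V : ncdom R d} (F : tupfun V l).
Set Implicit Arguments.

Definition coord (j : 'I_l) : scalfun V := fun n X => F n X j.

Lemma suc_coord : (forall j, suc (coord j)) -> nc_unif_continuous F.
Proof.
move=> h e e0; have h' j : exists dl : R, 0 < dl /\ forall n (X Y : V n),
    tdist (val X) (val Y) < dl -> mnorm (F n X j - F n Y j) < e.
  by have [dl dl0 hdl] := h j e e0; exists dl.
have [dl hdl] := choice h'.
have [m /andP[m0 _] hm] := bigmin_pos (fun j => (hdl j).1).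
exists m => // n X Y XY; apply: tnorm_lt => // j.
by apply: (hdl j).2; apply: lt_le_trans XY (hm j).
Qed.

Lemma nc_coord : (forall j, is_nc (tupfun_of_scal (coord j))) -> is_nc F.
Proof.
move=> h; split=> [m n X Y Z ZE|n S X Y Su YE]; apply/funext => j.
  exact: (congr1 (fun T => T ord0) ((h j).1 _ _ _ _ _ ZE)).
exact: (congr1 (fun T => T ord0) ((h j).2 _ _ _ _ Su YE)).
Qed.

End Tuples.

(** * The map induced by a completely contractive homomorphism *)

Section HomToMap.
Context {R : realType}.
Local Notation C := R[i].
Unset Implicit Arguments.
Context {d1 d2 : nat} {Q1 : pencil R d1} {Q2 : pencil R d2}
  {P1 : set (ncpoly R d1)} {P2 : set (ncpoly R d2)}
  {V1 : ncdom R d1} {V2 : ncdom R d2} (phi : scalfun V1 -> scalfun V2).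
Set Implicit Arguments.
Hypotheses (VP1 : pvar Q1 P1 V1) (VP2 : pvar Q2 P2 V2).
Hypotheses (phi_hom : alg_hom phi) (phi_cc : completely_contractive phi).

Let A1 p := Aalg_poly VP1 p.

Lemma ncpoly_fun_nil : ncpoly_fun V1 [::] = 0.
Proof. by apply/scalfunP => n X; rewrite /ncpoly_fun /ncpoly_eval big_nil. Qed.

Lemma phi0 : phi 0 = 0.
Proof.
have [_ lin _ _] := phi_hom; have A0 := A1 [::]; rewrite ncpoly_fun_nil in A0.
by have := lin (-1) 0 0 A0 A0; rewrite scaler0 addr0 scaleN1r addNr.
Qed.

Lemma phi_word w n (X : V2 n) :
  phi (ncpoly_fun V1 [:: (1, w)]) n X =
  word_eval w (fun j => phi (ncpoly_fun V1 (ncvar j)) n X).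
Proof.
have [_ lin mul one] := phi_hom; elim: w => [|j w IH] /=.
  have -> : ncpoly_fun V1 [:: (1, [::])] = 1.
    by apply/scalfunP => m Y; rewrite /ncpoly_fun ncpoly_eval1.
  by rewrite one.
have -> : ncpoly_fun V1 [:: (1, j :: w)] =
    ncpoly_fun V1 (ncvar j) * ncpoly_fun V1 [:: (1, w)].
  apply/scalfunP => m Y; transitivity (ncpoly_eval (ncvar j) (val Y) *m
    ncpoly_eval [:: (1, w)] (val Y)) => //.
  by rewrite /ncpoly_fun ncpoly_eval_var /ncpoly_eval !big_seq1 !scale1r.
by rewrite mul // -IH.
Qed.

Definition pull n (X : V2 n) : mtuple R d1 n :=
  fun j => phi (ncpoly_fun V1 (ncvar j)) n X.

Lemma phi_poly p n (X : V2 n) :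
  phi (ncpoly_fun V1 p) n X = ncpoly_eval p (pull X).
Proof.
have [_ lin _ _] := phi_hom; elim: p => [|t p IH].
  by rewrite ncpoly_fun_nil phi0 /ncpoly_eval big_nil.
have -> : ncpoly_fun V1 (t :: p) = t.1 *: ncpoly_fun V1 [:: (1, t.2)] + ncpoly_fun V1 p.
  apply/scalfunP => m Y; transitivity (t.1 *: ncpoly_eval [:: (1, t.2)] (val Y) +
    ncpoly_eval p (val Y)) => //.
  by rewrite /ncpoly_fun /ncpoly_eval big_cons big_seq1 scale1r.
rewrite lin //; transitivity (t.1 *: phi (ncpoly_fun V1 [:: (1, t.2)]) n X +
  phi (ncpoly_fun V1 p) n X) => //.
by rewrite phi_word IH /ncpoly_eval big_cons.
Qed.

Lemma phi_Aalg f : Aalg V1 f -> Aalg V2 (phi f).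
Proof. by have [h _ _ _] := phi_hom; apply: h. Qed.

Lemma pull_cl n (X : V2 n) : ncclosure V1 n (pull X).
Proof.
apply: (clI VP1); first exact: (pvar_gt0 VP2 (memV X)).
  apply: qbound_compr => k e f eo fo.
  (* The compression entries as polynomials, so that complete contractivity applies to the matrix
     [G] over the algebra of [V1]. *)
  pose g (a b : 'I_k) : ncpoly R d1 :=
    [seq (hdot (pcod Q1) (pcoef Q1 j (e b)) (f a), [:: j]) | j <- index_enum 'I_d1].
  have gE a b m (Y : mtuple R d1 m) : ncpoly_eval (g a b) Y = compr e f Y a b.
    rewrite /ncpoly_eval big_map; apply: eq_bigr => j _ /=.
    by rewrite mulmx1.
  pose G : 'M[scalfun V1]_k := \matrix_(a, b) ncpoly_fun V1 (g a b).
  have GA a b : Aalg V1 (G a b) by rewrite mxE; apply: A1.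
  have -> : \mxblock_(a < k, b < k) compr e f (pull X) a b =
      \mxblock_(a < k, b < k) map_mx phi G a b n X.
    by apply: eq_mxblock => a b; rewrite !mxE phi_poly gE.
  apply: le_trans (le_supnorm_mx X _) _.
    by move=> a b; rewrite mxE; apply: Aalg_sbounded; apply: phi_Aalg.
  apply: le_trans (phi_cc GA) _; apply: supnorm_mx_le => // m Y.
  have -> : \mxblock_(a < k, b < k) G a b m Y =
      \mxblock_(a < k, b < k) compr e f (val Y) a b.
    by apply: eq_mxblock => a b; rewrite !mxE /ncpoly_fun gE.
  exact: compr_le eo fo (pvar_qbound1 VP1 (memV Y)).
(* A polynomial of [P1] is the zero element of the algebra of [V1], so [phi] sends it to 0. *)
move=> p Pp; rewrite -phi_poly.
have -> : ncpoly_fun V1 p = 0.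
  by apply/scalfunP => m Y; apply: (pvar_poly VP1 (memV Y) Pp).
by rewrite phi0.
Qed.

Definition pullc n (X : ncclosure V2 n) : mtuple R d1 n :=
  fun j => cext (phi (ncpoly_fun V1 (ncvar j))) n X.

Lemma phi_suc f : Aalg V1 f -> suc (phi f).
Proof. by move=> /phi_Aalg /(Aalg_suc VP2). Qed.

Lemma pullc_evr n (X : ncclosure V2 n) (e : R) : 0 < e ->
  evr (fun r => forall VrX : V2 n (tscale r (val X)),
    tdist (pull (inV VrX)) (pullc X) < e).
Proof.
move=> e0.
apply: evrW (evr_all (fun j => cext_evr X (phi_suc (A1 (ncvar j))) e0)).
by move=> r r0 r1 h VrX; apply: tnorm_lt => // j; apply: h.
Qed.

Lemma pullc_cl n (X : ncclosure V2 n) : ncclosure V1 n (pullc X).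
Proof.
apply: cl_closed => e e0; have [r [r0 r1 h]] := evr_ex (pullc_evr X e0).
have VrX := cl_tscale VP2 (memV X) r0 r1.
by exists (pull (inV VrX)); [exact: pull_cl|rewrite tdistC].
Qed.

Definition hom_map : ncmap (ncclosure V2) (ncclosure V1) :=
  fun n X => inV (pullc_cl X).

Lemma hom_map_nc : is_nc (tupfun_of_map hom_map).
Proof.
apply: nc_coord => j; have Aj := A1 (ncvar j).
exact: (cext_nc VP2 (phi_suc Aj) (Aalg_nc (phi_Aalg Aj))).
Qed.

Lemma hom_map_uc : nc_unif_continuous (tupfun_of_map hom_map).
Proof. by apply: suc_coord => j; apply: cext_suc; apply: phi_suc. Qed.

(** Ordinary contractivity, obtained from 1 by 1 matrices. *)
Lemma phi_sbounded f M : 0 <= M -> Aalg V1 f -> sbounded f M -> sbounded (phi f) M.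
Proof.
move=> M0 fA fM n X; pose G : 'M[scalfun V1]_1 := \matrix_(a, b) f.
have GA a b : Aalg V1 (G a b) by rewrite mxE.
have -> : phi f n X = (map_mx phi G) ord0 ord0 n X by rewrite !mxE.
apply: le_trans (mnorm_mxblock1 (fun a b => (map_mx phi G) a b n X)) _.
apply: le_trans (le_supnorm_mx X _) _.
  by move=> a b; rewrite !mxE; apply: Aalg_sbounded; apply: phi_Aalg.
apply: le_trans (phi_cc GA) _; apply: supnorm_mx_le => // m Y.
apply: le_trans (mnorm_mxblock_sum _) _.
by rewrite big_ord_recl big_ord0 big_ord_recl big_ord0 !addr0 mxE.
Qed.

Lemma cext_phi_poly p n (X : ncclosure V2 n) :
  cext (phi (ncpoly_fun V1 p)) n X = ncpoly_eval p (pullc X).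
Proof.
have [c c0 hc] := cl_bounded VP1.
have [K K0 hK] := ncpoly_eval_lip p c0.
have K1 : 0 < K + 1 by rewrite ltr_wpDl.
apply: mnorm_lim_eq => e e0; have e2 : 0 < e / 2 by rewrite divr_gt0.
have eK : 0 < e / 2 / (K + 1) by rewrite divr_gt0.
have [r [r0 r1 [h1 h2]]] := evr_ex (evr_and (cext_evr X (phi_suc (A1 p)) e2)
  (pullc_evr X eK)).
have VrX := cl_tscale VP2 (memV X) r0 r1.
apply: le_trans (mnorm_trans _ (phi (ncpoly_fun V1 p) n (inV VrX)) _) _.
apply: ler_halves; first by rewrite mnormB; apply: h1.
rewrite phi_poly; apply: le_lt_trans (hK _ _ _ (hc _ _ (pull_cl _)) (hc _ _ (pullc_cl _))) _.
have := h2 VrX; rewrite ltr_pdivlMr //; apply: le_lt_trans.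
by rewrite mulrC ler_wpM2l ?tdist_ge0 // lerDl.
Qed.

(** The identity holds for polynomials by [cext_phi_poly], and both sides are linear and contractive
    in [f], so density carries it over: [h = f - p] is small on both sides. *)
Lemma cext_phi f : Aalg V1 f -> cext (phi f) = sfcomp (cext f) hom_map.
Proof.
move=> fA; apply/scalfunP => n X; apply: mnorm_lim_eq => e e0.
have e2 : 0 < e / 2 by rewrite divr_gt0.
have [p hp] := fA.2 _ e2; have [_ lin _ _] := phi_hom.
have fsc := Aalg_suc VP1 fA; have psc := Aalg_suc VP1 (A1 p).
set h := (-1) *: ncpoly_fun V1 p + f.
have hA : Aalg V1 h by apply: Aalg_lin VP1 _ _ _ _ fA.
have hE : h = f - ncpoly_fun V1 p by rewrite /h scaleN1r addrC.
have [M hM] := Aalg_sbounded hA.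
pose s := supnorm h.
have hs : sbounded h s by move=> m Y; apply: le_supnorm hM.
have s0 : 0 <= s.
  have [[m [Y _]]|ne] := pselect (exists n (X : V1 n), True).
    by apply: le_trans (hs _ Y); apply: mnorm_ge0.
  rewrite /s /supnorm (_ : [set r | _] = set0) ?sup0 //.
  by apply/seteqP; split=> // r [m [Y _]]; case: ne; exists m, Y.
have se : s < e / 2 by rewrite /s hE.
have b1 := cext_sbounded VP1 (Aalg_suc VP1 hA) hs (hom_map X).
have b2 := cext_sbounded VP2 (phi_suc hA) (phi_sbounded s0 hA hs) X.
rewrite /h cext_lin // (cext_poly VP1) in b1.
have eh : phi h = (-1) *: phi (ncpoly_fun V1 p) + phi f := lin _ _ _ (A1 p) fA.
rewrite eh (cext_lin _ _ (phi_suc (A1 p)) (phi_suc fA)) cext_phi_poly in b2.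
rewrite scaleN1r addrC in b1; rewrite scaleN1r addrC in b2.
apply: le_trans (mnorm_trans _ (ncpoly_eval p (pullc X)) _) _.
apply: ler_halves; first exact: le_lt_trans b2 se.
by rewrite mnormB; apply: le_lt_trans b1 se.
Qed.

Lemma hom_to_map : exists F : ncmap (ncclosure V2) (ncclosure V1),
  [/\ is_nc (tupfun_of_map F), nc_unif_continuous (tupfun_of_map F) &
    forall f : scalfun V1, Aalg V1 f -> cext (phi f) = sfcomp (cext f) F].
Proof.
exists hom_map; split; [exact: hom_map_nc|exact: hom_map_uc|exact: cext_phi].
Qed.

End HomToMap.

(** * From maps to homomorphisms *)

Section MapToHom.
Context {R : realType}.
Local Notation C := R[i].
Unset Implicit Arguments.
Context {d1 d2 : nat} {Q1 : pencil R d1} {Q2 : pencil R d2}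
  {P1 : set (ncpoly R d1)} {P2 : set (ncpoly R d2)}
  {V1 : ncdom R d1} {V2 : ncdom R d2} (F : ncmap (ncclosure V2) (ncclosure V1)).
Set Implicit Arguments.
Hypotheses (VP1 : pvar Q1 P1 V1) (VP2 : pvar Q2 P2 V2).
Hypotheses (Fnc : is_nc (tupfun_of_map F)) (Fuc : nc_unif_continuous (tupfun_of_map F)).

(** [F] may send points of [V2] to boundary points of [V1], so [f] is extended before composing. *)
Definition pullback (f : scalfun V1) : scalfun V2 :=
  fun n X => cext f n (F n (clV X)).

Lemma comp_suc (h : scalfun (ncclosure V1)) : suc h -> suc (sfcomp h F).
Proof.
move=> hc e e0; have [a a0 ha] := hc _ e0; have [b b0 hb] := Fuc a0.
by exists b => // n X Y XY; apply/ha/hb.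
Qed.

Lemma comp_nc (h : scalfun (ncclosure V1)) : is_nc (tupfun_of_scal h) ->
  is_nc (tupfun_of_scal (sfcomp h F)).
Proof.
move=> [hd hs]; split=> [m n X Y Z ZE|n S X Y Su YE].
  by apply: hd; apply: (Fnc.1 _ _ _ _ _ ZE).
by apply: hs => //; apply: (Fnc.2 _ _ _ _ Su YE).
Qed.

(** No polynomial approximation is constructed by hand: bounded uniformly continuous nc functions
    belong to the algebra by [suc_Aalg]. *)
Lemma pullback_Aalg f : Aalg V1 f -> Aalg V2 (pullback f).
Proof.
move=> fA; have fc := Aalg_suc VP1 fA.
have cc := comp_suc (cext_suc fc).
have [cd cs] := comp_nc (cext_nc VP1 fc (Aalg_nc fA)).
apply: (suc_Aalg VP2).
  split.
    split=> [m n X Y Z ZE|n S X Y Su YE].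
      exact: (cd _ _ (clV X) (clV Y) (clV Z) ZE).
    exact: (cs _ S (clV X) (clV Y) Su YE).
  have [M fM] := Aalg_sbounded fA; exists M => n X.
  exact: (cext_sbounded VP1 fc fM).
move=> e e0; have [dl dl0 hdl] := cc _ e0.
by exists dl => // n X Y XY; apply: (hdl n (clV X) (clV Y)).
Qed.

Lemma pullback_lin a f g : Aalg V1 f -> Aalg V1 g ->
  pullback (a *: f + g) = a *: pullback f + pullback g.
Proof.
move=> fA gA; apply/scalfunP => n X.
exact: (cext_lin a _ (Aalg_suc VP1 fA) (Aalg_suc VP1 gA)).
Qed.

Lemma pullback_hom : alg_hom pullback.
Proof.
split=> [f fA|a f g fA gA|f g fA gA|].
- exact: pullback_Aalg.
- exact: pullback_lin.
- apply/scalfunP => n X; have [M gM] := Aalg_sbounded gA.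
  exact: (cext_mul _ (Aalg_suc VP1 fA) (Aalg_suc VP1 gA) gM).
apply/scalfunP => n X; apply: cext_uniq => e e0; exists 1 => // Y _.
by rewrite subrr mnorm0.
Qed.

Lemma pullback_cext f : Aalg V1 f -> cext (pullback f) = sfcomp (cext f) F.
Proof.
move=> fA; apply/scalfunP => n X.
exact: (cext_of_closed X (comp_suc (cext_suc (Aalg_suc VP1 fA)))).
Qed.

Lemma supnorm_mx_ge0 k (f : 'M[scalfun V1]_k) :
  (forall i j, exists M, sbounded (f i j) M) -> 0 <= supnorm_mx f.
Proof.
move=> fb; have [[n [X _]]|ne] := pselect (exists n (X : V1 n), True).
  by apply: le_trans (le_supnorm_mx X fb); apply: mnorm_ge0.
rewrite /supnorm_mx (_ : [set r | _] = set0) ?sup0 //.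
by apply/seteqP; split=> // r [n [X _]]; case: ne; exists n, X.
Qed.

(** At a possible boundary point [Y = F(X)] the value is approached along [r Y], with one [r] for
    all [k * k] entries; at [r Y] the norm of [f] over [V1] applies. *)
Lemma pullback_cc : completely_contractive pullback.
Proof.
move=> k f fA; have fb i j : exists M, sbounded (f i j) M by apply: Aalg_sbounded.
apply: supnorm_mx_le; first exact: supnorm_mx_ge0.
move=> n X; apply/ler_addgt0Pr => e e0.
pose Y := F n (clV X).
have k0 : 0 < k%:R * k%:R + 1 :> R by rewrite ltr_wpDl // mulr_ge0.
have ek : 0 < e / (k%:R * k%:R + 1) by rewrite divr_gt0.
have [r [r0 r1 h]] := evr_ex (evr_all (fun ij : 'I_k * 'I_k =>
  cext_evr Y (Aalg_suc VP1 (fA ij.1 ij.2)) ek)).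
have VrY := cl_tscale VP1 (memV Y) r0 r1.
pose D a b := cext (f a b) n Y - f a b n (inV VrY).
have -> : \mxblock_(a < k, b < k) (map_mx pullback f) a b n X =
    \mxblock_(a < k, b < k) f a b n (inV VrY) + \mxblock_(a < k, b < k) D a b.
  by apply/matrixP => s t; rewrite !mxE addrC subrK.
apply: le_trans (mnormD _ _) _; apply: lerD; first exact: le_supnorm_mx.
apply: le_trans (mnorm_mxblock_sum _) _.
apply: (@le_trans _ _ (\sum_(a < k) \sum_(b < k) (e / (k%:R * k%:R + 1)))).
  apply: ler_sum => a _; apply: ler_sum => b _; rewrite /D mnormB.
  by apply/ltW; apply: (h (a, b)).
rewrite !sumr_const !card_ord -mulrnA -[_ *+ _]mulr_natr natrM.
by rewrite mulrAC ler_pdivrMr // ler_wpM2l ?(ltW e0) // lerDl.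
Qed.

Lemma pullback_continuous : supnorm_continuous pullback.
Proof.
(* [pullback] is linear and contractive; halving restores the strict inequality lost in the
   supremum. *)
move=> f fA e e0; exists (e / 2); first by rewrite divr_gt0.
move=> g gA gf.
have fgA : Aalg V1 ((-1) *: f + g) by apply: (Aalg_lin VP1).
have fgE : g - f = (-1) *: f + g by rewrite scaleN1r addrC.
have [M hM] := Aalg_sbounded fgA.
have -> : pullback g - pullback f = pullback ((-1) *: f + g).
  by rewrite pullback_lin // scaleN1r addrC.
rewrite fgE in gf.
apply: (@le_lt_trans _ _ (e / 2)); last by rewrite ltr_pdivrMr // ltr_pMr // ltr1n.
apply: supnorm_le; first by rewrite divr_ge0 // ltW.
have hb : sbounded ((-1) *: f + g) (supnorm ((-1) *: f + g)).
  by move=> m Y; apply: le_supnorm hM.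
move=> n X; apply: le_trans (ltW gf).
exact: (cext_sbounded VP1 (Aalg_suc VP1 fgA) hb).
Qed.

Lemma map_to_hom : exists phi : scalfun V1 -> scalfun V2,
  [/\ alg_hom phi, supnorm_continuous phi, completely_contractive phi &
    forall f : scalfun V1, Aalg V1 f -> cext (phi f) = sfcomp (cext f) F].
Proof.
exists pullback; split; [exact: pullback_hom|exact: pullback_continuous|
  exact: pullback_cc|exact: pullback_cext].
Qed.

End MapToHom.

(** * Biholomorphisms and the boundary *)

Section Perturbation.
Context {R : realType}.
Local Notation C := R[i].
Unset Implicit Arguments.
Context {d : nat} {Q : pencil R d} {P : set (ncpoly R d)} {V : ncdom R d}.
Set Implicit Arguments.
Hypothesis VP : pvar Q P V.

(** [V] is relatively open in the zero set of [P]; half of the slack [1 - q] of [W] is spent. *)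
Lemma pvar_near m (W : mtuple R d m) : V m W -> exists2 dl : R, 0 < dl &
  forall Z : mtuple R d m, tdist Z W <= dl ->
    (forall p, P p -> ncpoly_eval p Z = 0) -> V m Z.
Proof.
move=> VW; have [q [q0 q1 Wq]] := pvar_qbound VP VW.
have [K K0 hK] := qbound_crude Q m m.
have K1 : 0 < K + 1 by rewrite ltr_wpDl.
pose t := (1 - q) / 2.
have t0 : 0 < t by rewrite divr_gt0 // subr_gt0.
exists (t / (K + 1)); first by rewrite divr_gt0.
move=> Z ZW pZ.
have -> : Z = fun j => W j + (Z j - W j) by apply/funext => j; rewrite addrC subrK.
have Kt : K * tdist Z W <= t.
  rewrite ler_pdivlMr // in ZW; apply: le_trans ZW.
  by rewrite mulrC ler_wpM2l ?tdist_ge0 // lerDl.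
apply: (@pvarI _ _ _ _ _ VP _ _ (q + t)).
- exact: (pvar_gt0 VP VW).
- by rewrite addr_ge0 // ltW.
- by rewrite /t; move: q1; lra.
- apply: qboundD => //; first exact: ltW.
  apply: qboundW Kt _; first by rewrite mulr_ge0 // tdist_ge0.
  by apply: hK; [exact: tdist_ge0|exact: le_tdist].
move=> p Pp; rewrite (_ : (fun j => _) = Z) ?pZ //.
by apply/funext => j; rewrite addrC subrK.
Qed.

Lemma twine_polys m (W Z : mtuple R d m) (E : 'M[C]_m) : E \in unitmx ->
  (forall j, E *m Z j = W j *m E) -> (forall p, P p -> ncpoly_eval p W = 0) ->
  forall p, P p -> ncpoly_eval p Z = 0.
Proof.
move=> uE EZ pW p Pp; have := ncpoly_eval_twine EZ p.
by rewrite (pW _ Pp) mul0mx => /(congr1 (mulmx (invmx E))); rewrite mulKmx // mulmx0.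
Qed.

Lemma twine_tconj m (W Z : mtuple R d m) (E : 'M[C]_m) : E \in unitmx ->
  (forall j, E *m Z j = W j *m E) -> Z = tconj E W.
Proof. by move=> uE EZ; apply/funext => j; rewrite /tconj -mulmxA -EZ mulKmx. Qed.

(* Conjugating [X (+) Y] by a small multiple of the shear of [L] stays in [V],
   and [g] does not see it. *)
Lemma inj_twine l (g : tupfun V l) : is_nc g ->
  (forall n (X Y : V n), g n X = g n Y -> X = Y) ->
  forall m n (X : V m) (Y : V n) (L : 'M[C]_(n, m)),
  (forall j, L *m g _ X j = g _ Y j *m L) ->
  forall j, L *m val X j = val Y j *m L.
Proof.
move=> [gd gs] ginj m n X Y L gL.
pose W := inV (pvar_dsum VP (memV X) (memV Y)).
pose N : mtuple R d (m + n) :=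
  fun j => block_mx 0 0 (val Y j *m L - L *m val X j) 0.
have [dl dl0 near] := pvar_near (memV W).
have c0 : 0 < tnorm N + 1 by rewrite ltr_wpDl // tnorm_ge0.
pose t := dl / (tnorm N + 1).
have t0 : 0 < t by rewrite divr_gt0.
have tc0 : t%:C%C != 0 :> C by rewrite fmorph_eq0 gt_eqF.
pose E := shear (t%:C%C *: L).
have uE : E \in unitmx := shear_unit _.
pose Z : mtuple R d (m + n) := fun j => val W j + t%:C%C *: N j.
have EZ j : E *m Z j = val W j *m E.
  rewrite /E /shear /Z /N /= /dsum scale_block_mx add_block_mx !mulmx_block.
  rewrite !mulmx0 !mul0mx !mulmx1 !mul1mx !scaler0 !addr0 !add0r.
  congr (block_mx _ _ _ _); last by rewrite mulmx0 add0r.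
  by rewrite -scalemxAl -scalemxAr -scalerDr addrC subrK.
have VZ : V (m + n)%N Z.
  apply: near; last first.
    by apply: (twine_polys uE EZ) => p Pp; apply: (pvar_poly VP (memV W) Pp).
  apply: tnorm_le => [|j]; first exact: ltW.
  rewrite /Z addrC addKr; apply: le_trans (mnormZ_le _ _) _.
  rewrite cn_real (ger0_norm (ltW t0)) /t mulrAC ler_pdivrMr // ler_wpM2l ?(ltW dl0) //.
  by apply: le_trans (le_tnorm N j) _; rewrite lerDl.
have gW : g _ W = dsum (g _ X) (g _ Y) by apply: gd.
have gZ : g _ (inV VZ) = g _ W.
  rewrite (gs _ E W (inV VZ) uE (twine_tconj uE EZ)); apply/tconj_fix => // j.
  by rewrite gW; apply/shear_dsum; rewrite -scalemxAl -scalemxAr gL.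
(* By injectivity the perturbation was trivial: the corner [Y L - L X] of [N] vanishes. *)
have ZW : Z = val W by rewrite -(ginj _ _ _ gZ).
move=> j; have := EZ j; rewrite ZW => /shear_dsum.
by rewrite -scalemxAl -scalemxAr => /(scalerI tc0).
Qed.

(** If [|Q(c - b) v|] is at most a quarter of [|v|], then [|Q(b) v|] is at most [1/2 + 1/4] of it.
    Otherwise the term with [s] uses up at least [s ^ 2 / 16] of [|v| ^ 2]. The first bound, [9/16],
    is below [1 - s ^ 2 / 16] because [s <= 1]. *)
Lemma col_strict n (c b : mtuple R d n) (s : R) : 0 < s -> s <= 1 -> qbound Q c (2^-1) ->
  (forall v, nsq (papp (fun j => s%:C%C *: (c j - b j)) v) + nsq (papp (Q := Q) b v) <= nsq v) ->
  qbound Q b (Num.sqrt (1 - s ^+ 2 / 16)).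
Proof.
move=> s0 s1 cq h v.
have s2 : s ^+ 2 <= 1 by rewrite expr_le1 // ltW.
have q0 : 0 <= 1 - s ^+ 2 / 16 by move: s2; set x := s ^+ 2; lra.
rewrite sqr_sqrtr //.
have := h v; rewrite (eq_nsq (papp_scale _ (fun j => c j - b j) v)) nsqZ.
rewrite cn_real ger0_norm ?(ltW s0) //.
have v0 := nsq_ge0 v; have cb0 := nsq_ge0 (papp (Q := Q) (fun j => c j - b j) v).
have [cbv|cbv] := lerP (nsq (papp (Q := Q) (fun j => c j - b j) v)) (nsq v / 16).
  move=> _; set al := Num.sqrt (nsq v).
  have al2 : al ^+ 2 = nsq v by rewrite sqr_sqrtr.
  have al0 : 0 <= al by rewrite sqrtr_ge0.
  have : nsq (papp (Q := Q) b v) <= (al / 2 + al / 4) ^+ 2.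
    rewrite (eq_nsq (v := fun i => papp (Q := Q) c v i + - papp (Q := Q) (fun j => c j - b j) v i)).
      apply: nsqD; rewrite ?divr_ge0 //.
        have := cq v; rewrite -al2 => /le_trans; apply.
        by rewrite expr_div_n exprVn mulrC.
      rewrite (eq_nsq (v := fun i => (-1 : C) *: papp (Q := Q) (fun j => c j - b j) v i)).
        rewrite nsqZ cnN cn1 expr1n mul1r (le_trans cbv) // -al2 expr_div_n.
        by rewrite (_ : 4 ^+ 2 = 16) // -natrX.
      by move=> i; rewrite scaleN1r.
    move=> i; have := papp_add (Q := Q) b (fun j => c j - b j) v i.
    rewrite (_ : (fun j => _) = c) => [->|]; first by rewrite addrK.
    by apply/funext => j; rewrite addrC subrK.
  move=> /le_trans; apply; rewrite -al2.
  have -> : (al / 2 + al / 4) ^+ 2 = al ^+ 2 * (9 / 16) by field.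
  rewrite mulrC ler_wpM2r ?sqr_ge0 //; move: s2; set x := s ^+ 2; lra.
move: cbv cb0 v0; set x := nsq (papp (fun j => c j - b j) v); set z := nsq v.
set y := nsq (papp b v).
move=> xz x0 z0 hv.
have sx : s ^+ 2 * (z / 16) <= s ^+ 2 * x by rewrite ler_wpM2l ?sqr_ge0 // ltW.
rewrite mulrBl mul1r lerBrDl; apply: le_trans hv; rewrite lerD2r.
by apply: le_trans sx; rewrite mulrAC mulrA.
Qed.

End Perturbation.

(** * Triangular tuples similar to direct sums *)

Section UpperTriangular.
Context {R : realType}.
Local Notation C := R[i].

Definition ushear {n} (s : R) : 'M[C]_(n + n) := block_mx 1%:M (s%:C%C)%:M 0 1%:M.

Lemma ushear_unit {n} s : @ushear n s \in unitmx.
Proof. by rewrite unitmxE /ushear det_ublock !det1 mulr1 unitr1. Qed.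

Definition utri {d n} (s : R) (a b : mtuple R d n) : mtuple R d (n + n) :=
  fun j => block_mx (a j) (s%:C%C *: (a j - b j)) 0 (b j).

Lemma utri_twine {d n} s (a b : mtuple R d n) j :
  ushear s *m utri s a b j = dsum a b j *m ushear s.
Proof.
rewrite /ushear /utri /dsum !mulmx_block !mul1mx !mulmx1 !mulmx0 !mul0mx.
rewrite mul_scalar_mx mul_mx_scalar !addr0 !add0r; congr (block_mx _ _ _ _).
by rewrite -scalerDr subrK.
Qed.

Lemma utri_tconj {d n} s (a b : mtuple R d n) :
  utri s a b = tconj (ushear s) (dsum a b).
Proof. by apply: twine_tconj => [|j]; [exact: ushear_unit|exact: utri_twine]. Qed.

Lemma nc_utri {d l} {V : ncdom R d} (g : tupfun V l) : is_nc g ->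
  forall n s (a b : V n) (D Z : V (n + n)%N), val D = dsum (val a) (val b) ->
  val Z = utri s (val a) (val b) -> g _ Z = utri s (g _ a) (g _ b).
Proof.
move=> [gd gs] n s a b D Z DE ZE.
rewrite (gs _ (ushear s) D Z (ushear_unit s)) ?(gd _ _ _ _ _ DE) ?utri_tconj //.
by rewrite ZE DE utri_tconj.
Qed.

Unset Implicit Arguments.
Context {d : nat} {Q : pencil R d} {P : set (ncpoly R d)} {V : ncdom R d}.
Set Implicit Arguments.
Hypothesis VP : pvar Q P V.

Lemma utri_polys n s (a b : mtuple R d n) : V n a -> V n b ->
  forall p, P p -> ncpoly_eval p (utri s a b) = 0.
Proof.
move=> Va Vb; apply: (twine_polys (ushear_unit s) (utri_twine s a b)) => p Pp.
exact: (pvar_poly VP (pvar_dsum VP Va Vb) Pp).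
Qed.

Lemma small_utri n (a b : mtuple R d n) : V n a -> V n b ->
  exists s, [/\ 0 < s, s <= 1 & V (n + n)%N (utri s a b)].
Proof.
move=> Va Vb; have [dl dl0 near] := pvar_near VP (pvar_dsum VP Va Vb).
pose N : mtuple R d (n + n) := fun j => block_mx 0 (a j - b j) 0 0.
have c0 : 0 < tnorm N + 1 by rewrite ltr_wpDl // tnorm_ge0.
pose s := Num.min 1 (dl / (tnorm N + 1)).
have s0 : 0 < s by rewrite lt_min ltr01 divr_gt0.
exists s; split=> //; first by rewrite ge_min lexx.
apply: near; last exact: utri_polys.
apply: tnorm_le => [|j]; first exact: ltW.
have -> : utri s a b j - dsum a b j = s%:C%C *: N j.
  by rewrite /utri /dsum /N opp_block_mx add_block_mx !subrr !subr0 scale_block_mx !scaler0.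
apply: le_trans (mnormZ_le _ _) _; rewrite cn_real (ger0_norm (ltW s0)).
apply: (@le_trans _ _ (dl / (tnorm N + 1) * (tnorm N + 1))); last by rewrite divfK // gt_eqF.
apply: ler_pM; rewrite ?(ltW s0) ?mnorm_ge0 //; first by rewrite ge_min lexx orbT.
by apply: le_trans (le_tnorm N j) _; rewrite lerDl.
Qed.

Lemma sqrt_lt1 (s : R) : 0 < s -> s <= 1 -> Num.sqrt (1 - s ^+ 2 / 16) < 1.
Proof.
move=> s0 s1; have s2 : 0 < s ^+ 2 by rewrite exprn_gt0.
have s3 : s ^+ 2 <= 1 by rewrite expr_le1 // ltW.
rewrite -[ltRHS]sqrtr1 ltr_sqrt ?ltr01 //; move: s2 s3; set x := s ^+ 2; lra.
Qed.

Lemma utri_strict n (a b : mtuple R d n) (s : R) : 0 < s -> s <= 1 ->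
  qbound Q a (2^-1) -> qbound Q (utri s a b) 1 ->
  qbound Q b (Num.sqrt (1 - s ^+ 2 / 16)).
Proof. by move=> s0 s1 aq Zq; apply: (col_strict s0 s1 aq) => v; apply: column_bound Zq. Qed.

End UpperTriangular.

(** * A biholomorphism of the closures preserves the interiors *)

Section Interior.
Context {R : realType}.
Local Notation C := R[i].
Unset Implicit Arguments.
Context {d1 d2 : nat} {Q1 : pencil R d1} {Q2 : pencil R d2}
  {P1 : set (ncpoly R d1)} {P2 : set (ncpoly R d2)}
  {V1 : ncdom R d1} {V2 : ncdom R d2} (G : ncmap (ncclosure V1) (ncclosure V2))
  (H : ncmap (ncclosure V2) (ncclosure V1)).
Set Implicit Arguments.
Hypotheses (VP1 : pvar Q1 P1 V1) (VP2 : pvar Q2 P2 V2).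
Hypotheses (Gnc : is_nc (tupfun_of_map G)) (Guc : nc_unif_continuous (tupfun_of_map G)).
Hypotheses (Huc : nc_unif_continuous (tupfun_of_map H)).
Hypotheses (GK : forall n, cancel (G n) (H n)) (HK : forall n, cancel (H n) (G n)).

(** Choose [c] in [V1] with [|Q2(G(c))| <= 1/2]. For small [s > 0] the triangular tuple of [c] and
    [X] lies in [V1]; its image is the triangular tuple of [G(c)] and [G(X)] and lies in the closed
    ball, so [utri_strict] puts [G(X)] in the open one. *)
Lemma G_interior n (X : V1 n) : V2 n (val (G n (clV X))).
Proof.
set B := val _.
have clB : ncclosure V2 n B := memV _.
have VO : V2 n (tscale 0 B) := cl_tscale VP2 clB (lexx 0) ltr01.
(* [G] need not fix 0, so the reference point is sought near the preimage of 0. *)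
pose e' := H n (clV (inV VO)).
have Ge' : val (G n e') = tscale 0 B by rewrite /e' HK.
have [K K0 hK] := qbound_crude Q2 n n.
have K1 : 0 < K + 1 by rewrite ltr_wpDl.
have h0 : 0 < 2^-1 :> R by rewrite invr_gt0 ltr0n.
have eta0 : 0 < 2^-1 / (K + 1) by rewrite divr_gt0.
have [dl dl0 hdl] := Guc eta0.
have [r [r0 r1 hr]] := evr_ex (evr_tdist (val e') dl0).
(* The preimage of 0 may itself be a boundary point; shrinking it slightly gives [c] in [V1] while
   keeping [G(c)] near 0. *)
have Vc := cl_tscale VP1 (memV e') r0 r1.
pose c := inV Vc.
have Cc : tdist (val (G n (clV c))) (tscale 0 B) < 2^-1 / (K + 1).
  by rewrite -Ge'; apply: (hdl n (clV c) e').
have Cq : qbound Q2 (val (G n (clV c))) (2^-1).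
  apply: (@qboundW _ _ _ _ _ _ (K * (2^-1 / (K + 1)))).
  - by rewrite mulr_ge0 // ltW.
  - by rewrite mulrCA ler_piMr ?(ltW h0) // ler_pdivrMr // mul1r lerDl.
  apply: hK => [|j]; first exact: ltW.
  apply: le_trans (ltW Cc); apply: le_trans (le_tdist _ _ j).
  by rewrite /tscale scale0r subr0.
have [s [s0 s1 VZ]] := small_utri VP1 Vc (memV X).
have VD := pvar_dsum VP1 Vc (memV X).
have GZ := nc_utri Gnc (a := clV c) (b := clV X) (D := clV (inV VD)) (Z := clV (inV VZ)) erefl erefl.
have Zq := cl_qbound VP2 (memV (G _ (clV (inV VZ)))).
have {}GZ : val (G _ (clV (inV VZ))) = utri s (val (G _ (clV c))) B := GZ.
rewrite GZ in Zq.
apply: (pvarI VP2 (cl_gt0 VP2 clB) _ (sqrt_lt1 s0 s1)).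
- by rewrite sqrtr_ge0.
- exact: utri_strict Cq Zq.
- by move=> p Pp; apply: (cl_poly VP2 clB Pp).
Qed.

Definition rG : tupfun V1 d2 := fun n X => val (G n (clV X)).

Lemma rG_nc : is_nc rG.
Proof.
split=> [m n X Y Z ZE|n S X Y Su YE].
  exact: (Gnc.1 _ _ (clV X) (clV Y) (clV Z) ZE).
exact: (Gnc.2 _ S (clV X) (clV Y) Su YE).
Qed.

Lemma rG_inj n (X Y : V1 n) : rG X = rG Y -> X = Y.
Proof.
move=> XY; have /(can_inj (@GK n)) : G n (clV X) = G n (clV Y) by apply: val_inj.
by move=> /(congr1 val) /= e; apply: val_inj.
Qed.

Lemma rG_utri n s (a b : V1 n) (Z : V1 (n + n)%N) :
  val Z = utri s (val a) (val b) -> rG Z = utri s (rG a) (rG b).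
Proof.
exact: (nc_utri rG_nc (D := inV (pvar_dsum VP1 (memV a) (memV b))) erefl).
Qed.

Lemma evr_gt (q : R) : 0 <= q -> q < 1 -> evr (fun r => q < r).
Proof.
move=> q0 q1; exists (1 - q); first by rewrite subr_gt0 q1 lerBlDr lerDl.
by move=> r; rewrite opprB addrC subrK.
Qed.

Lemma pos_div (x c : R) : 0 < x -> 0 <= c -> 0 < x / (c + 1) /\ c * (x / (c + 1)) <= x.
Proof.
move=> x0 c0; have c1 : 0 < c + 1 by rewrite ltr_wpDl.
split; first by rewrite divr_gt0.
by rewrite mulrCA ler_piMr ?(ltW x0) // ler_pdivrMr // mul1r lerDl.
Qed.

(* [H] is not yet known to be nc, but [z = utri b (G a) (G c)] is a limit of points
   [G w'] with [w'] in [V1], and these are similar to points close to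
   [utri s (G a) (G c) = G (utri s a c)], near which [H] takes values in [V1]. *)
Lemma H_utri n (b : R) (a c : V1 n) (Vz : V2 (n + n)%N (utri b (rG a) (rG c))) :
  0 < b -> val (H _ (clV (inV Vz))) = utri b (val a) (val c).
Proof.
move=> b0; set hz := val _.
have clhz : ncclosure V1 (n + n)%N hz := memV _.
have [s [s0 _ Vs]] := small_utri VP1 (memV a) (memV c).
pose zs' := inV Vs.
have zsE : rG zs' = utri s (rG a) (rG c) by apply: rG_utri.
have Vzs : V2 (n + n)%N (utri s (rG a) (rG c)) by rewrite -zsE; apply: G_interior.
(* [s] is dictated by [V1] whereas [b] is prescribed; conjugation by [T], the block diagonal of 1
   and [t], converts one corner factor into the other. *)
pose t := b / s.
have t0 : t%:C%C != 0 :> C by rewrite fmorph_eq0 gt_eqF // divr_gt0.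
pose T : 'M[C]_(n + n) := block_mx 1%:M 0 0 (t%:C%C)%:M.
have uT : T \in unitmx.
  by rewrite unitmxE /T det_ublock det1 mul1r det_scalar unitfE expf_neq0.
have bts : b%:C%C = t%:C%C * s%:C%C :> C by rewrite -rmorphM /t divfK // gt_eqF.
have TE d (p q : mtuple R d n) j : T *m utri b p q j = utri s p q j *m T.
  rewrite /T /utri !mulmx_block !mul0mx !mulmx0 !mulmx1 !mul1mx !addr0 !add0r.
  by rewrite mul_scalar_mx !mul_mx_scalar scalerA -bts.
suff Th j0 : T *m hz j0 = utri s (val a) (val c) j0 *m T.
  apply/funext => j; rewrite -[hz j](mulKmx uT) Th -TE mulKmx //.
apply: mnorm_lim_eq => e e0; have e2 : 0 < e / 2 by rewrite divr_gt0.
have [d1' d10 near1] := pvar_near VP1 Vs.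
have [d2' d20 near2] := pvar_near VP2 Vzs.
have [eT0 eT] := pos_div e2 (mnorm_ge0 T).
set eta := e / 2 / (mnorm T + 1) in eT0 eT.
have m1 : 0 < Num.min d1' eta by rewrite lt_min d10.
have [dH dH0 hdH] := Huc m1.
have m2 : 0 < Num.min d2' (dH / 2) by rewrite lt_min d20 divr_gt0.
have kT0 : 0 <= mnorm T * mnorm (invmx T) by rewrite mulr_ge0 ?mnorm_ge0.
have [e3 he3] := pos_div m2 kT0.
have [dG dG0 hdG] := Guc e3.
have m3 : 0 < Num.min dG eta by rewrite lt_min dG0.
have [r [r0 r1 hr]] := evr_ex (evr_tdist hz m3).
have Vw' := cl_tscale VP1 clhz r0 r1.
pose w' := inV Vw'.
have zE : val (G _ (H _ (clV (inV Vz)))) = utri b (rG a) (rG c) :=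
  congr1 val (HK (clV (inV Vz))).
have hzr : tdist (tscale r hz) hz < eta.
  by apply: lt_le_trans hr _; rewrite ge_min lexx orbT.
have wz : tdist (rG w') (utri b (rG a) (rG c)) <
    Num.min d2' (dH / 2) / (mnorm T * mnorm (invmx T) + 1).
  rewrite -zE; apply: (hdG _ (clV w')); apply: lt_le_trans hr _.
  by rewrite ge_min lexx.
pose y : mtuple R d2 (n + n) := fun j => T *m rG w' j *m invmx T.
have yT j : T *m rG w' j = y j *m T by rewrite /y mulmxKV.
have ydist : tdist y (utri s (rG a) (rG c)) <= Num.min d2' (dH / 2).
  apply: le_trans he3; apply: tnorm_le => [|j].
    by rewrite mulr_ge0 // ltW.
  have -> : y j - utri s (rG a) (rG c) j =
      T *m (rG w' j - utri b (rG a) (rG c) j) *m invmx T.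
    by rewrite mulmxBr mulmxBl TE mulmxK.
  apply: le_trans (mnormM _ _) _.
  apply: le_trans (ler_wpM2r (mnorm_ge0 _) (mnormM _ _)) _.
  rewrite mulrAC ler_wpM2l // ltW //.
  exact: le_lt_trans (le_tdist _ _ j) wz.
have Vy : V2 (n + n)%N y.
  apply: near2; first by apply: le_trans ydist _; rewrite ge_min lexx.
  apply: (@twine_polys _ _ P2 _ (rG w') y (invmx T)); first by rewrite unitmx_inv.
    by move=> j; rewrite /y -mulmxA mulKmx.
  by move=> p Pp; apply: (pvar_poly VP2 (G_interior w') Pp).
pose y' := H _ (clV (inV Vy)).
have Hzs : H _ (clV (inV Vzs)) = clV zs'.
  by rewrite -(GK (clV zs')); congr (H _ _); apply: val_inj; rewrite /= -zsE.
have y'dist : tdist (val y') (utri s (val a) (val c)) < Num.min d1' eta.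
  have -> : utri s (val a) (val c) = val (H _ (clV (inV Vzs))) by rewrite Hzs.
  apply: (hdH _ (clV (inV Vy)) (clV (inV Vzs))).
  apply: (le_lt_trans ydist); apply: (@le_lt_trans _ _ (dH / 2)).
    by rewrite ge_min lexx orbT.
  by rewrite ltr_pdivrMr // ltr_pMr // ltr1n.
have Vy' : V1 (n + n)%N (val y').
  apply: near1; first by apply: le_trans (ltW y'dist) _; rewrite ge_min lexx.
  by move=> p Pp; apply: (cl_poly VP1 (memV y') Pp).
have rGy' : rG (inV Vy') = y.
  have -> : y = val (G _ y') by rewrite /y' HK.
  by rewrite /rG; congr (val (G _ _)); apply: val_inj.
(* The images [rG w'] and [y] are intertwined by [T] by construction; injectivity transfers this to
   [w'] and [y']. *)
have tw : forall j, T *m val w' j = val (inV Vy') j *m T.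
  by apply: (inj_twine VP1 rG_nc rG_inj) => j; rewrite rGy' yT.
have -> : T *m hz j0 - utri s (val a) (val c) j0 *m T =
    T *m (hz j0 - tscale r hz j0) + (val y' j0 - utri s (val a) (val c) j0) *m T.
  by rewrite mulmxBr mulmxBl (tw j0) subrKA.
apply: le_trans (mnormD _ _) _; rewrite [leRHS](splitr e); apply: lerD.
  apply: le_trans (mnormM _ _) _; apply: le_trans eT; rewrite ler_wpM2l ?mnorm_ge0 //.
  by rewrite mnormB ltW //; apply: le_lt_trans (le_tdist _ _ j0) hzr.
apply: le_trans (mnormM _ _) _; rewrite mulrC.
apply: le_trans eT; rewrite ler_wpM2l ?mnorm_ge0 //.
apply: le_trans (le_tdist _ _ j0) _; apply: le_trans (ltW y'dist) _.
by rewrite ge_min lexx orbT.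
Qed.

(** Let [x' = H(X)]. The triangular tuple of [G(0)] and [G(r x')] is close to [G(0) (+) X], hence in
    [V2], and [H] sends it to the triangular tuple of [0] and [r x']. So [r x'] has norm at most
    [q < 1] under [Q1], with [q] independent of [r]; taking [r > q] bounds that of [x'] by
    [q / r < 1]. *)
Lemma H_interior n (X : V2 n) : V1 n (val (H n (clV X))).
Proof.
set x' := val _; have clx' : ncclosure V1 n x' := memV _.
have Vo : V1 n (tscale 0 x') := cl_tscale VP1 clx' (lexx 0) ltr01.
pose o := rG (inV Vo); have Vo2 : V2 n o := G_interior _.
have [dl dl0 near] := pvar_near VP2 (pvar_dsum VP2 Vo2 (memV X)).
have dl2 : 0 < dl / 2 by rewrite divr_gt0.
pose N : mtuple R d2 (n + n) := fun j => block_mx 0 (o j - val X j) 0 0.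
have [b'0 hb'] := pos_div dl2 (tnorm_ge0 N).
(* Fixed before [r] is chosen, so that the bound [q] obtained from it does not move as [r] tends to
   1. *)
pose b := Num.min 1 (dl / 2 / (tnorm N + 1)).
have b0 : 0 < b by rewrite lt_min ltr01.
have b1 : b <= 1 by rewrite ge_min lexx.
have bN : b * tnorm N <= dl / 2.
  by apply: le_trans hb'; rewrite mulrC ler_wpM2l ?tnorm_ge0 // ge_min lexx orbT.
(* Encodes how the error [xr - X] enters the tuple: with factor [-b] in the corner and factor 1 in
   the lower block. *)
pose S : 'M[C]_(n + n) := block_mx 0 (- (b%:C%C)%:M) 0 1%:M.
have k0 : 0 <= 2 * mnorm S by rewrite mulr_ge0 // mnorm_ge0.
have [eta0 heta] := pos_div dl2 k0.
have [dG dG0 hdG] := Guc eta0.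
pose q := Num.sqrt (1 - b ^+ 2 / 16).
have q1 : q < 1 := sqrt_lt1 b0 b1.
have [r [r0 r1 [hr qr]]] := evr_ex (evr_and (evr_tdist x' dG0)
  (evr_gt (sqrtr_ge0 _) q1)).
have Vr : V1 n (tscale r x') := cl_tscale VP1 clx' r0 r1.
pose xr := rG (inV Vr); have Vxr : V2 n xr := G_interior _.
have xrX : tdist xr (val X) < dl / 2 / (2 * mnorm S + 1).
  have -> : val X = val (G _ (H _ (clV X))) by rewrite HK.
  exact: (hdG n (clV (inV Vr)) (H n (clV X))).
have Vz : V2 (n + n)%N (utri b o xr).
  apply: near; last exact: (utri_polys VP2).
  apply: tnorm_le => [|j]; first exact: ltW.
  have -> : utri b o xr j - dsum o (val X) j = b%:C%C *: N j +
      block_mx (xr j - val X j) 0 0 (xr j - val X j) *m S.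
    rewrite /utri /dsum /N /S opp_block_mx add_block_mx mulmx_block scale_block_mx.
    rewrite !mul0mx !mulmx0 !mulmx1 !scaler0 add_block_mx !addr0 !add0r !subrr !subr0.
    by rewrite mulmxN mul_mx_scalar -scalerBr opprB addrA subrK oppr0.
  apply: le_trans (mnormD _ _) _; rewrite [leRHS](splitr dl); apply: lerD.
    apply: le_trans (mnormZ_le _ _) _; rewrite cn_real (ger0_norm (ltW b0)).
    by apply: le_trans bN; rewrite ler_wpM2l ?(ltW b0) // le_tnorm.
  apply: le_trans (mnormM _ _) _; apply: le_trans heta.
  rewrite mulrAC; apply: ler_wpM2r; first exact: mnorm_ge0.
  apply: le_trans (mnorm_block_diag _ _) _; rewrite [leRHS]mulr_natl mulr2n.
  by apply: lerD; apply: ltW; apply: le_lt_trans (le_tdist _ _ j) xrX.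
have Hz := H_utri Vz b0.
have Zq := cl_qbound VP1 (memV (H _ (clV (inV Vz)))).
rewrite Hz in Zq.
have oq : qbound Q1 (val (inV Vo)) (2^-1).
  have := qboundZ 0%:C%C (cl_qbound VP1 clx'); rewrite cn_real normr0 mul0r.
  by apply: qboundW => //; rewrite invr_ge0 ler0n.
have xq := utri_strict b0 b1 oq Zq.
have r00 : 0 < r by apply: le_lt_trans qr; apply: sqrtr_ge0.
have x'E : x' = tscale r^-1 (tscale r x').
  by rewrite tscaleA mulVf ?gt_eqF // tscale1.
rewrite x'E; apply: (@pvarI _ _ _ _ _ VP1 _ _ (r^-1 * q)).
- exact: (cl_gt0 VP1 clx').
- by rewrite mulr_ge0 ?sqrtr_ge0 // invr_ge0.
- by rewrite mulrC ltr_pdivrMr // mul1r.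
- by have := qboundZ (r^-1%:C%C) xq; rewrite cn_real ger0_norm ?invr_ge0.
by rewrite -x'E => p Pp; apply: (cl_poly VP1 clx' Pp).
Qed.

End Interior.

Section AlgebraProducts.
Context {R : realType}.
Local Notation C := R[i].
Unset Implicit Arguments.
Context {d : nat} {Q : pencil R d} {P : set (ncpoly R d)} {V : ncdom R d}.
Set Implicit Arguments.
Hypothesis VP : pvar Q P V.

Lemma Aalg_mul (f g : scalfun V) : Aalg V f -> Aalg V g -> Aalg V (f * g).
Proof.
move=> fA gA; have [M fM] := Aalg_sbounded fA; have [K gK] := Aalg_sbounded gA.
have [fd fs] := Aalg_nc fA; have [gd gs] := Aalg_nc gA.
have fc := Aalg_suc VP fA; have gc := Aalg_suc VP gA.
apply: (suc_Aalg VP).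
  split.
    split=> [m n X Y Z ZE|n S X Y Su YE]; apply/funext => o; rewrite /tupfun_of_scal.
      have hf := congr1 (fun T => T o) (fd _ _ _ _ _ ZE).
      have hg := congr1 (fun T => T o) (gd _ _ _ _ _ ZE).
      rewrite /tupfun_of_scal /dsum in hf hg *.
      transitivity (f _ Z *m g _ Z); first by [].
      by rewrite hf hg mulmx_block !mulmx0 !mul0mx !addr0 !add0r.
    have hf := congr1 (fun T => T o) (fs _ _ _ _ Su YE).
    have hg := congr1 (fun T => T o) (gs _ _ _ _ Su YE).
    rewrite /tupfun_of_scal /tconj in hf hg *.
    transitivity (f _ Y *m g _ Y); first by [].
    transitivity (invmx S *m (f _ X *m g _ X) *m S); last by [].
    by rewrite hf hg -!mulmxA mulKVmx.
  exists (`|M| * `|K|) => n X; apply: le_trans (mnormM _ _) _.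
  apply: ler_pM; rewrite ?mnorm_ge0 //.
    exact: le_trans (fM _ _) (ler_norm _).
  exact: le_trans (gK _ _) (ler_norm _).
move=> e e0; have e2 : 0 < e / 2 by rewrite divr_gt0.
have M0 : 0 < `|M| + 1 by rewrite ltr_wpDl.
have K0 : 0 < `|K| + 1 by rewrite ltr_wpDl.
have eM : 0 < e / 2 / (`|M| + 1) by rewrite divr_gt0.
have eK : 0 < e / 2 / (`|K| + 1) by rewrite divr_gt0.
have [a a0 ha] := fc _ eK; have [b b0 hb] := gc _ eM.
exists (Num.min a b); first by rewrite lt_min a0.
move=> n X Y; rewrite lt_min => /andP[/ha fXY /hb gXY].
have -> : (f * g) n X - (f * g) n Y =
    (f n X - f n Y) *m g n X + f n Y *m (g n X - g n Y).
  by rewrite mulmxBl mulmxBr subrKA.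
apply: le_lt_trans (mnormD _ _) _; apply: ltr_halves.
  apply: le_lt_trans (mnormM _ _) _.
  apply: (@le_lt_trans _ _ (mnorm (f n X - f n Y) * (`|K| + 1))).
    rewrite ler_wpM2l ?mnorm_ge0 //; apply: le_trans (gK _ _) _.
    by apply: le_trans (ler_norm _) _; rewrite lerDl.
  by rewrite -ltr_pdivlMr.
apply: le_lt_trans (mnormM _ _) _.
apply: (@le_lt_trans _ _ ((`|M| + 1) * mnorm (g n X - g n Y))).
  rewrite ler_wpM2r ?mnorm_ge0 //; apply: le_trans (fM _ _) _.
  by apply: le_trans (ler_norm _) _; rewrite lerDl.
by rewrite mulrC -ltr_pdivlMr.
Qed.

Lemma Aalg1 : Aalg V 1.
Proof.
have -> : 1 = ncpoly_fun V [:: (1, [::])].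
  by apply/scalfunP => n X; rewrite /ncpoly_fun ncpoly_eval1.
exact: Aalg_poly VP _.
Qed.

End AlgebraProducts.

(** * The three equivalent conditions *)

Section Equivalences.
Context {R : realType}.
Local Notation C := R[i].

(** Composition reverses the order: coordinate [j] of the composite is the extension of
    [psi (phi z_j) = z_j]. *)
Lemma hom_map_cancel d1 d2 (Q1 : pencil R d1) (Q2 : pencil R d2) P1 P2
    (V1 : ncdom R d1) (V2 : ncdom R d2) (phi : scalfun V1 -> scalfun V2)
    (psi : scalfun V2 -> scalfun V1) (VP1 : pvar Q1 P1 V1) (VP2 : pvar Q2 P2 V2)
    (ph : alg_hom phi) (pc : completely_contractive phi)
    (sh : alg_hom psi) (sc : completely_contractive psi) :
  (forall f, Aalg V1 f -> psi (phi f) = f) ->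
  forall n, cancel (hom_map VP2 VP1 sh sc (n := n)) (hom_map VP1 VP2 ph pc (n := n)).
Proof.
move=> K n X; apply: val_inj; apply/funext => j.
have zA := Aalg_poly VP1 (ncvar j).
have := cext_phi VP2 VP1 sh sc (phi_Aalg ph zA); rewrite K // => e.
transitivity (cext (ncpoly_fun V1 (ncvar j)) n X); first by rewrite e.
by rewrite (cext_poly VP1) ncpoly_eval_var.
Qed.

(** Each algebraic law for [psi] is checked after applying [phi], which is injective on the
    algebra. *)
Lemma inverse_hom d1 d2 (Q1 : pencil R d1) (Q2 : pencil R d2) P1 P2
    (V1 : ncdom R d1) (V2 : ncdom R d2) (phi : scalfun V1 -> scalfun V2) :
  pvar Q1 P1 V1 -> pvar Q2 P2 V2 -> alg_iso phi -> completely_isometric phi ->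
  exists psi : scalfun V2 -> scalfun V1,
    [/\ alg_hom psi, completely_contractive psi,
        forall f, Aalg V1 f -> psi (phi f) = f &
        forall g, Aalg V2 g -> phi (psi g) = g].
Proof.
move=> VP1 VP2 [[pA lin mul one] [_ inj surj]] iso.
have hpsi g : exists f, Aalg V2 g -> Aalg V1 f /\ phi f = g.
  have [/surj[f fA fg]|ng] := pselect (Aalg V2 g); first by exists f.
  by exists 0.
have [psi hp] := choice hpsi.
have psiA g : Aalg V2 g -> Aalg V1 (psi g) by case/hp.
have psiK g : Aalg V2 g -> phi (psi g) = g by case/hp.
have phi_inj f g : Aalg V1 f -> Aalg V1 g -> phi f = phi g -> f = g.
  by move=> fA gA; apply: inj; apply: mem_set.
have phiK f : Aalg V1 f -> psi (phi f) = f.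
  by move=> fA; exact: phi_inj (psiA _ (pA _ fA)) fA (psiK _ (pA _ fA)).
exists psi; split; [split|move=> k f fA|exact: phiK|exact: psiK].
- exact: psiA.
- move=> a f g fA gA; have [fA' gA'] := (psiA f fA, psiA g gA).
  have fgA := Aalg_lin VP2 a fA gA.
  apply: (phi_inj _ _ (psiA _ fgA) (Aalg_lin VP1 a fA' gA')).
  by rewrite (psiK _ fgA) (lin _ _ _ fA' gA') (psiK _ fA) (psiK _ gA).
- move=> f g fA gA; have [fA' gA'] := (psiA f fA, psiA g gA).
  have fgA := Aalg_mul VP2 fA gA.
  apply: (phi_inj _ _ (psiA _ fgA) (Aalg_mul VP1 fA' gA')).
  by rewrite (psiK _ fgA) (mul _ _ fA' gA') (psiK _ fA) (psiK _ gA).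
- apply: (phi_inj _ _ (psiA _ (Aalg1 VP2)) (Aalg1 VP1)).
  by rewrite (psiK _ (Aalg1 VP2)) one.
rewrite -iso => [|i j]; last by rewrite mxE; apply: psiA.
rewrite (_ : map_mx phi (map_mx psi f) = f) //.
by apply/matrixP => i j; rewrite !mxE psiK.
Qed.

Lemma iso_to_closed_biholo d1 d2 (Q1 : pencil R d1) (Q2 : pencil R d2) P1 P2
    (V1 : ncdom R d1) (V2 : ncdom R d2) (phi : scalfun V1 -> scalfun V2) :
  pvar Q1 P1 V1 -> pvar Q2 P2 V2 -> alg_iso phi -> completely_isometric phi ->
  exists G : ncmap (ncclosure V1) (ncclosure V2), uc_nc_biholomorphism G.
Proof.
move=> VP1 VP2 piso pisom.
have [psi [sh sc phiK psiK]] := inverse_hom VP1 VP2 piso pisom.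
have ph : alg_hom phi := piso.1.
have pc : completely_contractive phi by move=> k f fA; rewrite pisom.
have GK := hom_map_cancel VP1 VP2 ph pc sh sc phiK.
have HK := hom_map_cancel VP2 VP1 sh sc ph pc psiK.
exists (hom_map VP2 VP1 sh sc); split.
- split; first exact: hom_map_nc.
  by move=> n; exists (@hom_map _ _ _ _ _ _ _ _ _ _ VP1 VP2 ph pc n).
- exact: hom_map_uc.
exists (hom_map VP1 VP2 ph pc); split=> //; exact: hom_map_uc.
Qed.

Lemma closed_to_open_biholo d1 d2 (Q1 : pencil R d1) (Q2 : pencil R d2) P1 P2
    (V1 : ncdom R d1) (V2 : ncdom R d2)
    (G : ncmap (ncclosure V1) (ncclosure V2)) :
  pvar Q1 P1 V1 -> pvar Q2 P2 V2 -> uc_nc_biholomorphism G ->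
  exists G' : ncmap V1 V2, uc_nc_biholomorphism G'.
Proof.
move=> VP1 VP2 [[Gnc Gbij] Guc [H [GK HK Huc]]].
have Gin n (X : V1 n) := G_interior VP1 VP2 Gnc Guc HK X.
have Hin n (X : V2 n) := H_interior VP1 VP2 Gnc Guc Huc GK HK X.
pose G' : ncmap V1 V2 := fun n X => inV (Gin n X).
pose H' : ncmap V2 V1 := fun n X => inV (Hin n X).
have GK' n : cancel (G' n) (H' n).
  move=> X; apply: val_inj; rewrite /H' /=.
  by rewrite (_ : clV (G' n X) = G n (clV X)) ?GK //; apply: val_inj.
have HK' n : cancel (H' n) (G' n).
  move=> X; apply: val_inj; rewrite /G' /=.
  by rewrite (_ : clV (H' n X) = H n (clV X)) ?HK //; apply: val_inj.
exists G'; split.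
- by split; [exact: (rG_nc Gnc)|move=> n; exists (H' n)].
- move=> e e0; have [dl dl0 hdl] := Guc _ e0; exists dl => // n X Y XY.
  exact: (hdl n (clV X) (clV Y)).
exists H'; split=> // e e0; have [dl dl0 hdl] := Huc _ e0; exists dl => // n X Y XY.
exact: (hdl n (clV X) (clV Y)).
Qed.

(** Direct sums follow from injectivity of [G] at [H(X) (+) H(Y)]. For a similarity [S], the points
    [X] and [Y] are values of [G], and [inj_twine] transfers their intertwining by [S] to [H(X)] and
    [H(Y)]. *)
Lemma inverse_nc d1 d2 (Q1 : pencil R d1) P1 (V1 : ncdom R d1) (V2 : ncdom R d2)
    (G : ncmap V1 V2) (H : ncmap V2 V1) : pvar Q1 P1 V1 ->
  is_nc (tupfun_of_map G) -> (forall n, cancel (G n) (H n)) ->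
  (forall n, cancel (H n) (G n)) -> is_nc (tupfun_of_map H).
Proof.
move=> VP1 Gnc GK HK.
have Ginj n (X Y : V1 n) : tupfun_of_map G n X = tupfun_of_map G n Y -> X = Y.
  by move=> e; apply: (can_inj (@GK n)); apply: val_inj.
split=> [m n X Y Z ZE|n S X Y Su YE].
  pose W := inV (pvar_dsum VP1 (memV (H m X)) (memV (H n Y))).
  have GW : G _ W = Z.
    apply: val_inj; rewrite ZE -[in RHS](HK m X) -[in RHS](HK n Y).
    exact: (Gnc.1 _ _ (H m X) (H n Y) W erefl).
  by rewrite /tupfun_of_map -GW GK.
have SY j : S *m tupfun_of_map G n (H n Y) j = tupfun_of_map G n (H n X) j *m S.
  by rewrite /tupfun_of_map !HK YE /tconj -mulmxA mulKVmx.
have tw := inj_twine VP1 Gnc Ginj SY.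
exact: twine_tconj.
Qed.

(** [H] is onto, so both suprema run over the same set of values. *)
Lemma supnorm_mx_comp d1 d2 (V1 : ncdom R d1) (V2 : ncdom R d2)
    (G : ncmap V1 V2) (H : ncmap V2 V1) k (f : 'M[scalfun V1]_k) :
  (forall n, cancel (G n) (H n)) ->
  supnorm_mx (map_mx (fun h => sfcomp h H) f) = supnorm_mx f.
Proof.
move=> GK; congr sup; apply/seteqP; split=> r [n [X ->]].
  exists n, (H n X); congr mnorm; apply: eq_mxblock => i j; by rewrite mxE.
exists n, (G n X); congr mnorm; apply: eq_mxblock => i j.
by rewrite mxE /sfcomp GK.
Qed.

Lemma comp_Aalg d1 d2 (Q1 : pencil R d1) (Q2 : pencil R d2) P1 P2
    (V1 : ncdom R d1) (V2 : ncdom R d2) (H : ncmap V2 V1) (f : scalfun V1) :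
  pvar Q1 P1 V1 -> pvar Q2 P2 V2 -> is_nc (tupfun_of_map H) ->
  nc_unif_continuous (tupfun_of_map H) -> Aalg V1 f -> Aalg V2 (sfcomp f H).
Proof.
move=> VP1 VP2 Hnc Huc fA; have [fd fs] := Aalg_nc fA.
apply: (suc_Aalg VP2).
  split.
    split=> [m n X Y Z ZE|n S X Y Su YE].
      exact: (fd _ _ _ _ _ (Hnc.1 _ _ _ _ _ ZE)).
    exact: (fs _ _ _ _ Su (Hnc.2 _ _ _ _ Su YE)).
  by have [M fM] := Aalg_sbounded fA; exists M => n X; apply: fM.
move=> e e0; have [a a0 ha] := Aalg_suc VP1 fA e0; have [b b0 hb] := Huc _ a0.
by exists b => // n X Y XY; apply/ha/hb.
Qed.

(** Composition with the inverse [H]; as [H] maps [V2] into [V1] itself, no extension to the closure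
    is involved. *)
Lemma open_biholo_to_iso d1 d2 (Q1 : pencil R d1) (Q2 : pencil R d2) P1 P2
    (V1 : ncdom R d1) (V2 : ncdom R d2) (G : ncmap V1 V2) :
  pvar Q1 P1 V1 -> pvar Q2 P2 V2 -> uc_nc_biholomorphism G ->
  exists phi : scalfun V1 -> scalfun V2, alg_iso phi /\ completely_isometric phi.
Proof.
move=> VP1 VP2 [[Gnc _] Guc [H [GK HK Huc]]].
have Hnc := inverse_nc VP1 Gnc GK HK.
exists (fun f => sfcomp f H); split; last first.
  by move=> k f _; apply: supnorm_mx_comp GK.
have HA f : Aalg V1 f -> Aalg V2 (sfcomp f H) by apply: comp_Aalg VP1 VP2 Hnc Huc.
split.
  split; [exact: HA|move=> a f g _ _|move=> f g _ _|]; exact: scalfunP.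
split=> [//|f g _ _ fg|g gA].
  apply/scalfunP => n X; have := congr1 (fun h : scalfun V2 => h n (G n X)) fg.
  by rewrite /sfcomp GK.
exists (sfcomp g G); first exact: (comp_Aalg VP2 VP1 Gnc Guc gA).
by apply/scalfunP => n X; rewrite /sfcomp HK.
Qed.

End Equivalences.

Theorem theorem6p1 (R : realType) (d1 d2 : nat)
    (Q1 : pencil R d1) (Q2 : pencil R d2)
    (V1 : ncdom R d1) (V2 : ncdom R d2)
    (V1var : subvariety Q1 V1) (V1hom : homogeneous V1)
    (V2var : subvariety Q2 V2) (V2hom : homogeneous V2) :
  (forall phi : scalfun V1 -> scalfun V2,
     alg_hom phi -> completely_contractive phi ->
     exists F : ncmap (ncclosure V2) (ncclosure V1),
       [/\ is_nc (tupfun_of_map F),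
           nc_unif_continuous (tupfun_of_map F) &
           forall f : scalfun V1, Aalg V1 f ->
             cext (phi f) = sfcomp (cext f) F])
  /\
  (forall F : ncmap (ncclosure V2) (ncclosure V1),
     is_nc (tupfun_of_map F) -> nc_unif_continuous (tupfun_of_map F) ->
     exists phi : scalfun V1 -> scalfun V2,
       [/\ alg_hom phi,
           supnorm_continuous phi,
           completely_contractive phi &
           forall f : scalfun V1, Aalg V1 f ->
             cext (phi f) = sfcomp (cext f) F])
  /\
  [<-> exists phi : scalfun V1 -> scalfun V2,
         alg_iso phi /\ completely_isometric phi;
       exists G : ncmap (ncclosure V1) (ncclosure V2),
         uc_nc_biholomorphism G;
       exists G : ncmap V1 V2,
         uc_nc_biholomorphism G].
Proof.
have VP1 := subvariety_pvar V1var V1hom.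
have VP2 := subvariety_pvar V2var V2hom.
split; first by move=> phi ph pc; apply: hom_to_map VP1 VP2 ph pc.
split; first by move=> F Fnc Fuc; apply: map_to_hom VP1 VP2 Fnc Fuc.
tfae.
- by move=> [phi [iso isom]]; apply: iso_to_closed_biholo VP1 VP2 iso isom.
- by move=> [G hG]; apply: closed_to_open_biholo VP1 VP2 hG.
by move=> [G hG]; apply: open_biholo_to_iso VP1 VP2 hG.
Qed.
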